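(* Let $W$ be a restricted $\mathcal{L}$-module of level $\ell_{123}$. Then there exists a $\phi$-coordinated $V_{\mathfrak{L}}(\ell_{123},0)$-module structure $Y_W(\cdot,x)$ on $W$, uniquely determined by $$Y_W(\overline{L}_{-1}\mathbf{1},x)=\widehat{L}(x),\qquad Y_W(\overline{I}_{-1}\mathbf{1},x)=\widehat{I}(x).$$ Moreover, for $r,s\ge 0$ and $n_i,m_j\in\mathbb{Z}$, $$Y_W(\overline{I}_{m_1}\cdots\overline{I}_{m_s}\overline{L}_{n_1}\cdots\overline{L}_{n_r}\mathbf{1},x)=\widehat{I}(x)^e_{m_1}\cdots\widehat{I}(x)^e_{m_s}\widehat{L}(x)^e_{n_1}\cdots\widehat{L}(x)^e_{n_r}\mathbf{1}_W.$$
   Context: The rank one twisted Heisenberg–Virasoro algebra $\mathcal{L}$ is the complex Lie algebra with basis $\{L_n,I_n,c_1,c_2,c_3: n\in\mathbb{Z}\}$ and brackets $[L_m,L_n]=(m-n)L_{m+n}+\delta_{m+n,0}\frac{m^3-m}{12}c_1$, $[L_m,I_n]=-nI_{m+n}-\delta_{m+n,0}(m^2+m)c_2$, $[I_m,I_n]=m\delta_{m+n,0}c_3$, and $c_1,c_2,c_3$ central. An $\mathcal{L}$-module $W$ is restricted if for each $w\in W$, $L_nw=0$ and $I_nw=0$ for $n$ sufficiently large; it is of level $\ell_{123}=(\ell_1,\ell_2,\ell_3)\in\mathbb{C}^3$ if $c_i$ acts as the scalar $\ell_i$, $i=1,2,3$. On such $W$ set $\widehat{L}(x)=\sum_{n\in\mathbb{Z}}L_nx^{-n}-\frac{\ell_1}{24}$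 and $\widehat{I}(x)=\sum_{n\in\mathbb{Z}}I_nx^{-n}-\ell_2$. Let $\mathfrak{L}$ be the Lie algebra with basis $\{\overline{L}_n,\overline{I}_n,c_1,c_2,c_3:n\in\mathbb{Z}\}$ and brackets $[\overline{L}_m,\overline{L}_n]=(m-n)\overline{L}_{m+n-1}+\frac{m(m-1)(m-2)}{12}\delta_{m+n-2,0}c_1$, $[\overline{L}_m,\overline{I}_n]=-n\overline{I}_{m+n-1}-(m^2-m)\delta_{m+n-1,0}c_2$, $[\overline{I}_m,\overline{I}_n]=m\delta_{m+n,0}c_3$, $c_i$ central. Let $\mathfrak{L}_{\ge0}=\mathrm{span}\{\overline{L}_n,\overline{I}_n:n\ge0\}\oplus\sum_i\mathbb{C}c_i$ act on $\mathbb{C}$ with $\overline L_n,\overline I_n$ ($n\ge0$) acting as $0$ and $c_i$ as $\ell_i$, and $V_{\mathfrak{L}}(\ell_{123},0)=U(\mathfrak{L})\otimes_{U(\mathfrak{L}_{\ge0})}\mathbb{C}$, $\mathbf{1}=1\otimes1$; it is a vertex algebra with vacuum $\mathbf{1}$, $Y(\overline{L}_{-1}\mathbf{1},x)=\sum_n\overline{L}_nx^{-n-1}$, $Y(\overline{I}_{-1}\mathbf{1},x)=\sum_n\overline{I}_nx^{-n-1}$, generated by $\overline{L}_{-1}\mathbf{1},\overline{I}_{-1}\mathbf{1}$. Let $\mathcal{E}(W)=\mathrm{Hom}(W,W((x)))$. A $\phi$-coordinated module ($\phi(x,z)=xe^z$) for a vertex algebra $V$ is a space $W$ with a linear map $Y_W(\cdot,x):V\to\mathcal{E}(W)$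 such that $Y_W(\mathbf{1},x)=\mathbf{1}_W$ (identity) and for $u,v\in V$ there is $k\in\mathbb{N}$ with $(x_1-x_2)^kY_W(u,x_1)Y_W(v,x_2)\in\mathrm{Hom}(W,W((x_1,x_2)))$ and $(x_2e^z-x_2)^kY_W(Y(u,z)v,x_2)=((x_1-x_2)^kY_W(u,x_1)Y_W(v,x_2))|_{x_1=x_2e^z}$. For $a(x),b(x)\in\mathcal{E}(W)$ with $(x_1-x_2)^ka(x_1)b(x_2)\in\mathrm{Hom}(W,W((x_1,x_2)))$, define $a(x)^e_nb(x)$ by $\sum_n a(x)^e_nb(x)z^{-n-1}=(xe^z-x)^{-k}\big((x_1-x)^ka(x_1)b(x)\big)|_{x_1=xe^z}$. *)

(* Defs.v *)
(* Base field: an arbitrary field K of characteristic 0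
   (the paper uses C). *)
From HB Require Import structures.
From mathcomp Require Import all_boot all_order all_algebra.
Set Implicit Arguments. Unset Strict Implicit. Unset Printing Implicit Defensive.
Import Order.TTheory GRing.Theory.
Local Open Scope ring_scope.

Section Defs.
Variable K : fieldType.

Definition lin (U W : lmodType K) (f : U -> W) : Prop :=
  forall (a : K) (u v : U), f (a *: u + v) = a *: f u + f v.

Definition isum (T : zmodType) (lo hi : int) (f : int -> T) : T :=
  if lo <= hi then \sum_(t < (absz (hi - lo)).+1) f (lo + Posz t) else 0.

Definition delta (a b : int) : K := if a == b then 1 else 0.

(* A module of level (l1,l2,l3) for the twisted Heisenberg-Virasoro
   algebra calL: operators L_n, I_n with c_i acting as l_i. *)
Definition calL_module (l1 l2 l3 : K) (W : lmodType K) (L I : int -> W -> W) : Prop :=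
  [/\ (forall n, lin (L n)), (forall n, lin (I n)),
   (forall (m n : int) w, L m (L n w) - L n (L m w) =
       (m - n)%:~R *: L (m + n) w
       + (delta (m + n) 0 * ((m ^+ 3 - m)%:~R / 12%:R) * l1) *: w),
   (forall (m n : int) w, L m (I n w) - I n (L m w) =
       - (n%:~R *: I (m + n) w) - (delta (m + n) 0 * (m ^+ 2 + m)%:~R * l2) *: w) &
   (forall (m n : int) w, I m (I n w) - I n (I m w) =
       (m%:~R * delta (m + n) 0 * l3) *: w)].

Definition restricted (W : lmodType K) (L I : int -> W -> W) : Prop :=
  forall w, exists N : int, forall n, N <= n -> L n w = 0 /\ I n w = 0.

Definition frakL_module (l1 l2 l3 : K) (V : lmodType K) (Lb Ib : int -> V -> V) : Prop :=
  [/\ (forall n, lin (Lb n)), (forall n, lin (Ib n)),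
   (forall (m n : int) v, Lb m (Lb n v) - Lb n (Lb m v) =
       (m - n)%:~R *: Lb (m + n - 1) v
       + ((m * (m - 1) * (m - 2))%:~R / 12%:R * delta (m + n - 2) 0 * l1) *: v),
   (forall (m n : int) v, Lb m (Ib n v) - Ib n (Lb m v) =
       - (n%:~R *: Ib (m + n - 1) v) - ((m ^+ 2 - m)%:~R * delta (m + n - 1) 0 * l2) *: v) &
   (forall (m n : int) v, Ib m (Ib n v) - Ib n (Ib m v) =
       (m%:~R * delta (m + n) 0 * l3) *: v)].

Definition annihilated (V : lmodType K) (Lb Ib : int -> V -> V) (v : V) : Prop :=
  forall n : int, 0 <= n -> Lb n v = 0 /\ Ib n v = 0.

Definition frakL_hom (V M : lmodType K) (Lb Ib : int -> V -> V) (LM IM : int -> M -> M)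
  (f : V -> M) : Prop :=
  [/\ lin f, (forall n v, f (Lb n v) = LM n (f v)) & (forall n v, f (Ib n v) = IM n (f v))].

(* (V, Lb, Ib, vac) is the induced module V_frakL(l123,0) = U(frakL) (x)_{U(frakL_{>=0})} C,
   vac = 1 (x) 1, given by its universal property. *)
Definition is_VfrakL (l1 l2 l3 : K) (V : lmodType K) (Lb Ib : int -> V -> V) (vac : V) : Prop :=
  [/\ frakL_module l1 l2 l3 Lb Ib, annihilated Lb Ib vac &
   forall (M : lmodType K) (LM IM : int -> M -> M) (m : M),
     frakL_module l1 l2 l3 LM IM -> annihilated LM IM m ->
     exists f : V -> M, [/\ frakL_hom Lb Ib LM IM f, f vac = m &
       forall g : V -> M, frakL_hom Lb Ib LM IM g -> g vac = m -> forall v, g v = f v]].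

(* formal series in x with coefficients in End(W): a k = coefficient of x^k *)
Definition ser (W : lmodType K) := int -> W -> W.

(* membership in E(W) = Hom(W, W((x))) *)
Definition inE (W : lmodType K) (a : ser W) : Prop :=
  (forall k, lin (a k)) /\ (forall w, exists N : int, forall k, k < N -> a k w = 0).

Definition idser (W : lmodType K) : ser W := fun k w => if k == 0 then w else 0.

(* modes: Y(u,x) = sum_n u_n x^{-n-1} *)
Definition md (V : lmodType K) (Y : V -> ser V) (u : V) (n : int) : V -> V := Y u (- n - 1).

Definition gbin (p : int) (i : nat) : K :=
  (\prod_(j < i) (p%:~R - (j : nat)%:R)) / (i`!)%:R.

(* vertex algebra (Lepowsky-Li): truncation, vacuum, creation, Jacobi identity
   (in its component form, the Borcherds identity). *)
Definition is_VA (V : lmodType K) (vac : V) (Y : V -> ser V) : Prop :=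
  [/\ (forall u k, lin (Y u k)),
   (forall a u v k w, Y (a *: u + v) k w = a *: Y u k w + Y v k w),
   (forall u v, exists N : int, forall k, k < N -> Y u k v = 0),
   (forall k w, Y vac k w = idser k w) &
   (forall v k, k < 0 -> Y v k vac = 0)] /\ (forall v, Y v 0 vac = v) /\
   (forall u v w (p q r : int), exists M0 : nat, forall M : nat, (M0 <= M)%N ->
     \sum_(i < M) gbin p i *: md Y (md Y u (r + Posz i) v) (p + q - Posz i) w =
     \sum_(i < M) ((-1) ^+ i * gbin r i) *:
        (md Y u (p + r - Posz i) (md Y v (q + Posz i) w)
         - (-1) ^+ (absz r) *: md Y v (q + r - Posz i) (md Y u (p + Posz i) w))).

(* coefficient of x1^i x2^j in (x1 - x2)^k a(x1) b(x2) applied to w *)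
Definition prod2 (W : lmodType K) (k : nat) (a b : ser W) (i j : int) (w : W) : W :=
  \sum_(t < k.+1) ((-1) ^+ (k - t) * ('C(k, t))%:R) *:
      a (i - Posz t) (b (j - Posz k + Posz t) w).

(* the series F(x1,x2) applied to w lies in W((x1,x2)), with truncation bound N *)
Definition trunc2 (W : lmodType K) (F : int -> int -> W -> W) (w : W) (N : int) : Prop :=
  forall i j, (i < N \/ j < N) -> F i j w = 0.

(* coefficient of x2^M z^p of F(x1,x2)|_{x1 = x2 e^z} applied to w, given a
   truncation bound N for F at w *)
Definition substC (W : lmodType K) (F : int -> int -> W -> W) (N M : int) (p : nat) (w : W) : W :=
  ((p`!)%:R)^-1 *: isum N (M - N) (fun i => (i%:~R ^+ p) *: F i (M - i) w).

(* coefficient of z^s in (e^z - 1)^k *)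
Definition ec (k s : nat) : K :=
  ((s`!)%:R)^-1 * \sum_(t < k.+1) ((-1) ^+ (k - t) * ('C(k, t))%:R * ((t : nat)%:R) ^+ s).

(* phi-coordinated module, phi(x,z) = x e^z *)
Definition is_phi_module (V : lmodType K) (vac : V) (Y : V -> ser V)
  (W : lmodType K) (YW : V -> ser W) : Prop :=
  [/\ (forall u, inE (YW u)),
   (forall a u v k w, YW (a *: u + v) k w = a *: YW u k w + YW v k w),
   (forall k w, YW vac k w = idser k w) &
   (forall u v, exists k : nat, forall w, exists N : int,
      trunc2 (prod2 k (YW u) (YW v)) w N /\
      forall (m p Q0 : int), (forall q, q < Q0 -> Y u q v = 0) ->
        isum Q0 p (fun q => ec k (absz (p - q)) *: YW (Y u q v) (m - Posz k) w)
        = (if 0 <= p then substC (prod2 k (YW u) (YW v)) N m (absz p) w else 0))].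

(* power series h(z) = z/(e^z - 1) = (sum_i z^i/(i+1)!)^{-1} *)
Definition gcoef (i : nat) : K := (((i.+1)`!)%:R)^-1.
Fixpoint hseq (j : nat) : seq K :=
  match j with
  | 0 => [:: 1]
  | j'.+1 => let s := hseq j' in
      rcons s (- \sum_(i < j'.+1) gcoef i.+1 * nth 0 s (j' - i))
  end.
Definition hcoef (j : nat) : K := nth 0 (hseq j) j.
(* coefficient of z^j in h(z)^k *)
Fixpoint hpow (k j : nat) : K :=
  match k with
  | 0 => if j == 0%N then 1 else 0
  | k'.+1 => \sum_(i < j.+1) hcoef i * hpow k' (j - i)
  end.
(* coefficient of z^q in (e^z - 1)^{-k} = z^{-k} h(z)^k *)
Definition einv (k : nat) (q : int) : K :=
  if 0 <= q + Posz k then hpow k (absz (q + Posz k)) else 0.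

Definition eprod (W : lmodType K) (a b : ser W) (n : int) (c : ser W) : Prop :=
  exists k : nat, forall w, exists N : int,
    trunc2 (prod2 k a b) w N /\
    forall m, c m w = isum 0 (Posz k - n - 1)
       (fun p => einv k (- n - 1 - p) *: substC (prod2 k a b) N (m + Posz k) (absz p) w).

Fixpoint chain_val (W : lmodType K) (s : seq (ser W * int)) (c : ser W) : Prop :=
  match s with
  | [::] => forall k w, c k w = idser k w
  | (a, n) :: s' => exists b : ser W, chain_val s' b /\ eprod a b n c
  end.

(* \hat L(x) = sum_n L_n x^{-n} - l1/24,  \hat I(x) = sum_n I_n x^{-n} - l2 *)
Definition Lhat (W : lmodType K) (l1 : K) (L : int -> W -> W) : ser W :=
  fun k w => L (- k) w - (if k == 0 then (l1 / 24%:R) *: w else 0).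
Definition Ihat (W : lmodType K) (l2 : K) (I : int -> W -> W) : ser W :=
  fun k w => I (- k) w - (if k == 0 then l2 *: w else 0).

End Defs.

(* Main.v *)
Require Import Defs.
From HB Require Import structures.
From mathcomp Require Import all_boot all_order all_algebra.
From mathcomp Require Import boolp functions.
From mathcomp Require Import ring zify.
Import Order.TTheory GRing.Theory Num.Theory.
Local Open Scope ring_scope.
Set Implicit Arguments. Unset Strict Implicit. Unset Printing Implicit Defensive.

(* Write x1 = x2 e^z and t = x1/x2. If a(x), b(x) are mutually local fields on W, then for
   fixed w and fixed total degree M the coefficients i |-> a_i b_{M-i} w of a(x1) b(x2) w are
   those of a rational function of t with poles at t = 0, 1, oo only, and the products a^e_n b
   are the coefficients of its Laurent expansion at t = e^z. Locality says that
   j |-> [a_j, b_{M-j}] w is polynomial; its coefficients are the a^e_s b, s >= 0.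
   The main point is the commutator formula
     [a^e_n, u^e_m] v = sum_s binom(n,s) (a^e_s u)^e_{n+m-s} v.
   For n >= 0 it expresses that ad a_j is a derivation, for n = -1 it follows by comparing
   a^e_{-1} with the normally ordered product, and for n < -1 one replaces a by (x d/dx) a.
   The same computation shows that a^e_n v stays local to u. Hence the fields which are local
   to \hat L and \hat I form an frakL-module, the universal property of V gives a map
   Y_W : V -> E(W) with Y_W(Lbar_n v) = \hat L^e_n Y_W(v) and Y_W(Ibar_n v) = \hat I^e_n Y_W(v),
   and Y_W(u_n v) = Y_W(u)^e_n Y_W(v) follows for all u by induction on v, because both sides
   obey the same commutator formula with the generators. *)

(** With the total degree fixed, a series in two variables becomes one function on the integers, and
    multiplication by $(x_1-x_2)^k$ becomes a k-th difference. Multiplication by $e^z-1$ is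
    invertible on Laurent series, so an expansion does not depend on the power that clears the
    denominator. Products can therefore be defined without mentioning $k$, and identities between
    them are proved by computing the expansion of one function in two ways. The case $n=-1$ needs
    its own argument because $(x\,d/dx\,a)^e_n=-n\,a^e_{n-1}$ lowers $n$ but gives nothing at $n=0$.
    In the coordinate $e^z$ the product $a^e_{-1}b$ is the normally ordered product only up to
    constants coming from $1/(e^z-1)$, essentially Bernoulli numbers. These must cancel in the
    commutator, and do so thanks to $\omega(-z)=-1-\omega(z)$ for $\omega=1/(e^z-1)$. No basis of V
    is used: the existence half of the universal property yields $Y_W$, the uniqueness half an
    induction principle along the operators of the generators. *)

(** * Sums over the integers with finite support *)

Section FiniteSupportSums.
Variable W : zmodType.
Implicit Types f g : int -> W.

Definition finsupp f := exists s : seq int, forall i, i \notin s -> f i = 0.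

(* The sum over the support; 0 by convention if the support is infinite. *)
Definition fsum f : W :=
  if pselect (finsupp f) is left H then \sum_(i <- undup (projT1 (cid H))) f i else 0.

Lemma sum_support f (s t : seq int) : uniq s -> uniq t ->
  (forall i, i \notin s -> f i = 0) -> (forall i, i \notin t -> f i = 0) ->
  \sum_(i <- s) f i = \sum_(i <- t) f i.
Proof.
move=> us ut hs ht.
have E (r : seq int) : \sum_(i <- r) f i = \sum_(i <- [seq j <- r | f j != 0]) f i.
  rewrite big_filter [LHS](bigID (fun i => f i != 0)) /= [X in _ + X]big1 ?addr0 //.
  by move=> i /negPn /eqP.
rewrite E [RHS]E; apply: perm_big; apply: uniq_perm; rewrite ?filter_uniq //.
move=> i; rewrite !mem_filter; case: eqP => //= fi.
by case: (boolP (i \in s)) => [_|/hs //]; case: (boolP (i \in t)) => [//|/ht].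
Qed.

Lemma fsumE f (s : seq int) : uniq s -> (forall i, i \notin s -> f i = 0) ->
  fsum f = \sum_(i <- s) f i.
Proof.
move=> us hs; rewrite /fsum; case: pselect => [H|[]]; last by exists s.
apply: sum_support => //; first exact: undup_uniq.
by move=> i; rewrite mem_undup; move: (projT2 (cid H)); apply.
Qed.

Lemma finsuppP f : finsupp f -> exists2 s, uniq s & forall i, i \notin s -> f i = 0.
Proof.
by case=> s hs; exists (undup s); [exact: undup_uniq|move=> i; rewrite mem_undup; exact: hs].
Qed.

Definition zrange (lo : int) (n : nat) : seq int := [seq lo + Posz t | t <- iota 0 n].

Lemma mem_zrange lo n i : (i \in zrange lo n) = (lo <= i < lo + Posz n).
Proof.
apply/mapP/idP => [[t]|/andP[h1 h2]]; first by rewrite mem_iota => ? ->; lia.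
by exists (absz (i - lo)); rewrite ?mem_iota; lia.
Qed.

Lemma zrange_uniq lo n : uniq (zrange lo n).
Proof. by rewrite map_inj_uniq ?iota_uniq // => a b; lia. Qed.

Lemma finsupp_itv f lo hi : (forall i, i < lo -> f i = 0) -> (forall i, hi < i -> f i = 0) -> finsupp f.
Proof.
move=> h1 h2; exists (zrange lo (absz (hi - lo)).+1) => i.
rewrite mem_zrange => hi'; case: (ltP i lo) => [/h1 //|h3]; apply: h2; lia.
Qed.

Lemma fsum_range f lo n :
  (forall i, i < lo -> f i = 0) -> (forall i, lo + Posz n <= i -> f i = 0) ->
  fsum f = \sum_(t < n) f (lo + Posz t).
Proof.
move=> h1 h2; rewrite (fsumE (zrange_uniq lo n)); last first.
  move=> i; rewrite mem_zrange => hi.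
  by case: (ltP i lo) => [/h1 //|h3]; apply: h2; lia.
by rewrite big_map -(big_mkord xpredT (fun t => f (lo + Posz t))) /index_iota subn0.
Qed.

(** If [lo > hi], the two vanishing hypotheses force [f] to be zero everywhere, in agreement with
    the default value of [isum]. *)
Lemma fsum_isum f lo hi : (forall i, i < lo -> f i = 0) -> (forall i, hi < i -> f i = 0) ->
  isum lo hi f = fsum f.
Proof.
move=> h1 h2; rewrite /isum; case: ifP => h.
  by rewrite (@fsum_range f lo (absz (hi - lo)).+1) // => i hi'; apply: h2; lia.
rewrite (@fsum_range f lo 0) ?big_ord0 // => i hi'; apply: h2; lia.
Qed.

Lemma eq_fsum f g : f =1 g -> fsum f = fsum g.
Proof. by move/funext->. Qed.

Lemma fsum0 f : (forall i, f i = 0) -> fsum f = 0.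
Proof. by move=> h; rewrite (@fsumE f [::]) ?big_nil. Qed.

Lemma fsum1 f i : (forall j, j != i -> f j = 0) -> fsum f = f i.
Proof.
move=> h; rewrite (@fsumE f [:: i]) ?big_seq1 // => j; rewrite inE; exact: h.
Qed.

Lemma finsupp2 f g : finsupp f -> finsupp g ->
  exists s, [/\ uniq s, forall i, i \notin s -> f i = 0 & forall i, i \notin s -> g i = 0].
Proof.
case=> s hs [t ht]; exists (undup (s ++ t)); split; first exact: undup_uniq.
  by move=> i; rewrite mem_undup mem_cat negb_or => /andP[/hs].
by move=> i; rewrite mem_undup mem_cat negb_or => /andP[_ /ht].
Qed.

Lemma finsuppD f g : finsupp f -> finsupp g -> finsupp (f + g).
Proof.
move=> ff fg; case: (finsupp2 ff fg) => s [_ h1 h2]; exists s => i hi.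
by rewrite addrfctE h1 // h2 // addr0.
Qed.

Lemma fsumD f g : finsupp f -> finsupp g -> fsum (fun i => f i + g i) = fsum f + fsum g.
Proof.
move=> ff fg; case: (finsupp2 ff fg) => s [us h1 h2].
rewrite !(fsumE us) ?big_split // => i hi; by rewrite h1 // h2 // addr0.
Qed.

(** If the support is infinite, so is that of the negative, and both sides take the default value
    0. *)
Lemma fsumN f : fsum (fun i => - f i) = - fsum f.
Proof.
case: (pselect (finsupp f)) => [ff|nf].
  case: (finsuppP ff) => s us hs; rewrite !(fsumE us) ?sumrN // => i hi.
  by rewrite hs // oppr0.
rewrite /fsum; case: pselect => [H|_]; last by case: pselect; rewrite ?oppr0.
by case: nf; case: H => s hs; exists s => i /hs /eqP; rewrite oppr_eq0 => /eqP.
Qed.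

Lemma finsuppN f : finsupp f -> finsupp (fun i => - f i).
Proof. by case=> s hs; exists s => i /hs ->; rewrite oppr0. Qed.

Lemma finsupp_reindex f (h h' : int -> int) : cancel h h' -> cancel h' h -> finsupp f -> finsupp (f
    \o h).
Proof.
move=> hK h'K [s hs]; exists [seq h' i | i <- s] => i hi /=; apply: hs.
by apply: contra hi => hi; apply/mapP; exists (h i).
Qed.

Lemma fsum_reindex f (h h' : int -> int) : cancel h h' -> cancel h' h ->
  fsum (fun i => f (h i)) = fsum f.
Proof.
move=> hK h'K; case: (pselect (finsupp f)) => [ff|nf].
  case: (finsuppP ff) => s us hs; rewrite [RHS](fsumE us) // (@fsumE _ [seq h' i | i <- s]).
  - by rewrite big_map; apply: eq_bigr => i _; rewrite h'K.
  - by rewrite map_inj_uniq //; apply: can_inj h'K.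
  - move=> i hi; apply: hs; apply: contra hi => hi; apply/mapP; exists (h i) => //.
rewrite /fsum; case: pselect => [H|_]; last by case: pselect.
case: nf; have := finsupp_reindex h'K hK H.
by case=> s hs; exists s => i /hs /=; rewrite h'K.
Qed.

Lemma fsum_shift f c : fsum (fun i => f (i + c)) = fsum f.
Proof. by apply: (@fsum_reindex f (fun i => i + c) (fun i => i - c)) => i; rewrite ?addrK ?subrK. Qed.

Lemma fsum_refl f c : fsum (fun i => f (c - i)) = fsum f.
Proof. by apply: (@fsum_reindex f (fun i => c - i) (fun i => c - i)) => i; lia. Qed.

Lemma fsum_exch (f : int -> int -> W) (s t : seq int) :
  (forall i j, i \notin s -> f i j = 0) -> (forall i j, j \notin t -> f i j = 0) ->
  fsum (fun i => fsum (fun j => f i j)) = fsum (fun j => fsum (fun i => f i j)).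
Proof.
move=> hs ht; rewrite (@fsumE _ (undup s)) ?undup_uniq //; last first.
  by move=> i; rewrite mem_undup => hi; apply: fsum0 => j; exact: hs.
rewrite [RHS](@fsumE _ (undup t)) ?undup_uniq //; last first.
  by move=> i; rewrite mem_undup => hi; apply: fsum0 => j; exact: ht.
under eq_bigr => i _.
  rewrite (@fsumE _ (undup t)) ?undup_uniq //; last by move=> j; rewrite mem_undup; exact: ht.
  over.
rewrite exchange_big /=; apply: eq_bigr => j _.
by rewrite (@fsumE _ (undup s)) ?undup_uniq // => i; rewrite mem_undup; exact: hs.
Qed.

Lemma fsum_sum (I : Type) (r : seq I) (f : I -> int -> W) :
  (forall t, finsupp (f t)) -> fsum (fun i => \sum_(t <- r) f t i) = \sum_(t <- r) fsum (f t).
Proof.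
move=> hf; elim: r => [|t r IH]; first by rewrite big_nil fsum0 // => i; rewrite big_nil.
rewrite big_cons -IH -fsumD //.
  by apply: eq_fsum => i; rewrite big_cons.
elim: r {IH} => [|u r IH]; first by exists [::] => i _; rewrite big_nil.
case: (finsupp2 (hf u) IH) => s [_ h1 h2]; exists s => i hi.
by rewrite big_cons h1 // h2 // addr0.
Qed.

End FiniteSupportSums.

(** * Linear maps and finite sums *)

Section LinearMaps.
Variable K : fieldType.
Variables U W : lmodType K.
Implicit Types f : U -> W.

Lemma linD f : lin f -> {morph f : u v / u + v}.
Proof. by move=> h u v; have := h 1 u v; rewrite !scale1r. Qed.
Lemma lin0 f : lin f -> f 0 = 0.
Proof. by move=> h; apply: (addrI (f 0)); rewrite -linD // !addr0. Qed.
Lemma linZ f : lin f -> forall a, {morph f : u / a *: u}.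
Proof. by move=> h a u; have := h a u 0; rewrite (lin0 h) !addr0. Qed.
Lemma linN f : lin f -> {morph f : u / - u}.
Proof. by move=> h u; rewrite -scaleN1r linZ // scaleN1r. Qed.
Lemma linB f : lin f -> {morph f : u v / u - v}.
Proof. by move=> h u v; rewrite linD // linN. Qed.
Lemma lin_sum f (I : Type) (r : seq I) (P : pred I) (F : I -> U) : lin f ->
  f (\sum_(i <- r | P i) F i) = \sum_(i <- r | P i) f (F i).
Proof. by move=> h; apply: (big_morph f (linD h) (lin0 h)). Qed.

Lemma fsum_lin f (g : int -> U) : lin f -> finsupp g -> f (fsum g) = fsum (fun i => f (g i)).
Proof.
move=> h fg; case: (finsuppP fg) => s us hs; rewrite !(fsumE us) ?lin_sum //.
by move=> i /hs ->; rewrite lin0.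
Qed.

Lemma finsupp_lin f (g : int -> U) : lin f -> finsupp g -> finsupp (fun i => f (g i)).
Proof. by move=> h [s hs]; exists s => i /hs ->; rewrite lin0. Qed.

End LinearMaps.

Lemma lin_scale (K : fieldType) (W : lmodType K) (a : K) : lin (fun w : W => a *: w).
Proof. by move=> b u v; rewrite scalerDr !scalerA mulrC. Qed.

Lemma lin_scalel (K : fieldType) (W : lmodType K) (w : W) : lin (fun a : K^o => a *: w).
Proof. by move=> b u v; rewrite scalerDl scalerA. Qed.

(** * Laurent series in z with coefficients in a module *)

Section Laurent.
Variable K : fieldType.
Implicit Types (W : lmodType K) (c d : int -> K).

(* A function A : int -> W stands for the Laurent series sum_q A(q) z^q. *)
Definition bdd W (A : int -> W) := exists Q : int, forall q, q < Q -> A q = 0.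

Definition conv W c (A : int -> W) : int -> W := fun p => fsum (fun q => c (p - q) *: A q).

Definition cmul c d : int -> K := @conv K^o c d.

Definition bddK c := @bdd K^o c.

Definition unit_ser : int -> K := fun p => (p == 0)%:R.

Lemma bdd0 W : bdd (fun=> 0 : W).
Proof. by exists 0. Qed.

Lemma bddD W (A B : int -> W) : bdd A -> bdd B -> bdd (A + B).
Proof.
case=> Q hQ [R hR]; exists (Num.min Q R) => q; rewrite lt_min => /andP[/hQ h1 /hR h2].
by rewrite addrfctE h1 h2 addr0.
Qed.

Lemma bdd_lin (U W : lmodType K) (f : U -> W) A : lin f -> bdd A -> bdd (fun q => f (A q)).
Proof. by move=> lf [Q hQ]; exists Q => q /hQ ->; rewrite lin0. Qed.

Lemma bddZ W (A : int -> W) a : bdd A -> bdd (a *: A).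
Proof. by move=> h; apply: (bdd_lin (lin_scale a) h). Qed.

Lemma bddN W (A : int -> W) : bdd A -> bdd (- A).
Proof. by rewrite -scaleN1r; exact: bddZ. Qed.

Lemma bddB W (A B : int -> W) : bdd A -> bdd B -> bdd (A - B).
Proof. by move=> h1 h2; apply/bddD/bddN. Qed.

Lemma bddK_unit : bddK unit_ser.
Proof. by exists 0 => q hq; rewrite /unit_ser; case: eqP => //; lia. Qed.

Lemma conv_finsupp W c (A : int -> W) p : bddK c -> bdd A -> finsupp (fun q => c (p - q) *: A q).
Proof.
case=> Q hQ [R hR]; apply: (@finsupp_itv _ _ R (p - Q)) => q hq; first by rewrite hR ?scaler0.
by rewrite hQ ?scale0r //; lia.
Qed.

Lemma bdd_conv W c (A : int -> W) : bddK c -> bdd A -> bdd (conv c A).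
Proof.
case=> Q hQ [R hR]; exists (Q + R) => p hp; apply: fsum0 => q.
case: (ltP q R) => [/hR -> |hq]; first by rewrite scaler0.
by rewrite hQ ?scale0r //; lia.
Qed.

Lemma convDr W c (A B : int -> W) : bddK c -> bdd A -> bdd B -> conv c (A + B) = conv c A + conv c B.
Proof.
move=> hc hA hB; apply/funext => p; rewrite /conv !addrfctE -fsumD; try exact: conv_finsupp.
by apply: eq_fsum => q; exact: scalerDr.
Qed.

Lemma conv_lin (U W : lmodType K) (f : U -> W) c A : lin f -> bddK c -> bdd A ->
  conv c (fun q => f (A q)) = fun p => f (conv c A p).
Proof.
move=> lf hc hA; apply/funext => p; rewrite /conv fsum_lin //; last exact: conv_finsupp.
by apply: eq_fsum => q; rewrite linZ.
Qed.

Lemma convNr W c (A : int -> W) : conv c (- A) = - conv c A.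
Proof. by apply/funext => p; rewrite -[RHS]/(- fsum _) -fsumN; apply: eq_fsum => q; exact: scalerN. Qed.

Lemma convBr W c (A B : int -> W) : bddK c -> bdd A -> bdd B -> conv c (A - B) = conv c A - conv c B.
Proof. by move=> hc hA hB; rewrite convDr ?convNr //; apply: bddN. Qed.

Lemma convDl W c d (A : int -> W) : bddK c -> bddK d -> bdd A ->
  conv (c + d) A = conv c A + conv d A.
Proof.
move=> hc hd hA; apply/funext => p; rewrite /conv !addrfctE -fsumD; try exact: conv_finsupp.
by apply: eq_fsum => q; exact: scalerDl.
Qed.

Lemma convZl W c (A : int -> W) (a : K) : bddK c -> bdd A ->
  conv (fun q => a * c q) A = a *: conv c A.
Proof.
move=> hc hA; apply/funext => p; rewrite -[RHS]/(a *: fsum _).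
rewrite (fsum_lin (lin_scale a)); last exact: conv_finsupp.
by apply: eq_fsum => q; rewrite scalerA.
Qed.

Lemma conv_scalar W c d (w : W) : bddK c -> bddK d ->
  conv c (fun q => d q *: w) = fun p => cmul c d p *: w.
Proof. by move=> hc hd; have := @conv_lin K^o W (fun a => a *: w) c d (lin_scalel w) hc hd. Qed.

Lemma cmulC c d : cmul c d = cmul d c.
Proof.
apply/funext => p; rewrite /cmul /conv -(fsum_refl _ p); apply: eq_fsum => q.
by rewrite /= opprB addrCA subrr addr0; exact: mulrC.
Qed.

(** Lower bounds on the three factors confine the double sum at a fixed exponent to a finite box, so
    the order of summation may be exchanged. *)
Lemma convA W c d (A : int -> W) : bddK c -> bddK d -> bdd A ->
  conv c (conv d A) = conv (cmul c d) A.
Proof.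
move=> hc hd hA; apply/funext => p; rewrite /conv.
transitivity (fsum (fun q => fsum (fun r => (c (p - q) * d (q - r)) *: A r))).
  apply: eq_fsum => q; rewrite (fsum_lin (lin_scale _)); last exact: conv_finsupp.
  by apply: eq_fsum => r; rewrite scalerA.
case: (hc) => Qc hQc; case: (hd) => Qd hQd; case: (hA) => QA hQA.
rewrite (@fsum_exch _ _ (zrange (QA + Qd) (absz (p - Qc - (QA + Qd))%R).+1)
                     (zrange QA (absz (p - Qc - Qd - QA)%R).+1)).
- apply: eq_fsum => r; rewrite /cmul /conv.
  rewrite (fsum_lin (lin_scalel (A r))); last exact: (@conv_finsupp K^o).
  rewrite -[RHS](fsum_shift _ (- r)); apply: eq_fsum => q.
  by congr (_ *: _); congr (c _ * d _); lia.
- move=> q r; rewrite mem_zrange => hq.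
  case: (ltP r QA) => [/hQA -> |h1]; first by rewrite scaler0.
  case: (ltP (q - r) Qd) => [/hQd -> |h2]; first by rewrite mulr0 scale0r.
  by rewrite hQc ?mul0r ?scale0r //; lia.
- move=> q r; rewrite mem_zrange => hq.
  case: (ltP r QA) => [/hQA -> |h1]; first by rewrite scaler0.
  case: (ltP (q - r) Qd) => [/hQd -> |h2]; first by rewrite mulr0 scale0r.
  by rewrite hQc ?mul0r ?scale0r //; lia.
Qed.

Lemma conv_swap W c d (A : int -> W) : bddK c -> bddK d -> bdd A ->
  conv c (conv d A) = conv d (conv c A).
Proof. by move=> hc hd hA; rewrite !convA // cmulC. Qed.

Lemma conv1 W (A : int -> W) : conv unit_ser A = A.
Proof.
apply/funext => p; rewrite /conv (@fsum1 _ _ p) /unit_ser ?subrr ?scale1r //.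
by move=> j; case: (p - j =P 0); rewrite ?scale0r //; lia.
Qed.

Lemma cmul1 c : cmul c unit_ser = c.
Proof. by rewrite cmulC /cmul conv1. Qed.

(* d/dz *)
Definition lderiv W (A : int -> W) : int -> W := fun p => (p + 1)%:~R *: A (p + 1).

Definition lderivK c : int -> K := @lderiv K^o c.

Lemma bdd_lderiv W (A : int -> W) : bdd A -> bdd (lderiv A).
Proof. by case=> Q hQ; exists (Q - 1) => q hq; rewrite /lderiv hQ ?scaler0 //; lia. Qed.

Lemma lderiv_conv W c (A : int -> W) : bddK c -> bdd A ->
  lderiv (conv c A) = conv (lderivK c) A + conv c (lderiv A).
Proof.
move=> hc hA; apply/funext => p; rewrite addrfctE {1}/lderiv /conv.
have -> : fsum (fun q => c (p - q) *: lderiv A q) = fsum (fun q => c (p + 1 - q) *: (q%:~R *: A q)).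
  rewrite -(fsum_shift (fun q => c (p + 1 - q) *: (q%:~R *: A q)) 1).
  by apply: eq_fsum => q; rewrite /lderiv; congr (c _ *: _); lia.
rewrite (fsum_lin (lin_scale _)); last exact: conv_finsupp.
rewrite -fsumD.
- apply: eq_fsum => q; have -> : lderivK c (p - q) = (p - q + 1)%:~R * c (p - q + 1) by [].
  rewrite !scalerA -scalerDl.
  have -> : p - q + 1 = p + 1 - q by lia.
  congr (_ *: A q); rewrite !rmorphD rmorphN /=; ring.
- by apply: conv_finsupp => //; apply: (@bdd_lderiv K^o).
- apply: (@conv_finsupp _ c (fun q => q%:~R *: A q)) => //.
  by case: hA => Q hQ; exists Q => q /hQ ->; rewrite scaler0.
Qed.

End Laurent.

(** * The series e^{jz} and 1/(e^z - 1) *)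

Section Char0.
Variable K : fieldType.
Hypothesis charK : [pchar K] =i pred0.

Lemma natK_eq0 n : (n%:R == 0 :> K) = (n == 0%N).
Proof. exact: (proj1 (pcharf0P K) charK n). Qed.

Lemma factK_neq0 n : (n`!)%:R != 0 :> K.
Proof. by rewrite natK_eq0 -lt0n fact_gt0. Qed.

Lemma natSK_neq0 n : (n.+1)%:R != 0 :> K.
Proof. by rewrite natK_eq0. Qed.

(* coefficient of z^p in e^{jz} *)
Definition expz (j p : int) : K :=
  if 0 <= p then j%:~R ^+ absz p / ((absz p)`!)%:R else 0.

Lemma expz_neg j p : p < 0 -> expz j p = 0.
Proof. by rewrite /expz; case: ifP => //; lia. Qed.

Lemma expz_nat j (p : nat) : expz j p = j%:~R ^+ p / (p`!)%:R.
Proof. by []. Qed.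

Lemma bddK_expz j : bddK (expz j).
Proof. by exists 0 => q; exact: expz_neg. Qed.

Lemma expz0 p : expz 0 p = unit_ser K p.
Proof.
rewrite /unit_ser; case: p => [[|p]|p].
- by rewrite expz_nat expr0 divr1.
- by rewrite expz_nat expr0n mul0r.
- by rewrite expz_neg.
Qed.

Lemma expz_0 j : expz j 0 = 1.
Proof. by rewrite expz_nat expr0 divr1. Qed.

Lemma expzD i j : cmul (expz i) (expz j) = expz (i + j).
Proof.
apply/funext => p; case: (ltP p 0) => hp.
  rewrite expz_neg //; apply: fsum0 => q; case: (ltP q 0) => hq.
    by rewrite [expz j q]expz_neg // scaler0.
  by rewrite expz_neg ?scale0r //; lia.
case: p hp => // n _; rewrite /cmul /conv (@fsum_range _ _ 0 n.+1).
- rewrite expz_nat rmorphD exprDn mulr_suml; apply: eq_bigr => t _.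
  have ht : (t <= n)%N by rewrite -ltnS.
  rewrite add0r subzn // !expz_nat -[_ *: _]/(_ * _).
  rewrite -mulr_natr -(bin_fact ht) !natrM.
  field.
  rewrite !factK_neq0 natK_eq0 -lt0n bin_gt0 ht //.
- by move=> q hq; rewrite [expz j q]expz_neg // scaler0.
- by move=> q hq; rewrite expz_neg ?scale0r //; lia.
Qed.

Lemma lderiv_expz j : lderivK (expz j) = fun p => j%:~R * expz j p.
Proof.
apply/funext => p; rewrite -[LHS]/((p + 1)%:~R * expz j (p + 1)); case: (ltP p 0) => hp.
  rewrite [expz j p]expz_neg // mulr0; case: (p =P -1) => [->|?].
    by rewrite addNr mul0r.
  by rewrite expz_neg ?mulr0 //; lia.
case: p hp => // n _; rewrite -PoszD !expz_nat addn1 factS natrM exprS -[n.+1%:~R]/(n.+1%:R).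
by move: (n.+1%:R : K) (natSK_neq0 n) => x h; field; rewrite factK_neq0 h.
Qed.

(* substitution t = e^z in the Laurent polynomial sum_i P(i) t^i *)
Definition expsum (W : lmodType K) (P : int -> W) : int -> W :=
  fun p => fsum (fun i => expz i p *: P i).

Lemma finsupp_scale (W : lmodType K) (c : int -> K) (P : int -> W) : finsupp P -> finsupp (fun i =>
    c i *: P i).
Proof. by case=> s hs; exists s => i /hs ->; rewrite scaler0. Qed.

Lemma bdd_expsum (W : lmodType K) (P : int -> W) : bdd (expsum P).
Proof. by exists 0 => p hp; apply: fsum0 => i; rewrite expz_neg // scale0r. Qed.

Lemma expsumD (W : lmodType K) (P Q : int -> W) : finsupp P -> finsupp Q -> expsum (P + Q) = expsum
    P + expsum Q.
Proof.
move=> fP fQ; apply/funext => p; rewrite /expsum !addrfctE -fsumD; try exact: finsupp_scale.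
by apply: eq_fsum => i; exact: scalerDr.
Qed.

Lemma expsum_lin (U W : lmodType K) (f : U -> W) P : lin f -> finsupp P ->
  expsum (fun i => f (P i)) = fun p => f (expsum P p).
Proof.
move=> lf fP; apply/funext => p; rewrite /expsum fsum_lin //; last exact: finsupp_scale.
by apply: eq_fsum => i; rewrite linZ.
Qed.

(** Under $t=e^z$, multiplication by $t^j$ becomes multiplication by $e^{jz}$. *)
Lemma expsum_shift (W : lmodType K) j (P : int -> W) : finsupp P ->
  expsum (fun i => P (i - j)) = conv (expz j) (expsum P).
Proof.
move=> fP; apply/funext => p; rewrite /expsum /conv.
rewrite -(fsum_shift _ j).
transitivity (fsum (fun i => fsum (fun q => (expz j (p - q) * expz i q) *: P i))).
  apply: eq_fsum => i; rewrite addrK addrC -expzD /cmul /conv.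
  by rewrite (fsum_lin (lin_scalel (P i))) //; apply: (@conv_finsupp _ K^o); apply: bddK_expz.
case: (fP) => s hs.
rewrite (@fsum_exch _ _ s (zrange 0 (absz p).+1)).
- apply: eq_fsum => q; rewrite (fsum_lin (lin_scale _)); last exact: finsupp_scale.
  by apply: eq_fsum => i; rewrite scalerA.
- by move=> i q /hs ->; rewrite scaler0.
- move=> i q; rewrite mem_zrange => hq; case: (ltP q 0) => h.
    by rewrite [expz i q]expz_neg // mulr0 scale0r.
  by rewrite expz_neg ?mul0r ?scale0r //; lia.
Qed.

(** Under $t=e^z$, the operator $t\,d/dt$ becomes $d/dz$. *)
Lemma lderiv_expsum (W : lmodType K) (P : int -> W) : finsupp P -> lderiv (expsum P) = expsum (fun
    i => i%:~R *: P i).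
Proof.
move=> fP; apply/funext => p; rewrite /lderiv /expsum (fsum_lin (lin_scale _)); last exact:
    finsupp_scale.
apply: eq_fsum => i; rewrite !scalerA; congr (_ *: _).
by rewrite mulrC [RHS]mulrC [LHS]mulrC; have := congr1 (fun f => f p) (lderiv_expz i).
Qed.

Lemma nth_hseq j i : (i <= j)%N -> nth 0 (hseq K j) i = hcoef K i.
Proof.
have sz m : size (hseq K m) = m.+1 by elim: m => //= m IH; rewrite size_rcons IH.
elim: j i => [|j IH] i; first by rewrite leqn0 => /eqP ->.
rewrite leq_eqVlt => /orP[/eqP -> //|]; rewrite ltnS => hi.
by rewrite /= nth_rcons sz ltnS hi IH.
Qed.

Lemma hcoefS j : hcoef K j.+1 = - \sum_(i < j.+1) gcoef K i.+1 * hcoef K (j - i).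
Proof.
have sz m : size (hseq K m) = m.+1 by elim: m => //= m IH; rewrite size_rcons IH.
rewrite /hcoef /= nth_rcons sz ltnn eqxx; congr (- _).
by apply: eq_bigr => i _; rewrite nth_hseq // leq_subr.
Qed.

(** The recursion behind [hseq] is the coefficient form of $h(z)\,(e^z-1)/z=1$. *)
Lemma gcoef_hcoef n : \sum_(i < n.+1) gcoef K i * hcoef K (n - i) = (n == 0%N)%:R.
Proof.
case: n => [|n]; first by rewrite big_ord1 /gcoef /hcoef /= mulr1 invr1.
rewrite big_ord_recl subn0 hcoefS /gcoef /= invr1 mul1r.
by under [X in _ + X]eq_bigr => i _ do rewrite /bump /= subSS; rewrite addNr.
Qed.

(* 1 / (e^z - 1) *)
Definition omega : int -> K := einv K 1.

Lemma omegaE q : omega q = if -1 <= q then hcoef K (absz (q + 1)) else 0.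
Proof.
rewrite /omega /einv; have -> : (0 <= q + 1%N) = (-1 <= q) by lia.
case: ifP => // _; rewrite /= big_ord_recr /= subnn mulr1.
rewrite big1 ?add0r // => i _; case: eqP => //; first by have := ltn_ord i; lia.
by rewrite mulr0.
Qed.

Lemma omega_lt q : q < -1 -> omega q = 0.
Proof. by rewrite omegaE; case: ifP => //; lia. Qed.

Lemma bddK_omega : bddK omega.
Proof. by exists (-1); exact: omega_lt. Qed.

Lemma omega_N1 : omega (-1) = 1.
Proof. by rewrite omegaE. Qed.

(** This is $(e^z-1)\omega=1$, in the form suited to multiplying by $e^z$ and then subtracting. *)
Lemma cmul_expz1_omega : cmul (expz 1) omega = omega + unit_ser K.
Proof.
(* $e^z=1+z\sum_i z^i/(i+1)!$, where the sum is the inverse of $h$. *)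
have E : expz 1 = unit_ser K + (fun p => if 0 < p then gcoef K (absz (p - 1)) else 0).
  apply/funext => p; rewrite addrfctE /unit_ser; case: p => [[|p]|p] /=.
  - by rewrite expz_0 addr0.
  - rewrite expz_nat expr1n add0r mul1r /gcoef.
    by congr (_`!)%:R^-1; lia.
  - by rewrite expz_neg // addr0.
rewrite E cmulC /cmul convDr; [|exact: bddK_omega|exact: bddK_unit|]; last first.
  by exists 1 => q hq; case: ifP => //; lia.
rewrite -!/(cmul _ _) cmul1; congr (_ + _); rewrite cmulC; apply/funext => p.
rewrite /cmul /conv /unit_ser; case: (ltP p 0) => hp.
  rewrite (_ : p == 0 = false); last by apply/eqP; lia.
  apply: fsum0 => q.
  case: ifP => h; last by rewrite scale0r.
  by rewrite omega_lt; [exact: mulr0|lia].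
case: p hp => // n _; rewrite -[(n == 0 :> int)]/(n == 0%N) -gcoef_hcoef.
rewrite -(fsum_refl _ (n%:Z - 1)) (@fsum_range _ _ 0 n.+1); last first.
- by move=> q hq; rewrite [omega _]omega_lt; [exact: mulr0|lia].
- by move=> q hq; case: ifP; rewrite ?scale0r //; lia.
apply: eq_bigr => i _.
have hi := ltn_ord i; rewrite omegaE.
do 2 (case: ifP => [_|]; last lia); rewrite -[_ *: _]/(_ * _).
by congr (gcoef _ _ * hcoef _ _); lia.
Qed.

End Char0.

(** * Differences and polynomial functions on the integers *)

Section Differences.
Variable K : fieldType.
Implicit Types W : lmodType K.

(* the coefficients of (t - 1) g(t), where g(t) = sum_i g(i) t^i *)
Definition bdiff W (g : int -> W) : int -> W := fun i => g (i - 1) - g i.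

Lemma iter_bdiff_lin (U W : lmodType K) (T : U -> W) k g : lin T ->
  iter k (@bdiff W) (fun i => T (g i)) = fun i => T (iter k (@bdiff U) g i).
Proof.
by move=> lT; elim: k => //= k ->; apply/funext => i; rewrite /bdiff linB.
Qed.

Lemma iter_bdiff_lin_fct (U W : lmodType K) (T : (int -> U) -> int -> W) k g :
  (forall h, bdiff (T h) = T (bdiff h)) -> iter k (@bdiff W) (T g) = T (iter k (@bdiff U) g).
Proof. by move=> h; elim: k => //= k ->. Qed.

Lemma iter_bdiffD W k (f g : int -> W) :
  iter k (@bdiff W) (f + g) = iter k (@bdiff W) f + iter k (@bdiff W) g.
Proof.
elim: k => //= k ->; apply/funext => i; rewrite /bdiff !addrfctE opprD addrACA //.
Qed.

Lemma iter_bdiffZ W k a (f : int -> W) : iter k (@bdiff W) (a *: f) = a *: iter k (@bdiff W) f.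
Proof. exact: (iter_bdiff_lin k f (lin_scale a)). Qed.

Lemma iter_bdiffN W k (f : int -> W) : iter k (@bdiff W) (- f) = - iter k (@bdiff W) f.
Proof. by rewrite -!scaleN1r iter_bdiffZ. Qed.

Lemma iter_bdiffB W k (f g : int -> W) :
  iter k (@bdiff W) (f - g) = iter k (@bdiff W) f - iter k (@bdiff W) g.
Proof. by rewrite iter_bdiffD iter_bdiffN. Qed.

Lemma iter_bdiff0 W k : iter k (@bdiff W) 0 = 0.
Proof. by rewrite -(scale0r 0) iter_bdiffZ !scale0r. Qed.

Lemma iter_bdiff_shift W k c (f : int -> W) :
  iter k (@bdiff W) (fun i => f (i + c)) = fun i => iter k (@bdiff W) f (i + c).
Proof. by apply: (iter_bdiff_lin_fct (T := fun f i => f (i + c))) => h; apply/funext => i; rewrite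
    /bdiff addrAC. Qed.

Lemma iter_bdiff_sum W k (I : Type) (r : seq I) (f : I -> int -> W) :
  iter k (@bdiff W) (fun i => \sum_(t <- r) f t i) = fun i => \sum_(t <- r) iter k (@bdiff W) (f t) i.
Proof.
elim: k => //= k ->; apply/funext => i; rewrite /bdiff -sumrB //.
Qed.

Lemma iter_bdiff_supp W k (f : int -> W) i :
  (forall t : nat, (t <= k)%N -> f (i - Posz t) = 0) -> iter k (@bdiff W) f i = 0.
Proof.
elim: k i => [|k IH] i h /=; first by have := h 0%N isT; rewrite subr0.
have h1 : iter k (@bdiff W) f (i - 1) = 0.
  by apply: IH => t ht; rewrite -(h t.+1 ht); congr f; lia.
by rewrite /bdiff h1 IH ?subrr // => t ht; apply: h; exact: leqW.
Qed.

(** The support of [G i] may vary with [i], so finiteness for the differences is carried through the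
    same induction. *)
Lemma iter_bdiff_fsum W k (G : int -> int -> W) : (forall i, finsupp (G i)) ->
  (forall i, finsupp (fun j => iter k (@bdiff W) (fun i => G i j) i)) /\
  iter k (@bdiff W) (fun i => fsum (G i)) = fun i => fsum (fun j => iter k (@bdiff W) (fun i => G i
      j) i).
Proof.
move=> fG; elim: k => //= k [fk ->]; split.
  by move=> i; apply: (finsuppD (fk (i - 1)) (finsuppN (fk i))).
by apply/funext => i; rewrite /bdiff -fsumN -fsumD //; exact: finsuppN.
Qed.

Lemma finsupp_bdiff W (f : int -> W) : finsupp f -> finsupp (bdiff f).
Proof.
move=> ff; apply: (finsuppD _ (finsuppN ff)).
exact: (@finsupp_reindex _ f (fun i => i - 1) (fun i => i + 1) (subrK _) (addrK _) ff).
Qed.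

(** Identifies iterated differences with the binomial sums in [prod2] and, for functions valued in
    series, with those in [ec]. *)
Lemma iter_bdiff_binom W k (f : int -> W) i : iter k (@bdiff W) f i =
  \sum_(t < k.+1) ((-1) ^+ (k - t) * ('C(k, t))%:R) *: f (i - Posz t).
Proof.
elim: k i => [|k IH] i /=; first by rewrite big_ord1 expr0 mulr1 scale1r subr0.
rewrite /bdiff !IH [RHS]big_ord_recl [X in _ - X]big_ord_recl /= !bin0 !subn0.
rewrite big_ord_recr [X in _ = _ + X]big_ord_recr /= !subnn !binn.
rewrite [X in _ - (_ + X)](_ : _ = \sum_(t < k)
   ((-1) ^+ (k - t.+1) * ('C(k, t.+1))%:R) *: f (i - Posz t.+1)); last first.
  by apply: eq_bigr => t _.
rewrite [X in _ = _ + (X + _)](_ : _ = \sum_(t < k)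
   (((-1) ^+ (k - t) * ('C(k, t))%:R) *: f (i - 1 - Posz t)
     - ((-1) ^+ (k - t.+1) * ('C(k, t.+1))%:R) *: f (i - Posz t.+1))); last first.
  apply: eq_bigr => t _; rewrite /bump /= add1n subSS binS natrD mulrDr scalerDl addrC.
  have -> : i - 1 - Posz t = i - Posz t.+1 by lia.
  congr (_ + _); rewrite -scaleNr; congr (_ *: _).
  have -> : (k - t)%N = (k - t.+1).+1 by have := ltn_ord t; lia.
  by rewrite exprS mulN1r mulNr.
rewrite sumrB exprS !mulr1 mulN1r scaleNr.
have -> : i - 1 - Posz k = i - Posz k.+1 by lia.
rewrite opprD; set X := \sum_(_ < _) _; set Y := \sum_(_ < _) _.
by rewrite addrCA; congr (_ + _); rewrite addrAC.
Qed.

Lemma bdiff_mul W (f : int -> W) :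
  bdiff (fun i => i%:~R *: f i) = (fun i => i%:~R *: bdiff f i) - (fun i => f (i - 1)).
Proof.
apply/funext => i; rewrite /bdiff -[RHS]/(i%:~R *: (f (i - 1) - f i) - f (i - 1)).
by rewrite rmorphB scalerBl scale1r scalerBr addrAC.
Qed.

(** Leibniz rule for $t\,d/dt$ against $(t-1)^{k+1}$: the derivative is $(k+1)\,t\,(t-1)^k$, and its
    factor $t$ is the shift to [i - 1]. *)
Lemma iter_bdiff_mul W k (f : int -> W) i : iter k.+1 (@bdiff W) (fun i => i%:~R *: f i) i =
  i%:~R *: iter k.+1 (@bdiff W) f i - k.+1%:R *: iter k (@bdiff W) f (i - 1).
Proof.
elim: k f i => [|k IH] f i; first by rewrite /= bdiff_mul scale1r.
rewrite iterSr bdiff_mul iter_bdiffB.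
rewrite -[LHS]/(iter k.+1 (@bdiff W) (fun i => i%:~R *: bdiff f i) i -
  iter k.+1 (@bdiff W) (fun i => f (i - 1)) i).
rewrite IH iter_bdiff_shift -!iterSr -addrA -opprD; congr (_ - _).
by rewrite -[k.+2%:R]natr1 scalerDl scale1r.
Qed.

(* g is a polynomial function of degree < k *)
Definition polyfun W k (f : int -> W) := iter k (@bdiff W) f = 0.

Lemma polyfun_le W k l (f : int -> W) : (k <= l)%N -> polyfun k f -> polyfun l f.
Proof. by move=> /subnK <-; rewrite /polyfun iterD => ->; exact: iter_bdiff0. Qed.

Lemma polyfunD W k (f g : int -> W) : polyfun k f -> polyfun k g -> polyfun k (f + g).
Proof. by rewrite /polyfun iter_bdiffD => -> ->; rewrite addr0. Qed.

Lemma polyfunB W k (f g : int -> W) : polyfun k f -> polyfun k g -> polyfun k (f - g).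
Proof. by rewrite /polyfun iter_bdiffB => -> ->; rewrite subr0. Qed.

Lemma polyfunN W k (f : int -> W) : polyfun k f -> polyfun k (- f).
Proof. by rewrite /polyfun iter_bdiffN => ->; rewrite oppr0. Qed.

Lemma polyfun_lin (U W : lmodType K) (T : U -> W) k f : lin T -> polyfun k f -> polyfun k (fun i =>
    T (f i)).
Proof. by move=> lT; rewrite /polyfun iter_bdiff_lin // => ->; apply/funext => i; exact: lin0. Qed.

Lemma polyfunZ W k a (f : int -> W) : polyfun k f -> polyfun k (fun i => a *: f i).
Proof. exact: (polyfun_lin (lin_scale a)). Qed.

Lemma polyfun_shift W k c (f : int -> W) : polyfun k f -> polyfun k (fun i => f (i + c)).
Proof. by rewrite /polyfun iter_bdiff_shift => ->. Qed.

Lemma polyfun_sum W k (I : Type) (r : seq I) (f : I -> int -> W) :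
  (forall t, polyfun k (f t)) -> polyfun k (fun i => \sum_(t <- r) f t i).
Proof.
move=> h; rewrite /polyfun iter_bdiff_sum; apply/funext => i; rewrite big1 // => t _.
by rewrite h.
Qed.

Lemma polyfun_mul W k (f : int -> W) : polyfun k f -> polyfun k.+1 (fun i => i%:~R *: f i).
Proof.
move=> h; apply/funext => i; rewrite iter_bdiff_mul h (polyfun_le (leqnSn k) h).
by rewrite -[LHS]/(i%:~R *: 0 - k.+1%:R *: 0) !scaler0 subr0.
Qed.

Lemma polyfun_mulX W k s (f : int -> W) : polyfun k f -> polyfun (k + s) (fun i => i%:~R ^+ s *: f i).
Proof.
elim: s k f => [|s IH] k f h.
  by rewrite addn0 (_ : (fun i => _) = f) //; apply/funext => i; rewrite scale1r.
have -> : (fun i : int => i%:~R ^+ s.+1 *: f i) = fun i => i%:~R ^+ s *: (i%:~R *: f i).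
  by apply/funext => i; rewrite scalerA -exprSr.
by rewrite addnS -addSn; apply: IH; exact: polyfun_mul.
Qed.

(** The difference of a reflected function is minus the reflected difference, one step further on;
    hence the induction changes [c] into [c + 1]. *)
Lemma polyfun_refl W k c (f : int -> W) : polyfun k f -> polyfun k (fun i => f (c - i)).
Proof.
elim: k c f => [|k IH] c f; rewrite /polyfun; first by move=> /= ->.
rewrite iterSr => /(IH (c + 1)) h; rewrite iterSr.
rewrite (_ : bdiff _ = - (fun i => bdiff f (c + 1 - i))); first by rewrite iter_bdiffN h oppr0.
apply/funext => i; rewrite -[RHS]/(- bdiff f (c + 1 - i)) /bdiff [RHS]opprB.
by congr (f _ - f _); lia.
Qed.

Lemma bdiff_eq0 W (f : int -> W) : bdiff f = 0 -> forall i, f i = f 0.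
Proof.
move=> h; have E i : f (i - 1) = f i.
  by apply/eqP; rewrite -subr_eq0; apply/eqP; exact: (congr1 (fun g => g i) h).
case=> n.
  elim: n => // n IH; rewrite -IH -(E n.+1); congr f; lia.
elim: n => [|n IH]; first by rewrite -(E 0).
by rewrite -IH -(E (Negz n)); congr f; lia.
Qed.

End Differences.

(** * Expansion of rational functions of t at t = e^z *)

Section Expansion.
Variable K : fieldType.
Hypothesis charK : [pchar K] =i pred0.
Implicit Types W : lmodType K.

(* multiplication by e^z - 1 *)
Definition expm1 W (A : int -> W) : int -> W := conv (expz K 1) A - A.

Lemma bdd_expm1 W (A : int -> W) : bdd A -> bdd (expm1 A).
Proof. by move=> h; apply: bddB => //; apply: bdd_conv => //; exact: bddK_expz. Qed.

Lemma bdd_iter_expm1 W k (A : int -> W) : bdd A -> bdd (iter k (@expm1 W) A).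
Proof. by move=> h; elim: k => //= k; exact: bdd_expm1. Qed.

Lemma expm1D W (A B : int -> W) : bdd A -> bdd B -> expm1 (A + B) = expm1 A + expm1 B.
Proof. by move=> hA hB; rewrite /expm1 convDr //; [rewrite opprD addrACA|exact: bddK_expz]. Qed.

Lemma iter_expm1D W k (A B : int -> W) : bdd A -> bdd B ->
  iter k (@expm1 W) (A + B) = iter k (@expm1 W) A + iter k (@expm1 W) B.
Proof. by move=> hA hB; elim: k => //= k ->; rewrite expm1D //; exact: bdd_iter_expm1. Qed.

Lemma iter_expm1_lin (U W : lmodType K) (T : U -> W) k A : lin T -> bdd A ->
  iter k (@expm1 W) (fun q => T (A q)) = fun q => T (iter k (@expm1 U) A q).
Proof.
move=> lT hA; elim: k => //= k ->; rewrite /expm1 conv_lin //.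
- by apply/funext => q; rewrite -[LHS]/(T _ - T _) -linB.
- exact: bddK_expz.
- exact: bdd_iter_expm1.
Qed.

Lemma expm1_conv W c (A : int -> W) : bddK c -> bdd A -> expm1 (conv c A) = conv c (expm1 A).
Proof.
move=> hc hA; have he := bddK_expz K 1.
by rewrite /expm1 conv_swap // convBr //; exact: bdd_conv.
Qed.

Lemma iter_expm1_conv W k c (A : int -> W) : bddK c -> bdd A ->
  iter k (@expm1 W) (conv c A) = conv c (iter k (@expm1 W) A).
Proof. by move=> hc hA; elim: k => //= k ->; rewrite expm1_conv //; exact: bdd_iter_expm1. Qed.

Lemma omega_expm1 W (A : int -> W) : bdd A -> conv (omega K) (expm1 A) = A.
Proof.
move=> hA; have he := bddK_expz K 1; have ho := bddK_omega K.
rewrite /expm1 convBr // ?convA //; last exact: bdd_conv.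
rewrite cmulC cmul_expz1_omega convDl //; last exact: bddK_unit.
by rewrite conv1 addrAC subrr add0r.
Qed.

Lemma expm1_omega W (A : int -> W) : bdd A -> expm1 (conv (omega K) A) = A.
Proof. by move=> hA; rewrite expm1_conv ?omega_expm1 //; exact: bddK_omega. Qed.

Lemma iter_omega_expm1 W k (A : int -> W) : bdd A -> iter k (conv (omega K)) (iter k (@expm1 W) A) = A.
Proof.
move=> hA; elim: k => // k IH.
by rewrite iterSr /= omega_expm1 //; exact: bdd_iter_expm1.
Qed.

Lemma bdd_iter_omega W k (A : int -> W) : bdd A -> bdd (iter k (conv (omega K)) A).
Proof. by move=> hA; elim: k => //= k; apply: bdd_conv; exact: bddK_omega. Qed.

Lemma iter_expm1_omega W k (A : int -> W) : bdd A -> iter k (@expm1 W) (iter k (conv (omega K)) A) = A.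
Proof.
move=> hA; elim: k => // k IH.
by rewrite iterSr /= expm1_omega //; exact: bdd_iter_omega.
Qed.

Lemma expm1_expsum W (P : int -> W) : finsupp P -> expm1 (expsum P) = expsum (bdiff P).
Proof.
move=> fP; have fP1 : finsupp (fun i => P (i - 1)).
  exact: (@finsupp_reindex _ P (fun i => i - 1) (fun i => i + 1) (subrK _) (addrK _) fP).
rewrite /expm1 -expsum_shift //.
rewrite (_ : bdiff P = (fun i => P (i - 1)) + (fun i => - P i)) // expsumD //; last exact: finsuppN.
congr (_ + _); have := expsum_lin (@lin_scale _ W (-1)) fP.
rewrite (_ : (fun i => -1 *: P i) = fun i => - P i); last by apply/funext => i; rewrite scaleN1r.
by move=> ->; apply/funext => i; rewrite scaleN1r.
Qed.

(* (t - 1)^k g(t) is a Laurent polynomial and (e^z - 1)^k A(z) is its value at t = e^z, i.e. A is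
   the expansion of g at t = e^z. Polynomial functions g, being killed by a power of t - 1, have
   expansion 0, so that both orderings of a product of local fields have the same expansion. *)
Definition isE_ord W k (g A : int -> W) :=
  [/\ bdd A, finsupp (iter k (@bdiff K W) g) & iter k (@expm1 W) A = expsum (iter k (@bdiff K W) g)].

Definition isE W (g A : int -> W) := exists k, isE_ord k g A.

Lemma isE_ord_S W k (g A : int -> W) : isE_ord k g A -> isE_ord k.+1 g A.
Proof.
case=> hA fg E; split=> //=; first exact: finsupp_bdiff.
by rewrite E expm1_expsum.
Qed.

Lemma isE_ord_le W k l (g A : int -> W) : (k <= l)%N -> isE_ord k g A -> isE_ord l g A.
Proof.
move=> /subnK <-; elim: (l - k)%N => // n IH h; rewrite addSn; exact/isE_ord_S/IH.
Qed.

(** Two clearing powers can be raised to a common one, where $(e^z-1)^k$ cancels. The expansion thus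
    depends on the function alone. *)
Lemma isE_uniq W (g A B : int -> W) : isE g A -> isE g B -> A = B.
Proof.
case=> k hk [l hl].
have [hA _ EA] := isE_ord_le (leq_maxl k l) hk; have [hB _ EB] := isE_ord_le (leq_maxr k l) hl.
by rewrite -(iter_omega_expm1 (maxn k l) hA) EA -EB iter_omega_expm1.
Qed.

(** Lets the clearing power be prescribed afterwards, for instance as a locality order. *)
Lemma isE_at W k (g A : int -> W) : finsupp (iter k (@bdiff K W) g) -> isE g A -> isE_ord k g A.
Proof.
move=> fg hg; have hB : bdd (iter k (conv (omega K)) (expsum (iter k (@bdiff K W) g))).
  exact/bdd_iter_omega/bdd_expsum.
suff hk : isE_ord k g (iter k (conv (omega K)) (expsum (iter k (@bdiff K W) g))).
  by rewrite (isE_uniq hg (ex_intro _ k hk)).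
by split=> //; rewrite iter_expm1_omega //; exact: bdd_expsum.
Qed.

Lemma isE_ex W k (g : int -> W) : finsupp (iter k (@bdiff K W) g) -> exists A, isE g A.
Proof.
move=> fg; exists (iter k (conv (omega K)) (expsum (iter k (@bdiff K W) g))); exists k.
by split=> //; [exact/bdd_iter_omega/bdd_expsum|rewrite iter_expm1_omega //; exact: bdd_expsum].
Qed.

Lemma isE_bdd W (g A : int -> W) : isE g A -> bdd A.
Proof. by case=> k []. Qed.

Lemma isE_finsupp W (g : int -> W) : finsupp g -> isE g (expsum g).
Proof. by move=> fg; exists 0%N; split=> //; exact: bdd_expsum. Qed.

Lemma isE_polyfun W k (g : int -> W) : polyfun k g -> isE g 0.
Proof.
move=> h; exists k; rewrite /isE_ord h; split; [exact: bdd0|by exists [::]|].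
have -> : expsum (0 : int -> W) = 0 by apply/funext => p; apply: fsum0 => i; rewrite scaler0.
by have := iter_expm1_lin k (@lin_scale _ W 0) (bdd0 W);
  rewrite (_ : (fun q => _) = 0) // => [->|]; apply/funext => q; rewrite scale0r.
Qed.

Lemma isE_lin (U W : lmodType K) (T : U -> W) g A : lin T -> isE g A ->
  isE (fun i => T (g i)) (fun q => T (A q)).
Proof.
move=> lT [k [hA fg E]]; exists k; rewrite /isE_ord iter_bdiff_lin // iter_expm1_lin // E; split.
- exact: bdd_lin.
- exact: finsupp_lin.
- by rewrite expsum_lin.
Qed.

Lemma isED W (g h A B : int -> W) : isE g A -> isE h B -> isE (g + h) (A + B).
Proof.
case=> k hk [l hl]; exists (maxn k l).
have [hA fg EA] := isE_ord_le (leq_maxl k l) hk; have [hB fh EB] := isE_ord_le (leq_maxr k l) hl.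
rewrite /isE_ord iter_bdiffD iter_expm1D // EA EB expsumD //; split=> //; [exact: bddD|exact: finsuppD].
Qed.

Lemma isEZ W a (g A : int -> W) : isE g A -> isE (fun i => a *: g i) (fun q => a *: A q).
Proof. exact: (isE_lin (lin_scale a)). Qed.

Lemma isEN W (g A : int -> W) : isE g A -> isE (- g) (- A).
Proof. by rewrite -!scaleN1r; exact: isEZ. Qed.

Lemma isEB W (g h A B : int -> W) : isE g A -> isE h B -> isE (g - h) (A - B).
Proof. by move=> hg hh; apply/isED/isEN. Qed.

Lemma isE_sum W (I : Type) (r : seq I) (g A : I -> int -> W) :
  (forall t, isE (g t) (A t)) ->
  isE (fun i => \sum_(t <- r) g t i) (fun q => \sum_(t <- r) A t q).
Proof.
move=> h; elim: r => [|t r IH].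
  have E (F : I -> int -> W) : (fun i => \sum_(t <- [::]) F t i) = 0.
    by apply/funext => i; rewrite big_nil.
  by rewrite !E; exact: (@isE_polyfun _ 0).
have := isED (h t) IH; congr isE; apply/funext => i; by rewrite big_cons.
Qed.

Lemma isE_shift W j (g A : int -> W) : isE g A -> isE (fun i => g (i - j)) (conv (expz K j) A).
Proof.
case=> k [hA fg E]; have he := bddK_expz K j.
exists k; rewrite /isE_ord (iter_bdiff_shift k (- j)) iter_expm1_conv // E; split.
- exact: bdd_conv.
- exact: (@finsupp_reindex _ _ (fun i => i - j) (fun i => i + j) (subrK _) (addrK _) fg).
- by rewrite expsum_shift.
Qed.

Lemma lderiv_expm1 W (A : int -> W) : bdd A -> lderiv (expm1 A) = expm1 (lderiv A) + conv (expz K 1) A.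
Proof.
move=> hA; have he := bddK_expz K 1.
have E (B C : int -> W) : lderiv (B - C) = lderiv B - lderiv C.
  by apply/funext => p; rewrite -[RHS]/(_ *: _ - _ *: _) -scalerBr.
rewrite /expm1 E lderiv_conv // lderiv_expz //.
have -> : (fun p => 1%:~R * expz K 1 p) = expz K 1 by apply/funext => p; rewrite mul1r.
by rewrite [X in _ = X]addrC addrA.
Qed.

Lemma isE_mul W (g A : int -> W) : isE g A -> isE (fun i => i%:~R *: g i) (lderiv A).
Proof.
case=> k; elim: k g A => [|k IH] g A h.
  case: (h) => /= hA fg ->; rewrite lderiv_expsum //; apply: isE_finsupp; exact: finsupp_scale.
have hA : bdd A by case: h.
have {}h1 : isE_ord k (bdiff g) (expm1 A).
  by case: h => _; rewrite !iterSr => ? ?; split=> //; exact: bdd_expm1.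
have hs : isE (fun i => g (i - 1)) (conv (expz K 1) A) by apply: isE_shift; exists k.+1.
(* $(t-1)\cdot t\,dg/dt$ equals $t\,d/dt$ of $(t-1)g$ minus $tg$; the expansion of the first term is
   known by induction, that of the second from the shift. *)
have := isEB (IH _ _ h1) hs; rewrite -bdiff_mul lderiv_expm1 // addrK => -[l [h2 h3 h4]].
by exists l.+1; split; [exact: bdd_lderiv|rewrite iterSr|rewrite !iterSr].
Qed.

(** Infinitely many [f j] may be nonzero, as long as the sum is finite at each [i]: those outside
    [J] are annihilated by one common power of $t-1$, hence so is their sum, whose expansion is
    0. *)
Lemma isE_fsum W (f A : int -> int -> W) (J : seq int) k :
  (forall j, isE (f j) (A j)) -> (forall j, j \notin J -> polyfun k (f j)) ->
  (forall i, finsupp (fun j => f j i)) ->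
  isE (fun i => fsum (fun j => f j i)) (fun q => fsum (fun j => A j q)).
Proof.
move=> hE hp hf; have A0 j : j \notin undup J -> A j = 0.
  by rewrite mem_undup => /hp /isE_polyfun h; exact: isE_uniq (hE j) h.
have -> : (fun q => fsum (fun j => A j q)) = fun q => \sum_(j <- undup J) A j q.
  by apply/funext => q; rewrite (@fsumE _ _ (undup J)) ?undup_uniq // => j /A0 ->.
pose r j i := if j \in J then 0 else f j i.
have -> : (fun i => fsum (fun j => f j i)) =
  (fun i => \sum_(j <- undup J) f j i) + (fun i => fsum (fun j => r j i)).
  apply/funext => i; rewrite -[RHS]/(_ + _).
  have -> : \sum_(j <- undup J) f j i = fsum (fun j => if j \in J then f j i else 0).
    rewrite (@fsumE _ _ (undup J)) ?undup_uniq //.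
      by rewrite !big_seq; apply: eq_bigr => j; rewrite mem_undup => ->.
    by move=> j; rewrite mem_undup => /negPf ->.
  rewrite -fsumD; first by apply: eq_fsum => j; rewrite /r; case: ifP; rewrite ?addr0 ?add0r.
    by exists J => j /negPf ->.
  by case: (hf i) => s hs; exists s => j /hs; rewrite /r => ->; case: ifP.
rewrite -[X in isE _ X]addr0; apply: isED; first exact: isE_sum.
apply: (@isE_polyfun _ k).
have fr i : finsupp (fun j => r j i).
  by case: (hf i) => s hs; exists s => j /hs; rewrite /r => ->; case: ifP.
rewrite /polyfun; case: (iter_bdiff_fsum k fr) => _ ->; apply/funext => i; apply: fsum0 => j.
rewrite /r; case: (boolP (j \in J)) => [_|/hp].
  by rewrite (iter_bdiff0 W k).
by rewrite /polyfun => ->.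
Qed.

End Expansion.

(** * Coefficients of polynomial functions as polar parts *)

Section PolynomialFunctions.
Variable K : fieldType.
Hypothesis charK : [pchar K] =i pred0.
Implicit Types W : lmodType K.

Lemma gbin0 p : gbin K p 0 = 1.
Proof. by rewrite /gbin big_ord0 divr1. Qed.

Lemma gbinS p s : gbin K p s.+1 = gbin K p s * (p - Posz s)%:~R / s.+1%:R.
Proof.
rewrite /gbin big_ord_recr /= factS natrM rmorphB /=.
move: (s.+1%:R : K) (natSK_neq0 charK s) => x hx.
by field; rewrite factK_neq0 // hx.
Qed.

Lemma gbin_nat (n s : nat) : gbin K n s = 'C(n, s)%:R.
Proof.
elim: s => [|s IH]; first by rewrite gbin0 bin0.
rewrite gbinS IH; case: (leqP s n) => h; last by rewrite !bin_small ?mul0r //; lia.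
rewrite subzn // -[(n - s)%N%:~R]/((n - s)%N%:R) -natrM mulnC -mul_bin_left natrM mulrC mulKf //.
exact: natSK_neq0.
Qed.

Lemma gbin_N1 s : gbin K (-1) s = (-1) ^+ s.
Proof.
elim: s => [|s IH]; first by rewrite gbin0.
rewrite gbinS IH exprS.
have -> : -1 - Posz s = - Posz s.+1 by lia.
rewrite rmorphN /= -[s.+1%:~R]/(s.+1%:R).
by move: (s.+1%:R : K) (natSK_neq0 charK s) => x hx; field; rewrite hx.
Qed.

Lemma expzS j (s : nat) : expz K j s.+1 = s.+1%:R^-1 * j%:~R * expz K j s.
Proof.
rewrite !expz_nat factS natrM exprS.
move: (s.+1%:R : K) (natSK_neq0 charK s) => x hx.
by field; rewrite factK_neq0 // hx.
Qed.

Lemma expzN j (s : nat) : expz K (- j) s = (-1) ^+ s * expz K j s.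
Proof. by rewrite !expz_nat mulrA -exprNn rmorphN. Qed.

(* (d/dz)^s / s! *)
Definition lderivn W s (A : int -> W) : int -> W := fun q => gbin K (q + Posz s) s *: A (q + Posz s).

Definition lderivnK s (c : int -> K) : int -> K := @lderivn K^o s c.

Lemma lderivnKE s c q : lderivnK s c q = gbin K (q + Posz s) s * c (q + Posz s).
Proof. by []. Qed.

Lemma lderivn0 W (A : int -> W) : lderivn 0 A = A.
Proof. by apply/funext => q; rewrite /lderivn gbin0 scale1r addr0. Qed.

Lemma lderivnS W s (A : int -> W) : lderivn s.+1 A = fun q => s.+1%:R^-1 *: lderiv (lderivn s A) q.
Proof.
apply/funext => q; rewrite /lderivn /lderiv gbinS !scalerA.
have -> : q + 1 + Posz s = q + Posz s.+1 by lia.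
congr (_ *: _); have -> : q + Posz s.+1 - Posz s = q + 1 by lia.
by rewrite mulrC [gbin _ _ _ * _]mulrC mulrA.
Qed.

Lemma bdd_lderivn W s (A : int -> W) : bdd A -> bdd (lderivn s A).
Proof.
by case=> Q hQ; exists (Q - Posz s) => q hq; rewrite /lderivn hQ ?scaler0 //; lia.
Qed.

Lemma isE_expz W (s : nat) (g A : int -> W) : isE g A -> isE (fun i => expz K i s *: g i) (lderivn s A).
Proof.
move=> h; elim: s => [|s IH].
  rewrite lderivn0; move: h; congr isE; apply/funext => i; by rewrite expz_0 scale1r.
have := isEZ s.+1%:R^-1 (isE_mul charK IH); rewrite lderivnS; congr isE.
by apply/funext => i; rewrite expzS !scalerA.
Qed.

(** The series is $1/(t-1)$ expanded at $t=\infty$: multiplication by $t-1$ leaves only the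
    coefficient of $t^0$. *)
Lemma isE_half W (w : W) : isE (fun j => if j < 0 then w else 0) (fun q => omega K q *: w).
Proof.
exists 1%N; have ho := bdd_lin (lin_scalel w) (bddK_omega K).
have E : bdiff (fun j : int => if j < 0 then w else 0) = fun j => if j == 0 then w else 0.
  apply/funext => j; rewrite /bdiff; case: (ltgtP j 0) => h.
  - by case: ifP; rewrite ?subrr //; lia.
  - by case: ifP; rewrite ?subr0 //; lia.
  - by rewrite h /= subr0.
rewrite /isE_ord /= E; split=> //; first by exists [:: 0] => i; rewrite inE; case: eqP.
rewrite /expm1 conv_scalar //; [|exact: bddK_expz|exact: bddK_omega].
rewrite cmul_expz1_omega; apply/funext => p; rewrite /expsum (@fsum1 _ _ 0); last first.
  by move=> j /negPf ->; rewrite scaler0.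
rewrite eqxx expz0 -[LHS]/((omega K p + unit_ser K p) *: w - omega K p *: w).
by rewrite scalerDl addrAC subrr add0r.
Qed.

(* expansion of sum_{j < 0} ((-j)^s / s!) t^j; its only pole is z^{-s-1} with coefficient 1 *)
Definition theta s (q : int) : K := (-1) ^+ s * lderivnK s (omega K) q.

Lemma isE_theta W (s : nat) (w : W) :
  isE (fun j => if j < 0 then expz K (- j) s *: w else 0) (fun q => theta s q *: w).
Proof.
have := isEZ ((-1) ^+ s) (isE_expz s (isE_half w)); congr isE; apply/funext => j.
  by case: ifP => _; rewrite ?scaler0 // expzN scalerA.
by rewrite /lderivn /theta lderivnKE !scalerA mulrA.
Qed.

(** Only the term $z^{-1}$ of $\omega$ reaches a negative exponent. Its nonnegative powers are
    killed by the binomial coefficient, whose upper index is then below [s], and the sign in [theta]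
    cancels $\binom{-1}{s}$. *)
Lemma theta_pole s (t : nat) : theta s (- Posz t - 1) = (t == s)%:R.
Proof.
rewrite /theta lderivnKE.
case: (ltngtP t s) => h.
- have -> : - Posz t - 1 + Posz s = (s - t.+1)%N by lia.
  by rewrite gbin_nat bin_small ?mul0r ?mulr0 //; lia.
- by rewrite omega_lt ?mulr0 //; lia.
- rewrite h; have -> : - Posz s - 1 + Posz s = -1 by lia.
  by rewrite omega_N1 gbin_N1 mulr1 -exprMn mulrNN mulr1 expr1n.
Qed.

Lemma theta_0 s : theta s 0 = (-1) ^+ s * omega K s.
Proof. by rewrite /theta lderivnKE add0r gbin_nat binn mul1r. Qed.

Lemma iter_bdiff_mon W (k : nat) (w : W) :
  polyfun k.+1 (fun j => expz K (- j) k *: w) /\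
  iter k (@bdiff K W) (fun j => expz K (- j) k *: w) = fun=> w.
Proof.
elim: k => [|k [IH1 IH2]].
  have E : (fun j : int => expz K (- j) 0%N *: w) = fun=> w.
    by apply/funext => j; rewrite expz_0 scale1r.
  by split=> //; rewrite /polyfun /= E; apply/funext => j; rewrite /bdiff subrr.
pose f (j : int) : W := - k.+1%:R^-1 *: (expz K (- j) k *: w).
have E : (fun j : int => expz K (- j) k.+1 *: w) = fun j => j%:~R *: f j.
  apply/funext => j; rewrite /f expzS !scalerA rmorphN; congr (_ *: _) => /=; ring.
have hf : polyfun k.+1 f := polyfunZ _ IH1.
rewrite E; split; first exact: polyfun_mul.
apply/funext => i; rewrite iter_bdiff_mul hf.
rewrite (iter_bdiff_lin k _ (lin_scale (- k.+1%:R^-1))) IH2 -[X in _ *: X - _]/(0 : W) scaler0.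
by rewrite sub0r scalerA mulrN scaleNr opprK divff ?scale1r // natSK_neq0.
Qed.

Lemma polyfun_mon W (k s : nat) (w : W) : (s < k)%N -> polyfun k (fun j => expz K (- j) s *: w).
Proof. by move=> h; apply: polyfun_le h _; case: (iter_bdiff_mon s w). Qed.

(** Induction on the degree bound: the k-th difference is a constant, which is the coefficient of
    the top monomial. The basis $(-j)^s/s!$ consists of the coefficients of $e^{-jz}$. *)
Lemma polyfunP W k (f : int -> W) : polyfun k f ->
  exists c : nat -> W, forall j, f j = \sum_(s < k) expz K (- j) s *: c s.
Proof.
elim: k f => [|k IH] f hf.
  by exists (fun=> 0) => j; rewrite big_ord0; have := congr1 (fun g => g j) hf.
have hw : forall i, iter k (@bdiff K W) f i = iter k (@bdiff K W) f 0 := bdiff_eq0 hf.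
set w := iter k (@bdiff K W) f 0 in hw.
have [_ hm] := iter_bdiff_mon k w.
have /IH[c hc] : polyfun k (f - fun j => expz K (- j) k *: w).
  by rewrite /polyfun iter_bdiffB hm; apply/funext => i; rewrite -[LHS]/(iter k (@bdiff K W) f i -
      w) hw subrr.
exists (fun s => if s == k then w else c s) => j; rewrite big_ord_recr /= eqxx.
transitivity ((f - fun j => expz K (- j) k *: w) j + expz K (- j) k *: w).
  by rewrite -[X in _ = X + _]/(f j - _) subrK.
rewrite hc; congr (_ + _); apply: eq_bigr => s _; case: eqP => // h.
by have := ltn_ord s; rewrite h ltnn.
Qed.

Lemma isE_half_sum W k (c : nat -> W) :
  isE (fun j => if j < 0 then \sum_(s < k) expz K (- j) s *: c s else 0)
      (fun q => \sum_(s < k) theta s q *: c s).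
Proof.
have := isE_sum charK (index_enum 'I_k) (fun s : 'I_k => isE_theta s (c s)); congr isE.
by apply/funext => j; case: ifP => // _; rewrite big1.
Qed.

Lemma sum_theta_pole W k (c : nat -> W) (t : nat) :
  \sum_(s < k) theta s (- Posz t - 1) *: c s = if (t < k)%N then c t else 0.
Proof.
case: ifP => h.
  rewrite (bigD1 (Ordinal h)) //= theta_pole eqxx scale1r big1 ?addr0 // => s hs.
  rewrite theta_pole; case: eqP => eprodn; last by rewrite scale0r.
  by case/eqP: hs; apply: val_inj; rewrite /= eprodn.
by rewrite big1 // => s _; rewrite theta_pole; case: eqP => eprodn; rewrite ?scale0r //; have :=
    ltn_ord s; lia.
Qed.

(** The coefficients are recovered as polar parts: cut off to $j<0$, the polynomial has expansion
    $\sum_s\theta_s c_s$, and each $\theta_s$ has a single polar term. *)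
Lemma polyfun_coef0 W k (c : nat -> W) :
  (forall j, \sum_(s < k) expz K (- j) s *: c s = 0) -> forall s, (s < k)%N -> c s = 0.
Proof.
move=> h t ht; have h1 := isE_half_sum k c.
have h2 : isE (fun j : int => if j < 0 then \sum_(s < k) expz K (- j) s *: c s else 0) (0 : int -> W).
  apply: (@isE_polyfun _ _ 0); apply/funext => j /=; by rewrite h; case: ifP.
have := congr1 (fun f => f (- Posz t - 1)) (isE_uniq charK h1 h2).
by rewrite sum_theta_pole ht.
Qed.

Lemma polyfun_coef_inj W k l (c d : nat -> W) :
  (forall j, \sum_(s < k) expz K (- j) s *: c s = \sum_(s < l) expz K (- j) s *: d s) ->
  forall s, (if (s < k)%N then c s else 0) = (if (s < l)%N then d s else 0).
Proof.
move=> h t; have h1 := isE_half_sum k c; have h2 := isE_half_sum l d.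
have h3 : isE (fun j : int => if j < 0 then \sum_(s < k) expz K (- j) s *: c s else 0)
  (fun q => \sum_(s < l) theta s q *: d s).
  by move: h2; congr isE; apply/funext => j; rewrite h.
rewrite -!sum_theta_pole; exact: (congr1 (fun f => f (- Posz t - 1)) (isE_uniq charK h1 h3)).
Qed.

(** Differences in [i] commute with the expansion in powers of $-j$, so each coefficient inherits
    the degree bound. This turns a Jacobi identity between modes into locality of products. *)
Lemma polyfun_coefs W k l (X : int -> nat -> W) :
  (forall j, polyfun l (fun i => \sum_(s < k) expz K (- j) s *: X i s)) ->
  forall s, (s < k)%N -> polyfun l (fun i => X i s).
Proof.
move=> h s hs; apply/funext => i.
apply: (@polyfun_coef0 _ k (fun s => iter l (@bdiff K W) (fun i => X i s) i) _ s hs) => j.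
have := congr1 (fun f => f i) (h j); rewrite /= iter_bdiff_sum => E.
rewrite -[RHS]E; apply: eq_bigr => t _.
by rewrite (iter_bdiff_lin l _ (lin_scale (expz K (- j) t))).
Qed.

(* product of g(t) with the expansion in t^-1 of a rational function with a pole at t = 1 *)
Definition geom W (s : nat) (g : int -> W) (i : int) : W :=
  fsum (fun j => if 0 <= j then expz K (- j) s *: g (i + j) else 0).

Lemma isE_geom W (s : nat) (g A : int -> W) B : (forall l, B < l -> g l = 0) -> isE g A ->
  isE (geom s g) (conv (lderivnK s (unit_ser K + omega K)) A).
Proof.
have hu := bddK_unit K; have ho := bddK_omega K.
have hd : bddK (unit_ser K + omega K) := @bddD _ K^o _ _ hu ho.
have hfin (c : int -> K) (h : int -> W) i : (forall l, B < l -> h l = 0) ->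
    finsupp (fun j => if 0 <= j then c j *: h (i + j) else 0).
  move=> hh; apply: (@finsupp_itv _ _ 0 (B - i)) => j hj; first by case: ifP => //; lia.
  by rewrite hh ?scaler0 ?if_same //; lia.
elim: s g A => [|s IH] g A hg h.
  have hA := isE_bdd h.
  have -> : lderivnK 0 (unit_ser K + omega K) = unit_ser K + omega K by exact: (@lderivn0 K^o).
  rewrite convDl // conv1.
  (* Multiplying [geom 0 g] by $t-1$ gives $t\,g$, so the factor is $t/(t-1)$, which is $1+\omega$
     at $t=e^z$. *)
  have E : bdiff (geom 0 g) = fun i => g (i - 1).
    apply/funext => i; rewrite /bdiff /geom -[X in X - _](fsum_shift _ 1) -fsumN -fsumD.
    - rewrite (@fsum1 _ _ (-1)); last first.
        move=> j hj; rewrite !expz_0 !scale1r.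
        have -> : (0 <= j + 1) = (0 <= j) by lia.
        by case: ifP => _; rewrite ?subr0 // (_ : i - 1 + (j + 1) = i + j) ?subrr //; lia.
      by rewrite addNr /= expz_0 scale1r addr0 subr0.
    - exact: (@finsupp_reindex _ (fun j : int => if 0 <= j then expz K (- j) 0%N *: g (i - 1 + j)
        else 0)
        (fun j => j + 1) (fun j => j - 1) (addrK _) (subrK _) (hfin _ _ _ hg)).
    - by apply: finsuppN; exact: hfin.
  have [k hk] := isE_shift charK 1 h; exists k.+1; rewrite /isE_ord !iterSr E.
  have hB : bdd (A + conv (omega K) A) by apply: bddD => //; apply: bdd_conv.
  split=> //; first by case: hk.
  rewrite expm1D //; last exact: bdd_conv.
  by rewrite expm1_omega // {1}/expm1 subrK; case: hk.
have hA := isE_bdd h.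
have hs : bddK (lderivnK s (unit_ser K + omega K)) := @bdd_lderivn K^o s _ hd.
have -> : lderivnK s.+1 (unit_ser K + omega K) =
    fun q => s.+1%:R^-1 * lderivK (lderivnK s (unit_ser K + omega K)) q by exact: (@lderivnS K^o).
rewrite convZl //; last exact: (@bdd_lderiv K K^o).
have -> : conv (lderivK (lderivnK s (unit_ser K + omega K))) A =
    lderiv (conv (lderivnK s (unit_ser K + omega K)) A) - conv (lderivnK s (unit_ser K + omega K))
        (lderiv A).
  by rewrite lderiv_conv // addrK.
(* Since $-j=i-(i+j)$, one more factor $-j$ is the commutator of $t\,d/dt$ with multiplication by
   the geometric series. *)
have -> : geom s.+1 g = fun i => s.+1%:R^-1 *:
    (i%:~R *: geom s g i - geom s (fun l => l%:~R *: g l) i).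
  apply/funext => i; rewrite /geom (fsum_lin (lin_scale i%:~R)); last exact: hfin.
  rewrite -fsumN -fsumD; last first.
  - by apply: finsuppN; apply: (hfin _ (fun l => l%:~R *: g l)) => l /hg ->; rewrite scaler0.
  - by apply: finsupp_scale; exact: hfin.
  rewrite (fsum_lin (lin_scale _)).
    apply: eq_fsum => j; case: ifP => _; last by rewrite !scaler0 subr0 scaler0.
    rewrite expzS !scalerA -scalerBl scalerA; congr (_ *: _).
    rewrite rmorphN rmorphD /=; ring.
  apply: finsuppD; first by apply: finsupp_scale; exact: hfin.
  by apply: finsuppN; apply: (hfin _ (fun l => l%:~R *: g l)) => l /hg ->; rewrite scaler0.
apply: isEZ; apply: (isEB charK); first by apply: (isE_mul charK); exact: IH.
by apply: IH; [move=> l /hg ->; rewrite scaler0|exact: (isE_mul charK h)].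
Qed.

(* omega(-z) = -1 - omega(z) *)
Lemma omega_refl q : (-1) ^+ absz q * omega K q = - (unit_ser K q + omega K q).
Proof.
have sg (m n : int) : (-1) ^+ absz (m + n)%R = (-1) ^+ absz m * (-1) ^+ absz n :> K.
  by rewrite -exprD -signr_odd -[RHS]signr_odd; congr (_ ^+ nat_of_bool _); lia.
have he1 := bddK_expz K 1; have heN := bddK_expz K (-1).
have ho := bddK_omega K; have hu := bddK_unit K.
have hd : bddK (unit_ser K + omega K) := @bddD _ K^o _ _ hu ho.
pose o' := (fun q => (-1) ^+ absz q * omega K q) : int -> K^o.
have ho' : bdd o' by exists (-1) => r hr; rewrite /o' omega_lt // mulr0.
(* $e^{-z}\omega=\omega-e^{-z}$, obtained from $e^z\omega=\omega+1$. *)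
have EN : cmul (expz K (-1)) (omega K) = omega K - expz K (-1).
  have : cmul (expz K (-1)) (cmul (expz K 1) (omega K)) = omega K.
    rewrite /cmul (@convA _ K^o) // expzD // addNr.
    have -> : expz K 0 = unit_ser K by apply/funext => p; exact: expz0.
    by rewrite conv1.
  rewrite cmul_expz1_omega /cmul (@convDr _ K^o) // => E.
  by rewrite -[in RHS]E -!/(cmul _ _) cmul1 addrK.
(* Both sides equal $-e^z$, and $e^z-1$ can then be cancelled. *)
have E : expm1 o' = expm1 (- (unit_ser K + omega K) : int -> K^o).
  have -> : expm1 (- (unit_ser K + omega K) : int -> K^o) = (- expz K 1 : int -> K^o).
    rewrite /expm1 convNr (@convDr _ K^o) // -!/(cmul _ _) cmul1 cmul_expz1_omega.
    apply/funext => p; rewrite -[LHS]/(- (expz K 1 p + (omega K p + unit_ser K p)) - - (unit_ser K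
        p + omega K p)).
    rewrite -[RHS]/(- expz K 1 p); ring.
  apply/funext => p; rewrite -[LHS]/(conv (expz K 1) o' p - o' p).
  have -> : conv (expz K 1) o' p = (-1) ^+ absz p * cmul (expz K (-1)) (omega K) p.
    rewrite -[RHS]/((-1) ^+ absz p *: (conv (expz K (-1)) (omega K : int -> K^o) p)).
    rewrite /conv (fsum_lin (lin_scale _)); last exact: (@conv_finsupp _ K^o).
    apply: eq_fsum => r; rewrite /o'.
    rewrite -[LHS]/(expz K 1 (p - r) * ((-1) ^+ absz r * omega K r)).
    rewrite -[RHS]/((-1) ^+ absz p * (expz K (-1) (p - r) * omega K r)).
    have -> : absz p = absz (p - r + r)%R by rewrite subrK.
    rewrite sg; case: (ltP (p - r) 0) => h; first by rewrite !expz_neg // !(mul0r, mulr0).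
    case: (p - r) h => // n _; rewrite expzN /=.
    have e1 : (-1) ^+ n * (-1) ^+ n = 1 :> K by rewrite -exprMn mulrNN mulr1 expr1n.
    move: ((-1) ^+ n : K) e1 ((-1) ^+ absz r : K) (expz K 1 n) (omega K r) => x e1 y z t.
    rewrite -[LHS]mul1r -e1; ring.
  rewrite EN -[(omega K - _) p]/(omega K p - expz K (-1) p) /o' mulrBr addrAC subrr add0r.
  rewrite -[RHS]/(- expz K 1 p); congr (- _).
  case: (ltP p 0) => h; first by rewrite !expz_neg // mulr0.
  case: p h => // n _; rewrite expzN mulrA -exprMn mulrNN mulr1 expr1n mul1r //.
have hN : bdd (- (unit_ser K + omega K) : int -> K^o) by apply: bddN.
have := omega_expm1 ho'; rewrite E omega_expm1 // => H; exact: (esym (congr1 (fun f => f q) H)).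
Qed.

End PolynomialFunctions.

(** * Fields on W, locality and the products a^e_n b *)

Section Fields.
Variable K : fieldType.
Hypothesis charK : [pchar K] =i pred0.
Variable W : lmodType K.
Implicit Types (a b c u v : ser W) (w : W).

Definition prodser a b (M : int) w : int -> W := fun i => a i (b (M - i) w).
Definition prodserop a b (M : int) w : int -> W := fun i => b (M - i) (a i w).
Definition bracket a b (M : int) w : int -> W := prodser a b M w - prodserop a b M w.

(** With $x_1=tx_2$ one has $(x_1-x_2)^k=x_2^k(t-1)^k$, so this says $(x_1-x_2)^k[a(x_1),b(x_2)]=0$
    in every total degree. *)
Definition locord k a b := forall M w, polyfun k (bracket a b M w).
Definition local a b := exists k, locord k a b.

(** The value 0 for functions without an expansion is a dummy; products of local fields always have
    one, by [eprodcP]. *)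
Definition expansion (g : int -> W) : int -> W :=
  if pselect (exists A, isE g A) is left H then projT1 (cid H) else 0.

Lemma expansionE g A : isE g A -> expansion g = A.
Proof.
move=> h; rewrite /expansion; case: pselect => [H|[]]; last by exists A.
exact: (isE_uniq charK (projT2 (cid H)) h).
Qed.

(* The coefficient of z^q in sum_n (a^e_n b) z^{-n-1}; thus [eprodn a n b] is a^e_n b. *)
Definition eprodc a b (q : int) : ser W := fun M w => expansion (prodser a b M w) q.
Definition eprodn a (n : int) b : ser W := eprodc a b (- n - 1).

Lemma eprodc_isE a b M w A : isE (prodser a b M w) A -> forall q, eprodc a b q M w = A q.
Proof. by move=> h q; rewrite /eprodc (expansionE h). Qed.

Lemma locord_le k l a b : (k <= l)%N -> locord k a b -> locord l a b.
Proof. by move=> h H M w; exact: polyfun_le h (H M w). Qed.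

(** The bound in the exponent of $x_1$ comes from the opposite ordering, which agrees after [k]
    differences. One [N] serves all total degrees [M], as membership in $W((x_1,x_2))$ requires. *)
Lemma prodser_trunc k a b : Defs.inE a -> Defs.inE b -> locord k a b -> forall w, exists N : int,
    forall M i,
  i < N \/ M + Posz k - i < N -> iter k (@bdiff K W) (prodser a b M w) i = 0.
Proof.
case=> la ta [lb tb] H w; have [Na hNa] := ta w; have [Nb hNb] := tb w.
exists (Num.min Na Nb) => M i; rewrite !lt_min => -[/andP[h _]|/andP[_ h]].
  have -> : prodser a b M w = bracket a b M w + prodserop a b M w by rewrite subrK.
  rewrite iter_bdiffD H add0r; apply: iter_bdiff_supp => t _.
  by rewrite /prodserop hNa ?lin0 //; lia.
apply: iter_bdiff_supp => t ht; rewrite /prodser hNb ?lin0 //; lia.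
Qed.

Lemma finsupp_prodser k a b M w : Defs.inE a -> Defs.inE b -> locord k a b -> finsupp (iter k
    (@bdiff K W) (prodser a b M w)).
Proof.
move=> ha hb H; have [N hN] := prodser_trunc ha hb H w.
apply: (@finsupp_itv _ _ N (M + Posz k - N)) => i hi; apply: hN; [left|right]; lia.
Qed.

Lemma eprodcP a b M w : Defs.inE a -> Defs.inE b -> local a b -> isE (prodser a b M w) (fun q =>
    eprodc a b q M w).
Proof.
move=> ha hb [k H]; have [A hA] := isE_ex (finsupp_prodser M w ha hb H).
by rewrite (_ : (fun q => _) = A) //; apply/funext => q; exact: eprodc_isE.
Qed.

Lemma inE_eprodc a b q : Defs.inE a -> Defs.inE b -> local a b -> Defs.inE (eprodc a b q).
Proof.
move=> ha hb hl; split=> [M x w w'|w].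
  rewrite (@eprodc_isE a b M _ (fun q => x *: eprodc a b q M w + eprodc a b q M w')) //.
  have := isED charK (isEZ x (eprodcP M w ha hb hl)) (eprodcP M w' ha hb hl); congr isE.
  apply/funext => i; rewrite -[LHS]/(x *: a i (b (M - i) w) + a i (b (M - i) w')).
  by case: ha hb => la _ [lb _]; rewrite /prodser lb la.
(* If $M+k<2N$, every [i] satisfies $i<N$ or $M+k-i<N$, so the cleared function vanishes
   identically. *)
case: hl => k H; have [N hN] := prodser_trunc ha hb H w; exists (2 * N - Posz k) => M hM.
rewrite (@eprodc_isE a b M _ 0) //; apply: (@isE_polyfun _ _ k); apply/funext => i; apply: hN; lia.
Qed.

(* the summands of the normally ordered product *)
Definition normord a b M w : int -> W :=
  fun j => if 0 <= j then prodser a b M w j else prodserop a b M w j.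

Lemma finsupp_normord a b M w : Defs.inE a -> Defs.inE b -> finsupp (normord a b M w).
Proof.
case=> la ta [lb tb]; have [Na hNa] := ta w; have [Nb hNb] := tb w.
apply: (@finsupp_itv _ _ (Num.min 0 Na) (Num.max 0 (M - Nb))) => j.
  rewrite lt_min => /andP[h1 h2]; rewrite /normord; case: ifP => [|_]; first lia.
  by rewrite /prodserop hNa // lin0.
rewrite gt_max => /andP[h1 h2]; rewrite /normord; case: ifP => [_|]; last lia.
by rewrite /prodser hNb ?lin0 //; lia.
Qed.

(** The product is its normally ordered part plus the commutator cut off to $j<0$. The first is a
    Laurent polynomial in $t$ and expands without poles; the second expands through [theta], so its
    poles identify the coefficients of the commutator with the $a^e_sb$. *)
Lemma ope k a b M w : Defs.inE a -> Defs.inE b -> locord k a b ->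
  [/\ forall j, bracket a b M w j = \sum_(s < k) expz K (- j) s *: eprodn a s b M w,
      forall q, eprodc a b q M w = expsum (normord a b M w) q + \sum_(s < k) theta K s q *: eprodn
          a s b M w &
      forall s : nat, (k <= s)%N -> eprodn a s b M w = 0].
Proof.
move=> ha hb H; have [c hc] := polyfunP charK (H M w).
have hE q : eprodc a b q M w = expsum (normord a b M w) q + \sum_(s < k) theta K s q *: c s.
  rewrite (@eprodc_isE a b M w (expsum (normord a b M w) + fun q => \sum_(s < k) theta K s q *: c
      s)) //.
  have := isED charK (isE_finsupp (finsupp_normord M w ha hb)) (isE_half_sum charK k c); congr isE.
  apply/funext => j; rewrite -[LHS]/(normord a b M w j + _) /normord.
  case: (ltP j 0) => h; last by rewrite addr0.
  by rewrite -hc -[bracket a b M w j]/(prodser a b M w j - prodserop a b M w j) addrC subrK.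
have hs (s : nat) : eprodn a s b M w = if (s < k)%N then c s else 0.
  rewrite /eprodn hE sum_theta_pole // (_ : expsum _ _ = 0) ?add0r //.
  by apply: fsum0 => i; rewrite expz_neg ?scale0r //; lia.
split=> [j|q|s hk]; last by rewrite hs ltnNge hk.
  by rewrite hc; apply: eq_bigr => s _; rewrite hs ltn_ord.
by rewrite hE; congr (_ + _); apply: eq_bigr => s _; rewrite hs ltn_ord.
Qed.

Lemma bracketE k a b M w j : Defs.inE a -> Defs.inE b -> locord k a b ->
  bracket a b M w j = \sum_(s < k) expz K (- j) s *: eprodn a s b M w.
Proof. by move=> ha hb H; case: (ope M w ha hb H). Qed.

Lemma eprodn_big k a b M w (s : nat) : Defs.inE a -> Defs.inE b -> locord k a b -> (k <= s)%N ->
    eprodn a s b M w = 0.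
Proof. by move=> ha hb H; case: (ope M w ha hb H) => _ _; apply. Qed.

Lemma eprodc_lt k a b M w q : Defs.inE a -> Defs.inE b -> locord k a b -> q < - Posz k -> eprodc a
    b q M w = 0.
Proof.
move=> ha hb H hq; have -> : q = - Posz (absz (- q - 1)%R) - 1 by lia.
by apply: (eprodn_big M w ha hb H); lia.
Qed.

(** The correction to the normally ordered product consists of the constant terms of [theta], which
    up to sign are $B_{s+1}/(s+1)!$. *)
Lemma eprodn_normord k a b M w : Defs.inE a -> Defs.inE b -> locord k a b ->
  eprodn a (-1) b M w = fsum (normord a b M w) + \sum_(s < k) theta K s 0 *: eprodn a s b M w.
Proof.
move=> ha hb H; case: (ope M w ha hb H) => _ h _; rewrite /eprodn opprK subrr h.
by congr (_ + _); apply: eq_fsum => i; rewrite expz_0 scale1r.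
Qed.

(** Converse use of [ope]: any explicit polynomial formula for the commutators proves locality and
    computes all products of nonnegative index. *)
Lemma ope_uniq k a b (y : nat -> ser W) : Defs.inE a -> Defs.inE b ->
  (forall M w j, bracket a b M w j = \sum_(s < k) expz K (- j) s *: y s M w) ->
  locord k a b /\ forall s : nat, eprodn a s b = if (s < k)%N then y s else 0.
Proof.
move=> ha hb h; have H : locord k a b.
  move=> M w; rewrite (_ : bracket a b M w = fun j => \sum_(s < k) expz K (- j) s *: y s M w).
    by apply: polyfun_sum => s; exact: (polyfun_mon charK _ (ltn_ord s)).
  by apply/funext => j; exact: h.
split=> // s; apply/funext => M; apply/funext => w.
have := @polyfun_coef_inj K charK W k k (fun s => eprodn a s b M w) (fun s => y s M w) _ s.
have -> : (if (s < k)%N then y s else 0) M w = if (s < k)%N then y s M w else 0 by case: ifP.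
move=> <- => [|j]; last by rewrite -(bracketE M w j ha hb H) h.
by case: ltnP => // hk; rewrite (eprodn_big M w ha hb H hk).
Qed.

(* x d/dx *)
Definition euler a : ser W := fun k w => k%:~R *: a k w.

Lemma inE_euler a : Defs.inE a -> Defs.inE (euler a).
Proof.
case=> la ta; split=> [k x w w'|w]; first by rewrite /euler la scalerDr !scalerA mulrC.
by have [N hN] := ta w; exists N => k hk; rewrite /euler hN // scaler0.
Qed.

Lemma inE_lin x a b : Defs.inE a -> Defs.inE b -> Defs.inE (x *: a + b).
Proof.
case=> la ta [lb tb]; split=> [k y w w'|w].
  rewrite -[LHS]/(x *: a k (y *: w + w') + b k (y *: w + w')) la lb.
  rewrite -[RHS]/(y *: (x *: a k w + b k w) + (x *: a k w' + b k w')).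
  by rewrite !scalerDr !scalerA addrACA [x * y]mulrC.
have [Na hNa] := ta w; have [Nb hNb] := tb w.
exists (Num.min Na Nb) => k; rewrite lt_min => /andP[/hNa h1 /hNb h2].
by rewrite -[LHS]/(x *: a k w + b k w) h1 h2 scaler0 addr0.
Qed.

Lemma inE0 : Defs.inE (0 : ser W).
Proof. by split=> [k x w w'|w]; [rewrite scaler0 addr0|exists 0]. Qed.

Lemma inE_id : Defs.inE (@idser K W).
Proof.
split=> [k x w w'|w]; rewrite /idser; first by case: ifP => _ //; rewrite scaler0 addr0.
by exists 0 => k hk; case: eqP => //; lia.
Qed.

Lemma locord_eulerl k a b : locord k a b -> (forall i, lin (b i)) -> locord k.+1 (euler a) b.
Proof.
move=> H lb M w; rewrite (_ : bracket _ _ _ _ = fun i => i%:~R *: bracket a b M w i).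
  exact: polyfun_mul.
apply/funext => i; rewrite -[LHS]/(i%:~R *: a i (b (M - i) w) - b (M - i) (i%:~R *: a i w)).
rewrite -[RHS]/(i%:~R *: (a i (b (M - i) w) - b (M - i) (a i w))).
by rewrite scalerBr (linZ (lb _)).
Qed.

Lemma localDl a b : local a b -> (forall k, lin (b k)) -> local (euler a) b.
Proof. by move=> [k H] lb; exists k.+1; exact: locord_eulerl. Qed.

Lemma local_sym a b : local a b -> local b a.
Proof.
case=> k H; exists k => M w.
rewrite (_ : bracket b a M w = - (fun i => bracket a b M w (M - i))).
  by apply/polyfunN/polyfun_refl.
apply/funext => i; rewrite -[RHS]/(- (prodser a b M w (M - i) - prodserop a b M w (M - i))) opprB.
by rewrite /prodser /prodserop (_ : M - (M - i) = i) //; lia.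
Qed.

Lemma local_linr x a b c : (forall k, lin (a k)) -> local a b -> local a c -> local a (x *: b + c).
Proof.
move=> la [k H] [l H']; exists (maxn k l) => M w.
rewrite (_ : bracket a (x *: b + c) M w = (fun i => x *: bracket a b M w i) + bracket a c M w).
  apply: polyfunD; first exact/polyfunZ/(polyfun_le (leq_maxl _ _) (H M w)).
  exact: (polyfun_le (leq_maxr _ _) (H' M w)).
apply/funext => i.
rewrite -[LHS]/(a i (x *: b (M - i) w + c (M - i) w) - (x *: b (M - i) (a i w) + c (M - i) (a i w))).
rewrite -[RHS]/(x *: (a i (b (M - i) w) - b (M - i) (a i w)) + (a i (c (M - i) w) - c (M - i) (a i w))).
by rewrite la scalerBr opprD addrACA.
Qed.

Lemma local_linl x a b c : (forall k, lin (c k)) -> local a c -> local b c -> local (x *: a + b) c.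
Proof. by move=> lc /local_sym h1 /local_sym h2; apply/local_sym/local_linr. Qed.

Lemma local0 a : (forall k, lin (a k)) -> local a 0.
Proof. by move=> la; exists 0%N => M w; apply/funext => i; rewrite /= -[LHS]/(a i 0 - 0) lin0 //
    subr0. Qed.

Lemma local_0l a : (forall k, lin (a k)) -> local 0 a.
Proof. by move=> la; apply/local_sym/local0. Qed.

Lemma local_id a : (forall k, lin (a k)) -> local a (@idser K W).
Proof.
move=> la; exists 0%N => M w; apply/funext => i.
rewrite /= -[LHS]/(a i (idser (M - i) w) - idser (M - i) (a i w)) /idser.
by case: ifP => _; rewrite ?(lin0 (la i)) subrr.
Qed.

Lemma local_idl a : (forall k, lin (a k)) -> local (@idser K W) a.
Proof. by move=> la; apply/local_sym/local_id. Qed.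

Lemma eprodc_eulerl a b q M w : Defs.inE a -> Defs.inE b -> local a b ->
  eprodc (euler a) b q M w = (q + 1)%:~R *: eprodc a b (q + 1) M w.
Proof.
move=> ha hb hl.
by rewrite (@eprodc_isE (euler a) b M w (lderiv (fun q => eprodc a b q M w))) //; exact/(isE_mul
    charK)/eprodcP.
Qed.

Lemma eprodn_eulerl a b n M w : Defs.inE a -> Defs.inE b -> local a b ->
  eprodn (euler a) n b M w = - (n%:~R *: eprodn a (n - 1) b M w).
Proof.
move=> ha hb hl; rewrite /eprodn eprodc_eulerl // -scaleNr -rmorphN.
by congr (_%:~R *: eprodc _ _ _ _ _); lia.
Qed.

Lemma eprodn_eulerr a b n : Defs.inE a -> Defs.inE b -> local a b ->
  euler (eprodn a n b) = eprodn a n (euler b) - n%:~R *: eprodn a (n - 1) b.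
Proof.
move=> ha hb hl; apply/funext => M; apply/funext => w.
have h := eprodcP M w ha hb hl.
(* In total degree [M], the Euler operator on the second factor acts as $M-t\,d/dt$. *)
have h1 : isE (prodser a (euler b) M w) ((fun q => M%:~R *: eprodc a b q M w) - lderiv (fun q =>
    eprodc a b q M w)).
  have := isEB charK (isEZ M%:~R h) (isE_mul charK h); congr isE; apply/funext => i.
  rewrite -[LHS]/(M%:~R *: a i (b (M - i) w) - i%:~R *: a i (b (M - i) w)).
  by rewrite -scalerBl -rmorphB /prodser /euler linZ //; case: ha.
rewrite -[LHS]/(M%:~R *: eprodc a b (- n - 1) M w).
rewrite -[RHS]/(eprodc a (euler b) (- n - 1) M w - n%:~R *: eprodc a b (- (n - 1) - 1) M w).
have -> : eprodc a (euler b) (- n - 1) M w =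
    M%:~R *: eprodc a b (- n - 1) M w - (- n - 1 + 1)%:~R *: eprodc a b (- n - 1 + 1) M w.
  exact: eprodc_isE h1 _.
have -> : - n - 1 + 1 = - n by lia.
have -> : - (n - 1) - 1 = - n by lia.
by rewrite rmorphN scaleNr opprK addrK.
Qed.

Lemma eprodc_linr x a b c q : Defs.inE a -> Defs.inE b -> Defs.inE c -> local a b -> local a c ->
  eprodc a (x *: b + c) q = x *: eprodc a b q + eprodc a c q.
Proof.
move=> ha hb hc hl hl'; apply/funext => M; apply/funext => w.
have := isED charK (isEZ x (eprodcP M w ha hb hl)) (eprodcP M w ha hc hl').
have -> : (fun i : int => x *: prodser a b M w i) + prodser a c M w = prodser a (x *: b + c) M w.
  by apply/funext => i; case: ha => la _; rewrite -[RHS]/(a i (_ *: b (M - i) w + c (M - i) w)) la.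
by move=> /eprodc_isE ->.
Qed.

Lemma eprodc_linl x a b c q : Defs.inE a -> Defs.inE b -> Defs.inE c -> local a c -> local b c ->
  eprodc (x *: a + b) c q = x *: eprodc a c q + eprodc b c q.
Proof.
move=> ha hb hc hl hl'; apply/funext => M; apply/funext => w.
have h := isED charK (isEZ x (eprodcP M w ha hc hl)) (eprodcP M w hb hc hl').
exact: (@eprodc_isE (x *: a + b) c M w _ h q).
Qed.

Lemma eprodc_0l c q : eprodc 0 c q = 0.
Proof.
apply/funext => M; apply/funext => w; rewrite (@eprodc_isE 0 c M w 0) //.
exact: (@isE_polyfun _ _ 0).
Qed.

Lemma eprodc_0r a q : (forall k, lin (a k)) -> eprodc a 0 q = 0.
Proof.
move=> la; apply/funext => M; apply/funext => w; rewrite (@eprodc_isE a 0 M w 0) //.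
by apply: (@isE_polyfun _ _ 0); apply/funext => i; exact: lin0.
Qed.

Lemma eprodc_idl b q : (forall k, lin (b k)) -> eprodc (@idser K W) b q = unit_ser K q *: b.
Proof.
move=> lb; apply/funext => M; apply/funext => w.
have f : finsupp (prodser (@idser K W) b M w) by exists [:: 0] => i; rewrite inE /prodser /idser =>
    /negPf ->.
rewrite (eprodc_isE (isE_finsupp f)) /expsum (@fsum1 _ _ 0); last first.
  by move=> j /negPf h; rewrite /prodser /idser h scaler0.
by rewrite expz0 /prodser /idser eqxx subr0.
Qed.

(** Only the monomial $t^M$ survives, with expansion $e^{Mz}$; so the products with the identity are
    the divided powers of $x\,d/dx$ applied to [a]. *)
Lemma eprodc_idr a q M w : (forall k, lin (a k)) -> eprodc a (@idser K W) q M w = expz K M q *: a M w.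
Proof.
move=> la.
have h0 i : i != M -> prodser a (@idser K W) M w i = 0.
  by move=> h; rewrite /prodser /idser; case: eqP => [|_]; [lia|exact: lin0].
have f : finsupp (prodser a (@idser K W) M w) by exists [:: M] => i; rewrite inE; exact: h0.
rewrite (eprodc_isE (isE_finsupp f)) /expsum (@fsum1 _ _ M) => [|j /h0 ->]; last by rewrite scaler0.
by rewrite /prodser /idser subrr eqxx.
Qed.

End Fields.

(** * Rearrangements of finite sums *)

Lemma subrACA (W : zmodType) (x y z t : W) : x - y - (z - t) = x - z - (y - t).
Proof. by rewrite opprD addrACA -opprD. Qed.

(** The identity $[u,[a,v]]=[a,[u,v]]-[[a,u],v]$, where [x1] to [x6] are the words
    $auv,uav,uva,avu,vau,vua$. *)
Lemma jacobi_sum (W : zmodType) (x1 x2 x3 x4 x5 x6 : W) :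
  x2 - x3 - (x4 - x5) = x1 - x4 - (x3 - x6) - (x1 - x2 - (x5 - x6)).
Proof.
rewrite [RHS]subrACA [x1 - x4 - _]subrACA subrr sub0r [- (x4 - x2)]opprB.
by rewrite [x3 - x6 - _]subrACA subrr subr0 subrACA.
Qed.

(** Regroups a rectangle along its antidiagonals $n=s+r$; every larger [N] works too, since [F]
    vanishes outside the rectangle. *)
Lemma sum_triangle (W : zmodType) (F : nat -> nat -> W) (a b N : nat) : (a + b <= N)%N ->
  (forall s r, (a <= s)%N || (b <= r)%N -> F s r = 0) ->
  \sum_(s < a) \sum_(r < b) F s r = \sum_(n < N) \sum_(s < n.+1) F s (n - s)%N.
Proof.
move=> hN hF.
have E (n : 'I_N) : \sum_(s < n.+1) F s (n - s)%N =
    \sum_(s < N) if (s < n.+1)%N then F s (n - s)%N else 0.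
  by rewrite (big_ord_widen N (fun s => F s (n - s)%N)) // big_mkcond.
rewrite (eq_bigr _ (fun n _ => E n)) [RHS]exchange_big /=.
have E2 (s : 'I_N) : \sum_(n < N) (if (s < n.+1)%N then F s (n - s)%N else 0) =
    \sum_(r < N - s) F s r.
  rewrite -big_mkcond -(big_mkord (fun n => (s < n.+1)%N) (fun n => F s (n - s)%N)).
  rewrite (big_cat_nat (n := s)) //=; last exact: ltnW.
  rewrite [X in X + _]big_nat_cond big1 ?add0r; last by move=> n; lia.
  rewrite -{1}[val s]add0n big_addn big_mkord.
  apply: eq_big => r; first by rewrite ltnS leq_addl.
  by rewrite addnK.
rewrite [RHS](eq_bigr _ (fun s _ => E2 s)).
have ha : (a <= N)%N by lia.
rewrite (big_ord_widen N (fun s => \sum_(r < b) F s r) ha).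
rewrite [RHS](bigID (fun s : 'I_N => (s < a)%N)) /= [X in _ + X]big1 ?addr0; last first.
  by move=> s hs; rewrite big1 // => r _; apply: hF; lia.
apply: eq_bigr => s hs.
have hb : (b <= N - s)%N by lia.
rewrite (big_ord_widen (N - s) (F s) hb) [RHS](bigID (fun r : 'I_(N - s) => (r < b)%N)) /=.
by rewrite [X in _ + X]big1 ?addr0 // => r hr; apply: hF; lia.
Qed.

Lemma bin_sum_trunc (K : fieldType) (W : lmodType K) (X : nat -> W) (n k : nat) :
  (forall s, (k <= s)%N -> X s = 0) ->
  \sum_(s < n.+1) ('C(n, s))%:R *: X s = \sum_(s < k) ('C(n, s))%:R *: X s.
Proof.
move=> hX.
rewrite (big_ord_widen (n.+1 + k) (fun s => ('C(n, s))%:R *: X s)) ?leq_addr //.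
rewrite [RHS](big_ord_widen (n.+1 + k) (fun s => ('C(n, s))%:R *: X s)) ?leq_addl //.
rewrite big_mkcond [RHS]big_mkcond; apply: eq_bigr => s _ /=.
case: ltnP => h1; case: ltnP => h2 //; first by rewrite hX ?scaler0.
by rewrite bin_small ?scale0r.
Qed.

(** * Triples of fields and locality of the products of nonnegative index *)

Section Triple.
Variable K : fieldType.
Hypothesis charK : [pchar K] =i pred0.
Variable W : lmodType K.
Implicit Types (a b c u v : ser W) (w : W).

(** Collects what the Jacobi identity for $a,u,v$ consumes. In the applications the $a^e_su$ are
    either listed explicitly or lie in the image of $Y_W$, so their locality to [v] can be checked
    directly. *)
Record good a u v : Prop := Good {
  good_a : Defs.inE a; good_u : Defs.inE u; good_v : Defs.inE v;
  good_au : local a u; good_av : local a v; good_uv : local u v;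
  good_auv : forall s : nat, local (eprodn a s u) v }.

Lemma locord_uniform (c : nat -> ser W) v n : (forall s, local (c s) v) ->
  exists l, forall s, (s < n)%N -> locord l (c s) v.
Proof.
move=> h; elim: n => [|n [l hl]]; first by exists 0%N.
have [k hk] := h n; exists (maxn l k) => s; rewrite ltnS leq_eqVlt => /orP[/eqP ->|/hl hs].
  exact: locord_le (leq_maxr _ _) hk.
exact: locord_le (leq_maxl _ _) hs.
Qed.

Lemma polyfun_expz l (s : nat) j (f : int -> W) : polyfun l f -> polyfun (l + s) (fun i => expz K
    (j - i) s *: f i).
Proof.
move=> hf; have := polyfunZ ((-1) ^+ s / (s`!)%:R) (polyfun_mulX s (polyfun_shift j hf)).
move/(polyfun_shift (- j)); congr polyfun; apply/funext => i.
rewrite subrK scalerA; congr (_ *: _).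
rewrite (_ : j - i = - (i - j)); last by lia.
by rewrite expzN expz_nat mulrAC mulrA.
Qed.

Lemma inE_eprodn a b n : Defs.inE a -> Defs.inE b -> local a b -> Defs.inE (eprodn a n b).
Proof. exact: inE_eprodc. Qed.

(** In the Jacobi identity for $[u_i,[a_j,v]]$ the right side is, for each [j], polynomial in [i] of
    degree bounded independently of [j]. The coefficient of $(-j)^n/n!$ on the left is the bracket
    of [u] with $a^e_nv$. *)
Lemma local_nonneg a u v (n : nat) : good a u v -> local u (eprodn a n v).
Proof.
case=> ha hu hv [ka Hau] [kv Hav] [k Huv] hauv.
have [l hl] := locord_uniform ka hauv.
case: (ltnP n kv) => hn; last first.
  rewrite (_ : eprodn a n v = 0); first by apply: local0; case: hu.
  by apply/funext => M; apply/funext => w; exact: (eprodn_big charK M w ha hv Hav hn).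
exists (maxn k l) => M w.
apply: (@polyfun_coefs K charK W kv (maxn k l) (fun i s => bracket u (eprodn a s v) M w i) _ n hn) => j.
pose X i := a j (bracket u v (M - j) w i) - bracket u v (M - j) (a j w) i.
pose Z i := \sum_(s < ka) expz K (- j) s *: bracket (eprodn a s u) v M w (i + j).
have [la _] := ha; have [lu _] := hu; have [lv _] := hv.
suff -> : (fun i => \sum_(s < kv) expz K (- j) s *: bracket u (eprodn a s v) M w i) = X - Z.
  apply: polyfunB.
    apply: (polyfun_le (leq_maxl k l)); apply: polyfunB; last exact: Huv.
    by apply: polyfun_lin => //; exact: Huv.
  apply: (polyfun_le (leq_maxr k l)); apply: polyfun_sum => s; apply: polyfunZ.
  by apply: polyfun_shift; exact: (hl s (ltn_ord s)).
apply/funext => i; rewrite -[RHS]/(X i - Z i).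
have -> : Z i = (bracket a u (i + j) (v (M - i - j) w) j) - v (M - i - j) (bracket a u (i + j) w j).
  rewrite !(bracketE charK _ _ _ ha hu Hau) (lin_sum _ _ _ (lv _)) -sumrB; apply: eq_bigr => s _.
  rewrite (linZ (lv _)) -scalerBr; congr (_ *: _).
  by rewrite /bracket /prodser /prodserop -[LHS]/(_ - _) opprD addrA.
have -> : \sum_(s < kv) expz K (- j) s *: bracket u (eprodn a s v) M w i =
    u i (bracket a v (M - i) w j) - bracket a v (M - i) (u i w) j.
  rewrite !(bracketE charK _ _ _ ha hv Hav) (lin_sum _ _ _ (lu _)) -sumrB; apply: eq_bigr => s _.
  by rewrite (linZ (lu _)) -scalerBr.
rewrite /X.
rewrite -[bracket u v (M - j) w i]/(u i (v (M - j - i) w) - v (M - j - i) (u i w)).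
rewrite -[bracket u v (M - j) (a j w) i]/(u i (v (M - j - i) (a j w)) - v (M - j - i) (u i (a j w))).
rewrite -[bracket a v (M - i) w j]/(a j (v (M - i - j) w) - v (M - i - j) (a j w)).
rewrite -[bracket a v (M - i) (u i w) j]/(a j (v (M - i - j) (u i w)) - v (M - i - j) (a j (u i w))).
rewrite -[bracket a u (i + j) w j]/(a j (u (i + j - j) w) - u (i + j - j) (a j w)).
rewrite -[bracket a u (i + j) (v (M - i - j) w) j]/(a j (u (i + j - j) (v (M - i - j) w)) - u (i +
    j - j) (a j (v (M - i - j) w))).
rewrite addrK [M - j - i]addrAC !(linB (la _)) !(linB (lu _)) !(linB (lv _)).
exact: jacobi_sum.
Qed.

End Triple.

(** * The commutator formula for a^e_n and u^e_m *)

Section Commutator.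
Variable K : fieldType.
Hypothesis charK : [pchar K] =i pred0.
Variable W : lmodType K.
Implicit Types (a b c u v : ser W) (w : W).

(** Skew symmetry $[u_j,a_{i-j}]=-[a_{i-j},u_j]$ expresses the $u^e_ta$ through the $a^e_tu$ with
    factors $(j-i)^t/t!$. These raise the degree in [i], hence the bound [l + ka]. *)
Lemma local_skew a u v (s : nat) : Defs.inE a -> Defs.inE u -> Defs.inE v -> local a u ->
  (forall s : nat, local (eprodn a s u) v) -> local (eprodn u s a) v.
Proof.
move=> ha hu hv hau hauv; have [ka Hau] := hau; have [ku Hua] := local_sym hau.
have [l hl] := locord_uniform ka hauv.
have [la _] := ha; have [lu _] := hu; have [lv _] := hv.
case: (ltnP s ku) => hs; last first.
  rewrite (_ : eprodn u s a = 0); first exact: local_0l.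
  by apply/funext => M; apply/funext => w; exact: (eprodn_big charK M w hu ha Hua hs).
exists (l + ka)%N => M w.
apply: (@polyfun_coefs K charK W ku (l + ka) (fun i s => bracket (eprodn u s a) v M w i) _ s hs) => j.
suff -> : (fun i => \sum_(t < ku) expz K (- j) t *: bracket (eprodn u t a) v M w i) =
    fun i => \sum_(t < ka) - (expz K (j - i) t *: bracket (eprodn a t u) v M w i).
  apply: polyfun_sum => t; apply: polyfunN; apply: (@polyfun_le _ _ (l + t)).
    by rewrite leq_add2l ltnW.
  by apply: polyfun_expz; exact: (hl t (ltn_ord t)).
apply/funext => i.
have E x : bracket u a i x j = - bracket a u i x (i - j).
  rewrite -[LHS]/(u j (a (i - j) x) - a (i - j) (u j x)).
  rewrite -[bracket a u i x (i - j)]/(a (i - j) (u (i - (i - j)) x) - u (i - (i - j)) (a (i - j) x)).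
  by rewrite opprB (_ : i - (i - j) = j) //; lia.
transitivity (bracket u a i (v (M - i) w) j - v (M - i) (bracket u a i w j)).
  rewrite !(bracketE charK _ _ _ hu ha Hua) (lin_sum _ _ _ (lv _)) -sumrB.
  apply: eq_bigr => t _; by rewrite (linZ (lv _)) -scalerBr.
rewrite !E (linN (lv _)) -opprD sumrN; congr (- _).
rewrite !(bracketE charK _ _ _ ha hu Hau) (lin_sum _ _ _ (lv _)) -sumrB; apply: eq_bigr => t _.
by rewrite (linZ (lv _)) -scalerBr (_ : - (i - j) = j - i) //; lia.
Qed.

Lemma good_sym a u v : good a u v -> good u a v.
Proof.
case=> ha hu hv hau hav huv hauv; split=> //; first exact: local_sym.
by move=> s; exact: local_skew.
Qed.

Lemma conv_expz_sum (A : int -> W) j q (R : nat) : (forall t, t <= q - Posz R -> A t = 0) ->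
  conv (expz K j) A q = \sum_(r < R) expz K j r *: A (q - Posz r).
Proof.
move=> hA; rewrite /conv -(fsum_refl _ q) (@fsum_range _ _ 0 R).
- by apply: eq_bigr => r _; rewrite add0r; congr (expz _ _ _ *: _); lia.
- by move=> i hi; rewrite expz_neg ?scale0r //; lia.
- by move=> i hi; rewrite hA ?scaler0 //; lia.
Qed.

(** The factor $e^{-jz}$ contributes $(-j)^{n-s}z^{n-s}/(n-s)!$: this lowers the exponent by $n-s$
    and, together with $(-j)^s/s!$, produces the binomial coefficient. *)
Definition dterm a u v q (n : nat) : ser W := fun M w => eprodc u (eprodn a n v) q M w +
  \sum_(s < n.+1) ('C(n, s))%:R *: eprodc (eprodn a s u) v (q - Posz (n - s)) M w.

(* The operator a_j acts on u(x1)v(x2) as a derivation; expanding at x1 = x2 e^z gives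
   [a_j, u_{[q]} v], with a factor e^{-jz} coming from the commutator with u. *)
Lemma derivation a u v q : good a u v ->
  exists N0 : nat, forall N, (N0 <= N)%N -> forall M w j,
  bracket a (eprodc u v q) M w j = \sum_(n < N) expz K (- j) n *: dterm a u v q n M w.
Proof.
move=> hg; have [ha hu hv [ka Hau] [kv Hav] [k Huv] hauv] := hg.
have [l hl] := locord_uniform ka hauv.
have [la _] := ha; have [lu _] := hu; have [lv _] := hv.
have hc s : Defs.inE (eprodn a (Posz s) u) by apply: inE_eprodn => //; exists ka.
have c0 s : (ka <= s)%N -> eprodn a s u = 0.
  by move=> hs; apply/funext => M; apply/funext => w; exact: (eprodn_big charK M w ha hu Hau hs).
have v0 s : (kv <= s)%N -> eprodn a s v = 0.
  by move=> hs; apply/funext => M; apply/funext => w; exact: (eprodn_big charK M w ha hv Hav hs).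
(* The expansions of the products of $a^e_su$ with [v] start no earlier than $z^{-l}$, so [R] terms
   of $e^{-jz}$ determine the coefficient of $z^q$. *)
pose R := absz (`|q| + Posz l + 1)%R.
have hR s t M w : (s < ka)%N -> t <= q - Posz R -> eprodc (eprodn a s u) v t M w = 0.
  by move=> hs ht; apply: (eprodc_lt charK M w (hc s) hv (hl s hs)); lia.
exists (kv + (ka + R))%N => N hN M w j.
have [hN1 hN2] : (kv <= N)%N /\ (ka + R <= N)%N by lia.
(* The expansion of [F] is computed twice: as a commutator with $a_j$, and through the polynomial
   formulas for the two inner brackets. The bracket of $a_j$ with $u_i$ has total degree $i+j$. *)
pose F i := bracket a u (i + j) (v (M - i - j) w) j + u i (bracket a v (M - i) w j).
have F1 : isE F (fun q => bracket a (eprodc u v q) M w j).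
  have huv : local u v by exists k.
  have := isEB charK (isE_lin (la j) (eprodcP charK (M - j) w hu hv huv)) (eprodcP charK (M - j) (a
      j w) hu hv huv).
  congr isE; apply/funext => i; rewrite /F.
  rewrite -[LHS]/(a j (u i (v (M - j - i) w)) - u i (v (M - j - i) (a j w))).
  rewrite -[bracket a v (M - i) w j]/(a j (v (M - i - j) w) - v (M - i - j) (a j w)).
  rewrite -[bracket a u (i + j) (v (M - i - j) w) j]/(a j (u (i + j - j) (v (M - i - j) w)) - u (i
      + j - j) (a j (v (M - i - j) w))).
  by rewrite addrK (linB (lu _)) addrA subrK [M - j - i]addrAC.
have F2 : isE F (fun q => \sum_(s < ka) expz K (- j) s *: conv (expz K (- j)) (fun q => eprodc
    (eprodn a s u) v q M w) q
    + \sum_(n < kv) expz K (- j) n *: eprodc u (eprodn a n v) q M w).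
  have h1 := isE_sum charK (index_enum 'I_ka) (fun s : 'I_ka =>
    isEZ (expz K (- j) s) (isE_shift charK (- j) (eprodcP charK M w (hc s) hv (hauv s)))).
  have hu' n : local u (eprodn a (Posz n) v) := local_nonneg charK n hg.
  have hv' n : Defs.inE (eprodn a (Posz n) v) by apply: inE_eprodn => //; exists kv.
  have h2 := isE_sum charK (index_enum 'I_kv) (fun n : 'I_kv =>
    isEZ (expz K (- j) n) (eprodcP charK M w hu (hv' n) (hu' n))).
  have := isED charK h1 h2; congr isE; apply/funext => i; rewrite /F.
  rewrite !(bracketE charK _ _ _ ha hv Hav) !(bracketE charK _ _ _ ha hu Hau) (lin_sum _ _ _ (lu _)).
  rewrite -[LHS]/(_ + _); congr (_ + _); apply: eq_bigr => s _; last by rewrite (linZ (lu _)).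
  by rewrite opprK /prodser; congr (_ *: eprodn a s u _ (v _ _)); lia.
have E : bracket a (eprodc u v q) M w j = _ := congr1 (fun f => f q) (isE_uniq charK F1 F2).
rewrite {}E.
(* Terms are sorted by the total power of $-j$. *)
transitivity (\sum_(n < N) expz K (- j) n *: eprodc u (eprodn a n v) q M w +
  \sum_(n < N) \sum_(s < n.+1) (expz K (- j) s * expz K (- j) (n - s)%N) *:
     eprodc (eprodn a s u) v (q - Posz (n - s)) M w); last first.
  rewrite -big_split; apply: eq_bigr => n _; rewrite /= scalerDr; congr (_ + _).
  rewrite scaler_sumr; apply: eq_bigr => s _; rewrite scalerA; congr (_ *: _).
  have hs : (s <= n)%N by rewrite -ltnS.
  rewrite !expz_nat mulrACA -exprD subnKC // -(bin_fact hs) !natrM.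
  have b0 : ('C(n, s))%:R != 0 :> K by rewrite natK_eq0 // -lt0n bin_gt0.
  move: ((- j)%:~R ^+ n) => x.
  by field; rewrite !factK_neq0 // b0.
rewrite addrC; congr (_ + _).
  rewrite (big_ord_widen N (fun n => expz K (- j) n *: eprodc u (eprodn a n v) q M w) hN1) big_mkcond.
  by apply: eq_bigr => n _; case: ltnP => // h; rewrite v0 // (eprodc_0r charK _ lu) scaler0.
rewrite -(@sum_triangle W (fun s r => (expz K (- j) s * expz K (- j) r) *: eprodc (eprodn a s u) v
    (q - Posz r) M w) ka R) //.
  apply: eq_bigr => s _; rewrite (@conv_expz_sum _ _ _ R); last by move=> t; exact: hR.
  by rewrite scaler_sumr; apply: eq_bigr => r _; rewrite scalerA.
move=> s r h; case: (leqP ka s) => hs; first by rewrite c0 // (eprodc_0l charK) scaler0.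
by rewrite hR ?scaler0 //; lia.
Qed.

Lemma local_eprodc a u v q : good a u v -> local a (eprodc u v q).
Proof.
move=> hg; have [N0 h] := derivation q hg; have [ha hu hv hau _ huv _] := hg.
have he : Defs.inE (eprodc u v q) by exact: inE_eprodc.
by case: (ope_uniq charK ha he (h N0 (leqnn _))) => H _; exists N0.
Qed.

Lemma local_eprodn a u v n : good a u v -> local u (eprodn a n v).
Proof. by move/good_sym; exact: local_eprodc. Qed.

(** By [ope_uniq] this is the coefficient of $(-j)^n/n!$ in [derivation]. *)
Lemma comm_nonneg a u v ka (n : nat) q M w : good a u v -> locord ka a u ->
  eprodn a n (eprodc u v q) M w - eprodc u (eprodn a n v) q M w =
  \sum_(s < ka) gbin K n s *: eprodc (eprodn a s u) v (q - Posz n + Posz s) M w.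
Proof.
move=> hg Hau; have [N0 h] := derivation q hg; have [ha hu hv hau _ huv _] := hg.
have he : Defs.inE (eprodc u v q) by exact: inE_eprodc.
have hN : (N0 <= n.+1 + N0)%N by exact: leq_addl.
case: (ope_uniq charK ha he (h _ hN)) => _ /(_ n) ->; rewrite leq_addr /dterm addrAC subrr add0r.
have c0 s : (ka <= s)%N -> eprodc (eprodn a s u) v (q - Posz n + Posz s) M w = 0.
  move=> hs; rewrite (_ : eprodn a s u = 0) ?(eprodc_0l charK) //.
  by apply/funext => M'; apply/funext => w'; exact: (eprodn_big charK M' w' ha hu Hau hs).
under [RHS]eq_bigr do rewrite gbin_nat //.
rewrite -(bin_sum_trunc n c0); apply: eq_bigr => s _; congr (_ *: eprodc _ _ _ _ _).
by have := ltn_ord s; lia.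
Qed.

(** Separates the polar term of the derived factor $1+\omega$ from the rest. By [omega_refl] the
    regular coefficients are the constants [theta s 0] up to sign, ready to cancel against those of
    [eprodn_normord]. *)
Lemma conv_lderivnK (A : int -> W) (r S : nat) q : (forall t, t <= q + Posz r - Posz S -> A t = 0) ->
  conv (lderivnK r (unit_ser K + omega K)) A q = (-1) ^+ r *: A (q + 1 + Posz r)
    - \sum_(s < S) theta K s 0 *: (gbin K s r *: A (q - Posz s + Posz r)).
Proof.
move=> hA; rewrite /conv -(fsum_refl _ (q + Posz r)) (@fsum_range _ _ (-1) S.+1); last first.
- by move=> s hs; rewrite hA ?scaler0 //; lia.
- move=> s hs; rewrite lderivnKE (_ : q - (q + Posz r - s) + Posz r = s); last by lia.
  rewrite -[(unit_ser K + omega K) s]/(unit_ser K s + omega K s) omega_lt // /unit_ser.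
  by case: eqP => [|_]; [lia|rewrite addr0 mulr0 scale0r].
rewrite big_ord_recl -sumrN; congr (_ + _).
  rewrite lderivnKE (_ : q - (q + Posz r - (-1 + 0)) + Posz r = -1); last by lia.
  rewrite gbin_N1 // -[(unit_ser K + omega K) (-1)]/(0 + omega K (-1)) add0r omega_N1 mulr1.
  by congr (_ *: A _) => /=; lia.
apply: eq_bigr => s _; rewrite /bump /= lderivnKE.
rewrite (_ : q - (q + Posz r - (-1 + Posz (1 + s))) + Posz r = s); last by lia.
rewrite -[(unit_ser K + omega K) s]/(unit_ser K s + omega K s) -[unit_ser K s + _]opprK -omega_refl //.
rewrite theta_0 // mulrN scaleNr scalerA [gbin _ _ _ * _]mulrC; by congr (- (_ *: A _)); rewrite
    /bump; lia.
Qed.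

(** Both occurrences of $a^e_{-1}$ are replaced by normally ordered products. Moving the modes
    $a_j$, $j\ge0$, past [u] costs geometric series of commutators. Their regular part cancels
    against the [theta] corrections, compared by [comm_nonneg], and only the polar terms remain. *)
Lemma comm_N1 a u v ka q M w : good a u v -> locord ka a u ->
  eprodn a (-1) (eprodc u v q) M w - eprodc u (eprodn a (-1) v) q M w =
  \sum_(s < ka) gbin K (-1) s *: eprodc (eprodn a s u) v (q + 1 + Posz s) M w.
Proof.
move=> hg Hau; have [ha hu hv hau hav huv hauv] := hg.
have [la ta] := ha; have [lu tu] := hu; have [lv tv] := hv.
have hq : Defs.inE (eprodc u v q) by exact: inE_eprodc.
have [kv Hav] := hav; have [kq Haq] := local_eprodc q hg; have [k Huv] := huv.
have hc s : Defs.inE (eprodn a (Posz s) u) by apply: inE_eprodn.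
have [l hl] := locord_uniform ka hauv.
(* One length for all [theta] sums: it exceeds both locality orders of [a] and also the truncation
   bound needed by [conv_lderivnK]. *)
pose S := (kv + kq + absz (`|q| + Posz l + Posz ka + 1)%R)%N.
have hS1 : (kv <= S)%N by rewrite /S; lia.
have hS2 : (kq <= S)%N by rewrite /S; lia.
pose A s t := eprodc (eprodn a (Posz s) u) v t M w.
(* The j-th term of the normally ordered product of [a] with $u(x_1)v(x_2)$, before setting
   $x_1=x_2e^z$. *)
pose f j i := if 0 <= j then a j (prodser u v (M - j) w i) else prodser u v (M - j) (a j w) i.
have isEf : isE (fun i => fsum (fun j => f j i)) (fun t => fsum (normord a (eprodc u v t) M w)).
  have [N hN] := prodser_trunc hu hv Huv w; have [Na hNa] := ta w.
  (* Outside this range the k-th difference of [f j] vanishes: for large [j] the total degree $M-j$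
     is too low, for very negative [j] one has $a_jw=0$. *)
  have := @isE_fsum K charK W f (fun j t => normord a (eprodc u v t) M w j)
    (zrange (Num.min 0 Na) (absz (Num.max 0 (M + Posz k - 2 * N) - Num.min 0 Na)%R).+1) k.
  apply.
  - move=> j; rewrite /f /normord; case: (0 <= j).
      exact: (isE_lin (la j) (eprodcP charK _ _ hu hv huv)).
    exact: (eprodcP charK _ _ hu hv huv).
  - move=> j; rewrite mem_zrange => hj; apply/funext => i; rewrite /f; case: (boolP (0 <= j)) => hj0.
      by rewrite (iter_bdiff_lin k _ (la j)) hN ?(lin0 (la j)) //; lia.
    apply: iter_bdiff_supp => t _; rewrite hNa; last by lia.
    by rewrite /prodser (lin0 (lv _)) (lin0 (lu _)).
  - move=> i; have [Nv hNv] := tv w.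
    apply: (@finsupp_itv _ _ (Num.min 0 Na) (Num.max 0 (M - i - Nv))) => j.
      rewrite lt_min => /andP[h1 h2]; rewrite /f; case: ifP => [|_]; first lia.
      by rewrite hNa // /prodser (lin0 (lv _)) (lin0 (lu _)).
    rewrite gt_max => /andP[h1 h2]; rewrite /f; case: ifP => [_|]; last lia.
    by rewrite /prodser hNv ?(lin0 (lu _)) ?(lin0 (la _)) //; lia.
have isEg (s : nat) : isE (geom s (prodser (eprodn a s u) v M w)) (conv (lderivnK s (unit_ser K +
    omega K)) (A s)).
  have [Nv hNv] := tv w.
  apply: (@isE_geom K charK W s _ _ (M - Nv)); last exact: (eprodcP charK).
  by move=> t ht; rewrite /prodser hNv; [apply: lin0; case: (hc s)|lia].
have isEb (s : nat) : isE (prodser u (eprodn a s v) M w) (fun t => eprodc u (eprodn a s v) t M w).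
  by apply: (eprodcP charK) => //; [exact: inE_eprodn|exact: local_nonneg].
have H1 : isE (prodser u (eprodn a (-1) v) M w) (fun t => fsum (normord a (eprodc u v t) M w)
    - \sum_(s < ka) conv (lderivnK s (unit_ser K + omega K)) (A s) t
    + \sum_(s < S) theta K s 0 *: eprodc u (eprodn a s v) t M w).
  have := isED charK (isEB charK isEf (isE_sum charK (index_enum 'I_ka) (fun s : 'I_ka => isEg s)))
    (isE_sum charK (index_enum 'I_S) (fun s : 'I_S => isEZ (theta K s 0) (isEb s))).
  congr isE; apply/funext => i.
  rewrite -[LHS]/(fsum (fun j => f j i) - \sum_(s < ka) geom s (prodser (eprodn a s u) v M w) i
     + \sum_(s < S) theta K s 0 *: prodser u (eprodn a s v) M w i).
  rewrite {3}/prodser (eprodn_normord charK _ _ ha hv (locord_le hS1 Hav)) (linD (lu _)) (lin_sum _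
      _ _ (lu _)).
  congr (_ + _); last by apply: eq_bigr => s _; rewrite (linZ (lu _)).
  have [Nv hNv] := tv w; have [Na hNa] := ta w.
  have fin_f : finsupp (fun j => f j i).
    apply: (@finsupp_itv _ _ (Num.min 0 Na) (Num.max 0 (M - i - Nv))) => j.
      rewrite lt_min => /andP[h1 h2]; rewrite /f; case: ifP => [|_]; first lia.
      by rewrite hNa // /prodser (lin0 (lv _)) (lin0 (lu _)).
    rewrite gt_max => /andP[h1 h2]; rewrite /f; case: ifP => [_|]; last lia.
    by rewrite /prodser hNv ?(lin0 (lu _)) ?(lin0 (la _)) //; lia.
  have fin_g (s : nat) : finsupp (fun j : int => if 0 <= j then expz K (- j) s *: prodser (eprodn a
      s u) v M w (i + j) else 0).
    apply: (@finsupp_itv _ _ 0 (M - i - Nv)) => j hj; first by case: ifP => //; lia.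
    case: ifP => // _; rewrite /prodser hNv; last by lia.
    by rewrite lin0 ?scaler0 //; case: (hc s).
  rewrite (fsum_lin (lu _)); last exact: finsupp_normord.
  rewrite /geom -(@fsum_sum _ _ (index_enum 'I_ka) (fun s : 'I_ka => fun j : int =>
    if 0 <= j then expz K (- j) s *: prodser (eprodn a s u) v M w (i + j) else 0)) //.
  rewrite -fsumN -fsumD //; last first.
    apply: finsuppN; elim: (index_enum _) => [|s r IH]; first by exists [::] => j _; rewrite big_nil.
    by case: (finsuppD (fin_g s) IH) => t ht; exists t => j /ht E; rewrite big_cons.
  apply: eq_fsum => j; rewrite /f /normord; case: ifP => hj; last first.
    by rewrite big1 // subr0 /prodser /prodserop addrAC.
  have -> : \sum_(s < ka) expz K (- j) s *: prodser (eprodn a s u) v M w (i + j) =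
      bracket a u (i + j) (v (M - (i + j)) w) j.
    by rewrite (bracketE charK _ _ _ ha hu Hau).
  rewrite -[bracket a u _ _ j]/(a j (u (i + j - j) (v (M - (i + j)) w)) - u (i + j - j) (a j (v (M
      - (i + j)) w))).
  rewrite /prodser addrK [M - j - i]addrAC (_ : M - (i + j) = M - i - j); last by lia.
  by rewrite opprB [LHS]addrC subrK.
have E : eprodc u (eprodn a (-1) v) q M w = _ := eprodc_isE charK H1 q.
rewrite E (eprodn_normord charK _ _ ha hq (locord_le hS2 Haq)) [- (_ + _)]opprD addrACA subKr -sumrB.
(* The [theta] corrections of the two products differ by commutators with $a^e_s$, $s\ge0$, which
   are already known. *)
under [X in _ + X]eq_bigr => s _ do
  rewrite -scalerBr (comm_nonneg _ _ _ _ hg Hau) scaler_sumr.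
rewrite exchange_big -big_split /=; apply: eq_bigr => s _.
rewrite (@conv_lderivnK _ s S) ?subrK ?gbin_N1 // => t ht.
by apply: (eprodc_lt charK M w (hc s) hv (hl s (ltn_ord s))); have := ltn_ord s; rewrite /S in ht; lia.
Qed.

Lemma gbin_absorb p t : t.+1%:R * gbin K p t.+1 = p%:~R * gbin K (p - 1) t.
Proof.
have E : \prod_(j < t.+1) (p%:~R - (j : nat)%:R) =
    p%:~R * \prod_(j < t) ((p - 1)%:~R - (j : nat)%:R) :> K.
  rewrite big_ord_recl subr0; congr (_ * _); apply: eq_bigr => j _.
  by rewrite lift0 -natr1 rmorphB /= opprD addrA addrAC.
rewrite /gbin E factS natrM; move: (t.+1%:R : K) (natSK_neq0 charK t) => x hx.
by field; rewrite factK_neq0 // hx.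
Qed.

Lemma eprodn_euler0 a b : Defs.inE a -> Defs.inE b -> local a b -> eprodn (euler a) 0 b = 0.
Proof.
move=> ha hb hl; apply/funext => M; apply/funext => w.
by rewrite (eprodn_eulerl charK) // scale0r oppr0.
Qed.

Lemma eprodn_eulerS a b (s : nat) : Defs.inE a -> Defs.inE b -> local a b ->
  eprodn (euler a) s.+1 b = (- s.+1%:R) *: eprodn a s b.
Proof.
move=> ha hb hl; apply/funext => M; apply/funext => w.
rewrite (eprodn_eulerl charK) // -[RHS]/(- s.+1%:R *: eprodn a s b M w) scaleNr.
by congr (- (_ *: eprodn a _ b M w)); lia.
Qed.

Lemma good_euler a u v : good a u v -> good (euler a) u v.
Proof.
case=> ha hu hv hau hav huv hauv; have [lu _] := hu; have [lv _] := hv; split=> //.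
- exact: inE_euler.
- exact: localDl.
- exact: localDl.
- case=> [|s]; first by rewrite eprodn_euler0 //; exact: local_0l.
  by rewrite eprodn_eulerS // -[_ *: _]addr0; apply: local_linl => //; exact: local_0l.
Qed.

(** Induction on [p], applied to $x\,d/dx\,a$ in place of [a]: this multiplies the left side at
    index $-p-2$ by $p+1$, which is invertible in characteristic 0. *)
Lemma comm_neg a u v ka (p : nat) q M w : good a u v -> locord ka a u ->
  eprodn a (- Posz p.+1) (eprodc u v q) M w - eprodc u (eprodn a (- Posz p.+1) v) q M w =
  \sum_(s < ka) gbin K (- Posz p.+1) s *: eprodc (eprodn a s u) v (q + Posz p.+1 + Posz s) M w.
Proof.
elim: p a ka q => [|p IH] a ka q hg Hau; first exact: comm_N1.
have [ha hu hv hau hav huv hauv] := hg.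
have [la _] := ha; have [lu _] := hu; have [lv _] := hv.
have hq : Defs.inE (eprodc u v q) by exact: inE_eprodc.
have p0 : p.+1%:R != 0 :> K by exact: natSK_neq0.
have E b : Defs.inE b -> local a b -> eprodn (euler a) (- Posz p.+1) b = p.+1%:R *: eprodn a (-
    Posz p.+2) b.
  move=> hb hl; apply/funext => M'; apply/funext => w'.
  rewrite (eprodn_eulerl charK) // rmorphN scaleNr opprK.
  by rewrite -[RHS]/(p.+1%:R *: eprodn a _ b M' w'); congr (_ *: eprodn a _ b M' w'); lia.
have := IH _ _ q (good_euler hg) (locord_eulerl Hau lu).
rewrite !E //; last exact: local_eprodc.
have hn : Defs.inE (eprodn a (- Posz p.+2) v) by exact: inE_eprodn.
have hln : local u (eprodn a (- Posz p.+2) v) by exact: local_eprodn.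
rewrite -[p.+1%:R *: eprodn a _ v]addr0 (eprodc_linr charK) //; [|exact: inE0|exact: local0].
rewrite (eprodc_0r charK) // addr0.
rewrite -[X in X - _ = _]/(p.+1%:R *: eprodn a (- Posz p.+2) (eprodc u v q) M w).
rewrite -[X in _ - X = _]/(p.+1%:R *: eprodc u (eprodn a (- Posz p.+2) v) q M w).
rewrite -scalerBr big_ord_recl eprodn_euler0 // (eprodc_0l charK) scaler0 add0r => H.
(* The summand of index 0 has vanished; the others are shifted by one and matched by
   $(s+1)\binom{-p-1}{s+1}=-(p+1)\binom{-p-2}{s}$. *)
apply: (scalerI p0); rewrite H scaler_sumr; apply: eq_bigr => s _.
rewrite lift0 eprodn_eulerS // -[_ *: eprodn a s u]addr0 (eprodc_linl charK) //; last exact: local_0l.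
- rewrite (eprodc_0l charK) addr0.
  rewrite -[X in _ *: X = _]/(- s.+1%:R *: eprodc (eprodn a s u) v (q + Posz p.+1 + Posz s.+1) M w).
  rewrite !scalerA mulrN [_ * s.+1%:R]mulrC gbin_absorb rmorphN mulNr opprK.
  by congr (_ * gbin K _ _ *: eprodc _ _ _ _ _); lia.
- exact: inE_eprodn.
- exact: inE0.
Qed.

Lemma comm a u v ka n q M w : good a u v -> locord ka a u ->
  eprodn a n (eprodc u v q) M w - eprodc u (eprodn a n v) q M w =
  \sum_(s < ka) gbin K n s *: eprodc (eprodn a s u) v (q - n + Posz s) M w.
Proof.
case: n => n hg H; first exact: comm_nonneg.
by rewrite NegzE (comm_neg _ _ _ _ hg H) opprK.
Qed.

End Commutator.

(** * Submodules as modules, and induction over the induced module *)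

Section Submodule.
Variables (K : fieldType) (U : lmodType K) (P : U -> Prop).
Hypothesis P0 : P 0.
Hypothesis Plin : forall a u v, P u -> P v -> P (a *: u + v).

Definition subP : {pred U} := fun u => `[< P u >].

Lemma subP_closed : submod_closed subP.
Proof.
split; first exact/asboolP.
by move=> a u v /asboolP pu /asboolP pv; apply/asboolP; exact: Plin.
Qed.

HB.instance Definition _ := GRing.isSubmodClosed.Build K U subP subP_closed.

Definition subT := {u | u \in subP}.
HB.instance Definition _ := SubChoice.on subT.
HB.instance Definition _ := [SubChoice_isSubLmodule of subT by <:].

(** The universal property quantifies over module types, so a linear predicate must first be
    realised by a type with an injection. *)
Lemma submodule_type : exists (S : lmodType K) (val : S -> U),
  [/\ lin val, injective val, (forall s, P (val s)) & (forall u, P u -> exists s, val s = u)].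
Proof.
exists subT, (val : subT -> U); split.
- by move=> a u v; rewrite linearP.
- exact: val_inj.
- by move=> s; exact/asboolP/(valP s).
- by move=> u pu; have hu : u \in subP by [apply/asboolP]; exists (exist _ u hu).
Qed.

End Submodule.

(** [P] carves out a submodule containing [vac], so the universal property maps V into it. Followed
    by the inclusion, this map is an endomorphism fixing [vac], hence the identity. *)
Lemma VfrakL_ind (K : fieldType) (l1 l2 l3 : K) (V : lmodType K) (Lb Ib : int -> V -> V) (vac : V)
  (P : V -> Prop) : is_VfrakL l1 l2 l3 Lb Ib vac -> P vac ->
  (forall a u v, P u -> P v -> P (a *: u + v)) ->
  (forall n v, P v -> P (Lb n v)) -> (forall n v, P v -> P (Ib n v)) -> forall v, P v.
Proof.
move=> [[lL lI LL LI II] hann huniv] Pvac Plin PL PI.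
have P0 : P 0 by rewrite -(addNr vac) -scaleN1r; exact: Plin.
have [S [f [lf injf hf exf]]] := submodule_type P0 Plin.
have [oL hoL] : exists o : int -> S -> S, forall n s, f (o n s) = Lb n (f s).
  have h n s := cid (exf _ (PL n _ (hf s))).
  by exists (fun n s => projT1 (h n s)) => n s; exact: (projT2 (h n s)).
have [oI hoI] : exists o : int -> S -> S, forall n s, f (o n s) = Ib n (f s).
  have h n s := cid (exf _ (PI n _ (hf s))).
  by exists (fun n s => projT1 (h n s)) => n s; exact: (projT2 (h n s)).
have [s0 hs0] := exf _ Pvac.
have [||g [[lg gL gI] g0 _]] := huniv S oL oI s0.
- split.
  + by move=> n a u v; apply: injf; rewrite hoL !lf lL !hoL.
  + by move=> n a u v; apply: injf; rewrite hoI !lf lI !hoI.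
  + move=> m n v; apply: injf.
    by rewrite (linB lf) (linD lf) !(linZ lf) !hoL LL.
  + move=> m n v; apply: injf.
    by rewrite !(linB lf) (linN lf) !(linZ lf) !(hoL, hoI) LI.
  + by move=> m n v; apply: injf; rewrite (linB lf) (linZ lf) !hoI II.
- move=> n hn; have [h1 h2] := hann n hn.
  by split; apply: injf; rewrite ?hoL ?hoI hs0 ?h1 ?h2 (lin0 lf).
have [g' [_ _ hg']] := huniv V Lb Ib vac (And5 lL lI LL LI II) hann.
move=> v; rewrite (_ : v = f (g v)) //.
rewrite (hg' (fun v => f (g v))); first by apply: hg'.
  split; [by move=> a u w; rewrite lg lf|by move=> n u; rewrite gL hoL|by move=> n u; rewrite gI hoI].
by rewrite g0.
Qed.

(** * The fields of the twisted Heisenberg-Virasoro algebra *)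

Section TwistedHV.
Variable K : fieldType.
Hypothesis charK : [pchar K] =i pred0.
Variables l1 l2 l3 : K.
Variable W : lmodType K.
Variables L I : int -> W -> W.
Hypothesis HW : calL_module l1 l2 l3 L I.
Hypothesis Hres : restricted L I.

Let Lh := Lhat l1 L.
Let Ih := Ihat l2 I.
Let d := unit_ser K.

Lemma LhE k w : Lh k w = L (- k) w - (d k * (l1 / 24%:R)) *: w.
Proof. by rewrite /Lh /Lhat /d /unit_ser; case: eqP => _; rewrite ?mul1r // mul0r scale0r. Qed.

Lemma IhE k w : Ih k w = I (- k) w - (d k * l2) *: w.
Proof. by rewrite /Ih /Ihat /d /unit_ser; case: eqP => _; rewrite ?mul1r // mul0r scale0r. Qed.

Lemma idE k w : @idser K W k w = d k *: w.
Proof. by rewrite /idser /d /unit_ser; case: eqP => _; rewrite ?scale1r ?scale0r. Qed.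

Lemma d_delta k : delta K (- k) 0 = d k.
Proof. by rewrite /delta /d /unit_ser oppr_eq0; case: eqP. Qed.

(** Discards the scalar shift of a field under $x\,d/dx$, as it sits in degree 0. *)
Lemma mul_d (k : int) : k%:~R * d k = 0.
Proof. by rewrite /d /unit_ser; case: eqP => [->|_]; rewrite ?mulr0 // mul0r. Qed.

Lemma inE_shifted (A : int -> W -> W) (x : int -> K) (a : ser W) :
  (forall k w, a k w = A (- k) w - (d k * x k) *: w) -> (forall n, lin (A n)) ->
  (forall w, exists N : int, forall n, N <= n -> A n w = 0) -> Defs.inE a.
Proof.
move=> hE lA hA; split=> [k y w w'|w].
  rewrite !hE lA scalerBr [(_ * _) *: (_ + _)]scalerDr !scalerA [_ * y]mulrC opprD addrACA //.
have [N hN] := hA w; exists (Num.min 0 (1 - N)) => k; rewrite lt_min => /andP[h1 h2].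
rewrite hE hN; last by lia.
by rewrite /d /unit_ser; case: eqP => [|_]; [lia|rewrite mul0r scale0r subr0].
Qed.

Lemma inE_Lh : Defs.inE Lh.
Proof.
case: HW => lL _ _ _ _; apply: (inE_shifted LhE) => // w.
by have [N hN] := Hres w; exists N => n /hN [].
Qed.

Lemma inE_Ih : Defs.inE Ih.
Proof.
case: HW => _ lI _ _ _; apply: (inE_shifted IhE) => // w.
by have [N hN] := Hres w; exists N => n /hN [].
Qed.

Lemma comm_cancel (P Q s t r : W) : P - s - (t - r) - (Q - t - (s - r)) = P - Q.
Proof.
by rewrite subrACA [P - s - _]subrACA [t - r - _]subrACA subrr subr0 -(opprB s t) opprK subrK.
Qed.

Lemma bracket_shifted (a b : ser W) (A B : int -> W -> W) (x y : int -> K) M w j :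
  (forall k w, a k w = A (- k) w - x k *: w) -> (forall k w, b k w = B (- k) w - y k *: w) ->
  (forall n, lin (A n)) -> (forall n, lin (B n)) ->
  bracket a b M w j = A (- j) (B (- (M - j)) w) - B (- (M - j)) (A (- j) w).
Proof.
move=> ha hb lA lB; rewrite -[LHS]/(a j (b (M - j) w) - b (M - j) (a j w)).
rewrite !ha !hb (linB (lA _)) (linB (lB _)) (linZ (lA _)) (linZ (lB _)).
by rewrite !scalerBr !scalerA [y _ * _]mulrC comm_cancel.
Qed.

Lemma comb_sub (x c : K) (X w : W) : x *: (X - c *: w) = x *: X + (- (x * c)) *: w.
Proof. by rewrite scalerBr scalerA scaleNr. Qed.

Lemma combD (p q p' q' : K) (X w : W) :
  p *: X + q *: w + (p' *: X + q' *: w) = (p + p') *: X + (q + q') *: w.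
Proof. by rewrite !scalerDl addrACA. Qed.

Lemma comb0 (q : K) (X w : W) : q *: w = 0 *: X + q *: w.
Proof. by rewrite scale0r add0r. Qed.

(* The s-th entry of yLL is \hat L^e_s \hat L, and similarly below. *)
Definition yLL : seq (ser W) := [:: euler Lh; 2%:R *: Lh; 0; (l1 / 2%:R) *: @idser K W].
Definition yLI : seq (ser W) := [:: euler Ih; Ih; (- (2%:R * l2)) *: @idser K W].
Definition yIL : seq (ser W) := [:: 0; Ih; (2%:R * l2) *: @idser K W].
Definition yII : seq (ser W) := [:: 0; l3 *: @idser K W].

Lemma expz1 j : expz K j 1 = j%:~R.
Proof. by rewrite expz_nat expr1 divr1. Qed.

(** The shift by $\ell_1/24$ absorbs the linear part of $(m^3-m)/12$, since
    $2m\cdot\ell_1/24=m\ell_1/12$. The remaining $m^3\ell_1/12$ is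
    $\frac{\ell_1}{2}\cdot\frac{m^3}{3!}$, with $m=-j$. *)
Lemma bracket_LL M w j : bracket Lh Lh M w j = \sum_(s < 4) expz K (- j) s *: nth 0 yLL s M w.
Proof.
case: HW => lL lI hLL hLI hII; rewrite (bracket_shifted _ _ _ LhE LhE) // hLL.
rewrite !big_ord_recr big_ord0 /= add0r expz_0 scale1r expz1.
rewrite -[(2%:R *: Lh) M w]/(2%:R *: Lh M w) -[euler Lh M w]/(M%:~R *: Lh M w).
rewrite -[((l1 / 2%:R) *: @idser K W) M w]/((l1 / 2%:R) *: @idser K W M w) scaler0 addr0.
rewrite LhE idE !(scalerA, comb_sub) (comb0 (expz K (- j) 3 * _ * _) (L (- M) w) w) !combD.
have -> : - j - (M - j) = - M by lia.
rewrite d_delta expz_nat.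
have hM := mul_d M; congr (_ *: _ + _ *: _).
  rewrite addr0 !rmorphB !rmorphN /= !rmorphB; ring.
rewrite [M%:~R * _]mulrA hM mul0r oppr0 add0r rmorphB rmorphXn /= !rmorphN /=.
rewrite (_ : (3`!)%:R = 6%:R :> K) //.
field; by rewrite ?natK_eq0.
Qed.

(** The shift by $\ell_2$ absorbs the linear part of $m^2+m$; what remains is
    $-m^2\ell_2=-2\ell_2\cdot\frac{m^2}{2!}$, with $m=-j$. *)
Lemma bracket_LI M w j : bracket Lh Ih M w j = \sum_(s < 3) expz K (- j) s *: nth 0 yLI s M w.
Proof.
case: HW => lL lI hLL hLI hII; rewrite (bracket_shifted _ _ _ LhE IhE) // hLI.
rewrite !big_ord_recr big_ord0 /= add0r expz_0 scale1r expz1.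
rewrite -[euler Ih M w]/(M%:~R *: Ih M w).
rewrite -[(- (2%:R * l2) *: @idser K W) M w]/(- (2%:R * l2) *: @idser K W M w).
rewrite IhE idE !(scalerA, comb_sub) (comb0 (expz K (- j) 2 * _ * _) (I (- M) w) w) !combD.
have -> : - j - (M - j) = - M by lia.
rewrite d_delta expz_nat -!scaleNr.
have hM := mul_d M; congr (_ *: _ + _ *: _).
  by rewrite addr0 -rmorphN /= -rmorphD /=; congr (_%:~R); lia.
rewrite [M%:~R * _]mulrA hM mul0r oppr0 add0r rmorphD rmorphXn /= !rmorphN /=.
rewrite (_ : (2`!)%:R = 2%:R :> K) //.
by field; rewrite ?natK_eq0.
Qed.

Lemma bracket_IL M w j : bracket Ih Lh M w j = \sum_(s < 3) expz K (- j) s *: nth 0 yIL s M w.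
Proof.
case: HW => lL lI hLL hLI hII; rewrite (bracket_shifted _ _ _ IhE LhE) // -opprB hLI.
rewrite !big_ord_recr big_ord0 /= add0r scaler0 add0r expz1.
rewrite -[((2%:R * l2) *: @idser K W) M w]/((2%:R * l2) *: @idser K W M w).
rewrite IhE idE !(scalerA, comb_sub) (comb0 (expz K (- j) 2 * _ * _) (I (- M) w) w) !combD.
have -> : - (M - j) - j = - M by lia.
rewrite d_delta expz_nat -!scaleNr opprD -!scaleNr.
have hM := mul_d M; congr (_ *: _ + _ *: _).
  by rewrite addr0 opprK.
(* The factor [d M] restricts to $M=0$, where $-(M-j)=j$. *)
have E : d M * ((- (M - j)) ^+ 2 + - (M - j))%:~R = d M * (j ^+ 2 + j)%:~R.
  rewrite /d /unit_ser; case: eqP => [->|_]; last by rewrite !mul0r.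
  by rewrite sub0r opprK.
rewrite E rmorphD rmorphXn /= !rmorphN /= (_ : (2`!)%:R = 2%:R :> K) //.
by field; rewrite ?natK_eq0.
Qed.

Lemma bracket_II M w j : bracket Ih Ih M w j = \sum_(s < 2) expz K (- j) s *: nth 0 yII s M w.
Proof.
case: HW => lL lI hLL hLI hII; rewrite (bracket_shifted _ _ _ IhE IhE) // hII.
rewrite !big_ord_recr big_ord0 /= add0r scaler0 add0r expz1.
rewrite -[(l3 *: @idser K W) M w]/(l3 *: @idser K W M w) idE !scalerA.
have -> : - j - (M - j) = - M by lia.
by rewrite d_delta mulrAC.
Qed.

(** Locality to the two generating fields is all that is asked; members need not be local to each
    other. This already makes the set stable under the products with those fields. *)
Definition localHV (b : ser W) := [/\ Defs.inE b, local Lh b & local Ih b].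

Lemma localZl (x : K) (a b : ser W) : Defs.inE b -> local a b -> local (x *: a) b.
Proof. by case=> lb _ h; rewrite -[x *: a]addr0; apply: local_linl => //; exact: local_0l. Qed.

Lemma local_nthif ys (b : ser W) k (s : nat) : Defs.inE b ->
  (forall i, (i < k)%N -> local (nth 0 ys i) b) -> local (if (s < k)%N then nth 0 ys s else 0) b.
Proof. by move=> [lb _] h; case: ifP => [/h //|_]; exact: local_0l. Qed.

Lemma localHV_Lh : localHV Lh.
Proof.
have hL := inE_Lh; have hI := inE_Ih; split=> //.
  by have [H _] := ope_uniq charK hL hL bracket_LL; exists 4%N.
by have [H _] := ope_uniq charK hI hL bracket_IL; exists 3%N.
Qed.

Lemma localHV_Ih : localHV Ih.
Proof.
have hL := inE_Lh; have hI := inE_Ih; split=> //.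
  by have [H _] := ope_uniq charK hL hI bracket_LI; exists 3%N.
by have [H _] := ope_uniq charK hI hI bracket_II; exists 2%N.
Qed.

Lemma good_LL b : localHV b -> good Lh Lh b.
Proof.
move=> [hb bL bI]; have [hL LL IL] := localHV_Lh; split=> // s.
have [lb _] := hb; have [_ ->] := ope_uniq charK hL hL bracket_LL.
apply: local_nthif => // -[|[|[|[|]]]] //= _.
- exact: localDl.
- exact: localZl.
- exact: local_0l.
- by apply: localZl => //; exact: local_idl.
Qed.

Lemma good_LI b : localHV b -> good Lh Ih b.
Proof.
move=> [hb bL bI]; have [hL LL IL] := localHV_Lh; have [hI LI II] := localHV_Ih; split=> // s.
have [lb _] := hb; have [_ ->] := ope_uniq charK hL hI bracket_LI.
apply: local_nthif => // -[|[|[|]]] //= _.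
- exact: localDl.
- by apply: localZl => //; exact: local_idl.
Qed.

Lemma good_IL b : localHV b -> good Ih Lh b.
Proof.
move=> [hb bL bI]; have [hL LL IL] := localHV_Lh; have [hI LI II] := localHV_Ih; split=> // s.
have [lb _] := hb; have [_ ->] := ope_uniq charK hI hL bracket_IL.
apply: local_nthif => // -[|[|[|]]] //= _.
- exact: local_0l.
- by apply: localZl => //; exact: local_idl.
Qed.

Lemma good_II b : localHV b -> good Ih Ih b.
Proof.
move=> [hb bL bI]; have [hI LI II] := localHV_Ih; split=> // s.
have [lb _] := hb; have [_ ->] := ope_uniq charK hI hI bracket_II.
apply: local_nthif => // -[|[|]] //= _.
- exact: local_0l.
- by apply: localZl => //; exact: local_idl.
Qed.

Lemma localHV_eprodnL n b : localHV b -> localHV (eprodn Lh n b).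
Proof.
move=> hb; have [hE bL bI] := hb; split; first exact: (inE_eprodn charK n inE_Lh).
  exact: (local_eprodn charK n (good_LL hb)).
exact: (local_eprodn charK n (good_LI hb)).
Qed.

Lemma localHV_eprodnI n b : localHV b -> localHV (eprodn Ih n b).
Proof.
move=> hb; have [hE bL bI] := hb; split; first exact: (inE_eprodn charK n inE_Ih).
  exact: (local_eprodn charK n (good_IL hb)).
exact: (local_eprodn charK n (good_II hb)).
Qed.

Lemma gbin1 m : gbin K m 1 = m%:~R.
Proof. by rewrite gbinS // gbin0 mul1r subr0 divr1. Qed.

Lemma gbin2 m : gbin K m 2 = (m ^+ 2 - m)%:~R / 2%:R.
Proof. by rewrite gbinS // gbin1 -rmorphM mulrBr mulr1 -expr2. Qed.

Lemma gbin3 m : gbin K m 3 = (m * (m - 1) * (m - 2))%:~R / 6%:R.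
Proof.
rewrite gbinS // gbin2 (_ : m * (m - 1) * (m - 2) = (m ^+ 2 - m) * (m - 2)); last by ring.
by rewrite rmorphM /=; field; rewrite ?natK_eq0.
Qed.

Lemma eprodn_idl n (b : ser W) M w : Defs.inE b -> eprodn (@idser K W) n b M w = delta K (n + 1) 0
    *: b M w.
Proof.
move=> [lb _]; rewrite /eprodn (eprodc_idl charK) // -[LHS]/(unit_ser K _ *: b M w).
by congr (_ *: _); rewrite /unit_ser /delta; case: eqP; case: eqP => //; lia.
Qed.

Lemma eprodn_Zl x (a b : ser W) n : Defs.inE a -> Defs.inE b -> local a b -> eprodn (x *: a) n b =
    x *: eprodn a n b.
Proof.
move=> ha hb hl; have [lb _] := hb; rewrite /eprodn -[x *: a]addr0 (eprodc_linl charK) //.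
- by rewrite (eprodc_0l charK) addr0.
- exact: inE0.
- exact: local_0l.
Qed.

Lemma eprodn_0l n (b : ser W) M w : eprodn 0 n b M w = 0.
Proof. by rewrite /eprodn (eprodc_0l charK). Qed.

Lemma comm_eprodn (a u v : ser W) ka n m M w : good a u v -> locord ka a u ->
  eprodn a n (eprodn u m v) M w - eprodn u m (eprodn a n v) M w =
  \sum_(s < ka) gbin K n s *: eprodn (eprodn a s u) (n + m - Posz s) v M w.
Proof.
move=> hg H; rewrite /eprodn (comm charK n (- m - 1) M w hg H); apply: eq_bigr => s _.
by rewrite /eprodn; congr (_ *: eprodc _ _ _ _ _); lia.
Qed.

(** In the commutator formula, $x\,d/dx\,\widehat L$ contributes $-(m+n)$ and $2\widehat L$
    contributes $2m$, giving $m-n$; the central term is $\binom m3\ell_1/2$. *)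
Lemma rel_LL m n b M w : localHV b ->
  eprodn Lh m (eprodn Lh n b) M w - eprodn Lh n (eprodn Lh m b) M w = (m - n)%:~R *: eprodn Lh (m +
      n - 1) b M w
  + ((m * (m - 1) * (m - 2))%:~R / 12%:R * delta K (m + n - 2) 0 * l1) *: b M w.
Proof.
move=> hb; have [hE bL bI] := hb; have hL := inE_Lh; have [lb _] := hE.
have [H He] := ope_uniq charK hL hL bracket_LL.
rewrite (comm_eprodn m n M w (good_LL hb) H) !big_ord_recr big_ord0 /= add0r !He /=.
rewrite gbin0 scale1r gbin1 gbin3 eprodn_0l scaler0 addr0.
rewrite eprodn_Zl // eprodn_Zl //; [|exact: inE_id|exact: local_idl].
rewrite -[(2%:R *: _) M w]/(2%:R *: eprodn Lh (m + n - 1) b M w).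
rewrite -[((l1 / 2%:R) *: _) M w]/((l1 / 2%:R) *: eprodn (@idser K W) (m + n - 3) b M w).
rewrite subr0 (eprodn_eulerl charK) // eprodn_idl // !scalerA -scaleNr -scalerDl.
have -> : m + n - 3 + 1 = m + n - 2 by lia.
congr (_ *: _ + _ *: _).
  rewrite !(rmorphB, rmorphD) /=; ring.
by field; rewrite ?natK_eq0.
Qed.

Lemma rel_LI m n b M w : localHV b ->
  eprodn Lh m (eprodn Ih n b) M w - eprodn Ih n (eprodn Lh m b) M w = - (n%:~R *: eprodn Ih (m + n
      - 1) b M w)
  - ((m ^+ 2 - m)%:~R * delta K (m + n - 1) 0 * l2) *: b M w.
Proof.
move=> hb; have [hE bL bI] := hb; have hL := inE_Lh; have hI := inE_Ih; have [lb _] := hE.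
have [H He] := ope_uniq charK hL hI bracket_LI.
rewrite (comm_eprodn m n M w (good_LI hb) H) !big_ord_recr big_ord0 /= add0r !He /=.
rewrite gbin0 scale1r gbin1 gbin2.
rewrite eprodn_Zl //; [|exact: inE_id|exact: local_idl].
rewrite -[(- (2%:R * l2) *: _) M w]/(- (2%:R * l2) *: eprodn (@idser K W) (m + n - 2) b M w).
rewrite subr0 (eprodn_eulerl charK) // eprodn_idl // !scalerA -!scaleNr -scalerDl.
have -> : m + n - 2 + 1 = m + n - 1 by lia.
congr (_ *: _ + _ *: _).
  rewrite !rmorphD /=; ring.
by field; rewrite ?natK_eq0.
Qed.

Lemma rel_II m n b M w : localHV b ->
  eprodn Ih m (eprodn Ih n b) M w - eprodn Ih n (eprodn Ih m b) M w = (m%:~R * delta K (m + n) 0 *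
      l3) *: b M w.
Proof.
move=> hb; have [hE bL bI] := hb; have hI := inE_Ih; have [lb _] := hE.
have [H He] := ope_uniq charK hI hI bracket_II.
rewrite (comm_eprodn m n M w (good_II hb) H) !big_ord_recr big_ord0 /= add0r !He /=.
rewrite gbin1 eprodn_0l scaler0 add0r.
rewrite eprodn_Zl //; [|exact: inE_id|exact: local_idl].
rewrite -[(l3 *: _) M w]/(l3 *: eprodn (@idser K W) (m + n - 1) b M w) eprodn_idl // !scalerA subrK.
by rewrite mulrAC.
Qed.

End TwistedHV.

(** * Agreement with the coefficientwise definitions *)

Lemma eq_isum (T : zmodType) lo hi (f g : int -> T) :
  (forall p, lo <= p -> p <= hi -> f p = g p) -> isum lo hi f = isum lo hi g.
Proof.
by move=> h; rewrite /isum; case: ifP => // hl; apply: eq_bigr => t _; apply: h;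
  have := ltn_ord t; lia.
Qed.

Section Links.
Variable K : fieldType.
Hypothesis charK : [pchar K] =i pred0.
Variable W : lmodType K.
Implicit Types (a b : ser W) (w : W).

(** The total degree drops by [k] because $(x_1-x_2)^k=x_2^k(t-1)^k$. *)
Lemma prod2E k a b i j w : prod2 k a b i j w = iter k (@bdiff K W) (prodser a b (i + j - Posz k) w) i.
Proof.
rewrite iter_bdiff_binom; apply: eq_bigr => t _; rewrite /prodser; congr (_ *: a _ (b _ w)); lia.
Qed.

Lemma substC_expsum k a b w N m (p : nat) : trunc2 (prod2 k a b) w N ->
  substC (prod2 k a b) N m p w = expsum (iter k (@bdiff K W) (prodser a b (m - Posz k) w)) p.
Proof.
move=> ht; have E i : prod2 k a b i (m - i) w = iter k (@bdiff K W) (prodser a b (m - Posz k) w) i.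
  by rewrite prod2E (_ : i + (m - i) - Posz k = m - Posz k) //; lia.
have h0 i : i < N \/ m - N < i -> prod2 k a b i (m - i) w = 0.
  by move=> h; apply: ht; lia.
rewrite /substC fsum_isum; last first.
- by move=> i hi; rewrite h0 ?scaler0 //; right.
- by move=> i hi; rewrite h0 ?scaler0 //; left.
rewrite (fsum_lin (lin_scale _)); last first.
  apply: (@finsupp_itv _ _ N (m - N)) => i hi; rewrite h0 ?scaler0 //; [by left|by right].
by apply: eq_fsum => i; rewrite E scalerA mulrC expz_nat.
Qed.

Lemma trunc2_finsupp k a b w N M : trunc2 (prod2 k a b) w N ->
  finsupp (iter k (@bdiff K W) (prodser a b M w)).
Proof.
move=> ht; have E i : iter k (@bdiff K W) (prodser a b M w) i = prod2 k a b i (M + Posz k - i) w.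
  by rewrite prod2E (_ : i + (M + Posz k - i) - Posz k = M) //; lia.
by apply: (@finsupp_itv _ _ N (M + Posz k - N)) => i hi; rewrite E; apply: ht; lia.
Qed.

Lemma locord_trunc2 k a b : Defs.inE a -> Defs.inE b -> locord k a b ->
  forall w, exists N, trunc2 (prod2 k a b) w N.
Proof.
move=> ha hb H w; have [N hN] := prodser_trunc ha hb H w; exists N => i j hij.
by rewrite prod2E; apply: hN; lia.
Qed.

Lemma ecE k (s : nat) :
  ec K k s = \sum_(t < k.+1) ((-1) ^+ (k - t) * ('C(k, t))%:R) * expz K t s.
Proof.
rewrite /ec mulr_sumr; apply: eq_bigr => t _; rewrite expz_nat mulrC -!mulrA //.
Qed.

(* [expm1] is the difference operator for the family of translates [e^{-iz} A]. *)
Lemma iter_expm1_binom k (A : int -> W) : bdd A -> iter k (@expm1 K W) A =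
  \sum_(t < k.+1) ((-1) ^+ (k - t) * ('C(k, t))%:R) *: conv (expz K t) A.
Proof.
move=> hA; pose G (i : int) : int -> W := conv (expz K (- i)) A.
have E n i : iter n (@bdiff K (int -> W)) G i = conv (expz K (- i)) (iter n (@expm1 K W) A).
  elim: n i => // n IH i; rewrite /= /bdiff !IH.
  have hB : bdd (iter n (@expm1 K W) A) by exact: bdd_iter_expm1.
  have h1 := bddK_expz K 1; have h2 := bddK_expz K (- i).
  rewrite [in RHS]/expm1 convBr //; last exact: bdd_conv.
  by rewrite (convA h2 h1 hB) expzD //; congr (conv (expz K _) _ - _); lia.
have := E k 0; rewrite oppr0 (_ : expz K 0 = unit_ser K); last by apply/funext => p; exact: expz0.
rewrite conv1 => <-; rewrite iter_bdiff_binom; apply: eq_bigr => t _.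
by rewrite /G sub0r opprK.
Qed.

(** Translates the left side of the identity in [is_phi_module] into iterated [expm1]; any lower
    bound [Q0] of the series gives the same value. *)
Lemma iter_expm1_ec k (A : int -> W) Q0 p : (forall q, q < Q0 -> A q = 0) ->
  iter k (@expm1 K W) A p = isum Q0 p (fun q => ec K k (absz (p - q)) *: A q).
Proof.
move=> hA; have bA : bdd A by exists Q0.
pose x (t : 'I_k.+1) : K := (-1) ^+ (k - t) * ('C(k, t))%:R.
have -> : isum Q0 p (fun q => ec K k (absz (p - q)) *: A q) =
    isum Q0 p (fun q => \sum_(t < k.+1) x t *: (expz K t (p - q) *: A q)).
  rewrite /isum; case: ifP => // h; apply: eq_bigr => r _.
  have hr := ltn_ord r; rewrite ecE scaler_suml; apply: eq_bigr => t _.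
  by rewrite scalerA; congr (_ * expz K _ _ *: _); lia.
rewrite fsum_isum.
- rewrite iter_expm1_binom // fct_sumE fsum_sum.
    apply: eq_bigr => t _; rewrite -[LHS]/(x t *: conv (expz K t) A p) /conv.
    by rewrite (fsum_lin (lin_scale _)) //; apply: conv_finsupp => //; exact: bddK_expz.
  by move=> t; apply: finsupp_scale; apply: conv_finsupp => //; exact: bddK_expz.
- by move=> q hq; rewrite big1 // => t _; rewrite hA // !scaler0.
- by move=> q hq; rewrite big1 // => t _; rewrite expz_neg ?scale0r ?scaler0 //; lia.
Qed.

Lemma einv_lt k q : q < - Posz k -> einv K k q = 0.
Proof. by rewrite /einv; case: ifP => //; lia. Qed.

Lemma bddK_einv k : bddK (einv K k).
Proof. by exists (- Posz k) => q; exact: einv_lt. Qed.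

Lemma einvS k : einv K k.+1 = cmul (omega K) (einv K k).
Proof.
apply/funext => q; rewrite /cmul /conv /einv; case: ifP => hq; last first.
  rewrite fsum0 // => s; case: ifP => hs; last by rewrite scaler0.
  by rewrite omega_lt ?scale0r //; lia.
pose j := absz (q + Posz k.+1); have hj : q = Posz j - Posz k.+1 by rewrite /j; lia.
rewrite (@fsum_range _ _ (- Posz k) j.+1).
- rewrite -/j /= (reindex_inj rev_ord_inj) /=; apply: eq_bigr => t _.
  have ht := ltn_ord t; case: ifP => [_|]; last lia.
  rewrite omegaE; case: ifP => [_|]; last lia.
  by rewrite -[RHS]/(_ * _); congr (hcoef K _ * hpow K k _); lia.
- by move=> s hs; case: ifP => //; [lia|rewrite scaler0].
- by move=> s hs; rewrite omega_lt ?scale0r //; lia.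
Qed.

Lemma iter_omega_einv k (B : int -> W) : bdd B -> iter k (conv (omega K)) B = conv (einv K k) B.
Proof.
move=> hB; elim: k => [|k IH].
  rewrite (_ : einv K 0 = unit_ser K) ?conv1 //; apply/funext => q.
  rewrite /einv /unit_ser addr0; case: ifP => [h|h].
    by case: q h => //= n _; rewrite -[(Posz n == 0)]/(n == 0%N); case: eqP.
  by case: eqP => // eprodn; rewrite eprodn in h.
by rewrite einvS /= IH convA //; [exact: bddK_omega|exact: bddK_einv].
Qed.

Lemma eprod_eprodn a b n : Defs.inE a -> Defs.inE b -> local a b -> eprod a b n (eprodn a n b).
Proof.
move=> ha hb hl; have [k H] := hl; exists k => w; have [N hN] := locord_trunc2 ha hb H w.
exists N; split=> // m; have := isE_at charK (finsupp_prodser m w ha hb H) (eprodcP charK m w ha hb hl).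
case=> hA _ E; have := iter_omega_expm1 k hA; rewrite E iter_omega_einv; last exact: bdd_expsum.
move=> /(congr1 (fun f => f (- n - 1))) E1.
(* The limits of [isum] come from [expsum] vanishing at negative exponents and [einv K k] below
   $-k$. *)
rewrite -[LHS]E1 /conv -(@fsum_isum _ _ 0 (Posz k - n - 1)).
- apply: eq_isum => p h1 h2; rewrite substC_expsum // addrK; congr (_ *: expsum _ _); lia.
- by move=> p hp; rewrite /expsum fsum0 ?scaler0 // => i; rewrite expz_neg // scale0r.
- by move=> p hp; rewrite einv_lt ?scale0r //; lia.
Qed.

End Links.

(** * Consequences of the Borcherds identity in V *)

Section VertexAlgebra.
Variable K : fieldType.
Hypothesis charK : [pchar K] =i pred0.
Variables (V : lmodType K) (vac : V) (Y : V -> ser V).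
Hypothesis HY : is_VA vac Y.

Lemma gbin_00 (i : nat) : gbin K 0 i = (i == 0%N)%:R.
Proof. by rewrite (gbin_nat charK 0 i) bin0n. Qed.

Lemma sum_gbin0 M (F : nat -> V) : (0 < M)%N -> \sum_(i < M) gbin K 0 i *: F i = F 0%N.
Proof.
case: M => // M _; rewrite big_ord_recl gbin_00 scale1r big1 ?addr0 // => i _.
by rewrite gbin_00 scale0r.
Qed.

Lemma md_lin u n : lin (md Y u n).
Proof. by case: HY => -[h _ _ _ _] _; exact: h. Qed.

Lemma md_vac u (n : nat) : md Y u n vac = 0.
Proof. by case: HY => -[_ _ _ _ h] _; apply: h; lia. Qed.

Lemma md_N1 u : md Y u (-1) vac = u.
Proof. by case: HY => _ [h _]; rewrite /md opprK subrr. Qed.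

(** The case $r=0$, where $\binom0i$ leaves only the first term of the right side. *)
Lemma VA_comm a u v n m : exists M0 : nat, forall M : nat, (M0 <= M)%N ->
  md Y a n (md Y u m v) - md Y u m (md Y a n v) =
  \sum_(i < M) gbin K n i *: md Y (md Y a i u) (n + m - Posz i) v.
Proof.
case: (HY) => _ [_ /(_ a u v n m 0)] [M0 h]; exists M0.+1 => M hM.
have := h M (ltnW hM).
under [X in X = _ -> _]eq_bigr => i _ do rewrite add0r.
move=> ->; rewrite expr0.
pose F i := (-1) ^+ i *: (md Y a (n + 0 - Posz i) (md Y u (m + Posz i) v) -
      1 *: md Y u (m + 0 - Posz i) (md Y a (n + Posz i) v)).
transitivity (F 0%N).
  rewrite /F expr0 !scale1r; congr (md Y a _ (md Y u _ v) - md Y u _ (md Y a _ v)); lia.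
rewrite -(@sum_gbin0 M) //; last exact: leq_trans hM.
by apply: eq_bigr => i _; rewrite /F scalerA mulrC.
Qed.

(** The case $p=0$ on the vacuum: the second family of terms contains $a_i\mathbf 1$ with $i\ge0$
    and vanishes. *)
Lemma VA_iter_vac a u r q : exists M0 : nat, forall M : nat, (M0 <= M)%N ->
  md Y (md Y a r u) q vac =
  \sum_(i < M) ((-1) ^+ i * gbin K r i) *: md Y a (r - Posz i) (md Y u (q + Posz i) vac).
Proof.
case: (HY) => _ [_ /(_ a u vac 0 q r)] [M0 h]; exists M0.+1 => M hM.
have := h M (ltnW hM).
rewrite (@sum_gbin0 M (fun i => md Y (md Y a (r + Posz i) u) (0 + q - Posz i) vac)); last exact:
    leq_trans hM.
rewrite addr0 add0r subr0 => ->; apply: eq_bigr => i _.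
by rewrite !add0r md_vac (lin0 (md_lin _ _)) scaler0 subr0.
Qed.

(* the translation operator of V *)
Definition trans u := md Y u (-2) vac.

(** In [VA_iter_vac] with $q=-2$ only $i=0,1$ survive, because $u_{i-2}\mathbf 1=0$ for $i\ge2$. *)
Lemma trans_md a u n : trans (md Y a n u) = md Y a n (trans u) - n%:~R *: md Y a (n - 1) u.
Proof.
have [M0 h] := VA_iter_vac a u n (-2); rewrite /trans (h (M0 + 2)%N) ?leq_addr // addn2.
rewrite !big_ord_recl big1 ?addr0 => [|i _].
  rewrite lift0 /= gbin0 gbin1 // expr0 mul1r scale1r expr1 mulN1r scaleNr.
  have -> : md Y a (n - 1) u = md Y a (n - 1) (md Y u (-1) vac) by rewrite md_N1.
  by congr (md Y a _ (md Y u _ vac) - _ *: md Y a _ (md Y u _ vac)); lia.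
rewrite (_ : -2 + Posz (lift ord0 (lift ord0 i)) = i); last by rewrite !lift0; lia.
by rewrite md_vac (lin0 (md_lin _ _)) scaler0.
Qed.

Lemma gbin_N2 p : gbin K (-2) p = (-1) ^+ p * p.+1%:R.
Proof.
elim: p => [|p IH]; first by rewrite gbin0 mulr1.
rewrite gbinS // IH (_ : -2 - Posz p = - Posz p.+2); last by lia.
rewrite rmorphN /= -[p.+2%:~R]/(p.+2%:R) exprS.
by move: (p.+1%:R : K) (natSK_neq0 charK p) => x hx; field; rewrite hx.
Qed.

(** Only $i=p$ contributes, as $\mathbf 1_n\mathbf 1=0$ unless $n=-1$. The recursion identifies
    $u_{-p-1}\mathbf 1$ with a divided power of translation. *)
Lemma md_trans_vac u (p : nat) : md Y (trans u) (- Posz p - 1) vac = p.+1%:R *: md Y u (- Posz p -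
    2) vac.
Proof.
have [M0 h] := VA_iter_vac u vac (-2) (- Posz p - 1).
rewrite /trans (h (M0 + p.+1)%N) ?leq_addr //.
have hv n : md Y vac n vac = if n == -1 then vac else 0.
  case: HY => -[_ _ _ hvac _] _; rewrite /md hvac /idser.
  by case: eqP; case: eqP => //; lia.
have hp : (p < M0 + p.+1)%N by lia.
rewrite (bigD1 (Ordinal hp)) //= big1 ?addr0 => [|i hi].
  rewrite hv (_ : - Posz p - 1 + Posz p = -1); last by lia.
  rewrite eqxx gbin_N2 mulrA -exprMn mulrNN mulr1 expr1n mul1r.
  by congr (_ *: md Y u _ vac); lia.
rewrite hv; case: eqP => [E|_]; last by rewrite (lin0 (md_lin _ _)) scaler0.
by case/eqP: hi; apply: val_inj => /=; lia.
Qed.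

End VertexAlgebra.

(** * Construction, compatibility and uniqueness of the module map *)

Section Existence.
Variable K : fieldType.
Hypothesis charK : [pchar K] =i pred0.
Variables l1 l2 l3 : K.
Variables (V : lmodType K) (Lb Ib : int -> V -> V) (vac : V) (Y : V -> ser V).
Hypothesis HV : is_VfrakL l1 l2 l3 Lb Ib vac.
Hypothesis HY : is_VA vac Y.
Hypothesis HYL : forall k w, Y (Lb (-1) vac) k w = Lb (- k - 1) w.
Hypothesis HYI : forall k w, Y (Ib (-1) vac) k w = Ib (- k - 1) w.
Variables (W : lmodType K) (L I : int -> W -> W).
Hypothesis HW : calL_module l1 l2 l3 L I.
Hypothesis Hres : restricted L I.

Let Lh := Lhat l1 L.
Let Ih := Ihat l2 I.

(** Mentions the generators only; the formula for all modes of V is deduced from it by induction. *)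
Record fieldmap (YW : V -> ser W) : Prop := Fieldmap {
  fm_inM : forall v, localHV l1 l2 L I (YW v);
  fm_lin : forall a u v, YW (a *: u + v) = a *: YW u + YW v;
  fm_vac : YW vac = @idser K W;
  fm_L : forall n v, YW (Lb n v) = eprodn Lh n (YW v);
  fm_I : forall n v, YW (Ib n v) = eprodn Ih n (YW v) }.

Lemma eprodn_id_nonneg (a : ser W) n : Defs.inE a -> 0 <= n -> eprodn a n (@idser K W) = 0.
Proof.
move=> [la _] hn; apply/funext => M; apply/funext => w.
by rewrite /eprodn (eprodc_idr charK) // expz_neg ?scale0r //; lia.
Qed.

Lemma eprodn_linr (a : ser W) n x b c : Defs.inE a -> Defs.inE b -> Defs.inE c -> local a b ->
    local a c ->
  eprodn a n (x *: b + c) = x *: eprodn a n b + eprodn a n c.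
Proof. exact: (eprodc_linr charK). Qed.

Lemma fieldmap_exists : exists YW, fieldmap YW.
Proof.
have hL := inE_Lh HW Hres; have hI := inE_Ih HW Hres.
have M0 : localHV l1 l2 L I 0.
  by split; [exact: inE0|apply: local0; case: hL|apply: local0; case: hI].
have Mlin a (b c : ser W) : localHV l1 l2 L I b -> localHV l1 l2 L I c -> localHV l1 l2 L I (a *: b
    + c).
  move=> [h1 h2 h3] [h4 h5 h6]; split; first exact: inE_lin.
    by apply: local_linr => //; case: hL.
  by apply: local_linr => //; case: hI.
have [S [f [lf injf hf exf]]] := submodule_type M0 Mlin.
have [oL hoL] : exists o : int -> S -> S, forall n s, f (o n s) = eprodn Lh n (f s).
  have h n s := cid (exf _ (localHV_eprodnL charK HW Hres n (hf s))).
  by exists (fun n s => projT1 (h n s)) => n s; exact: (projT2 (h n s)).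
have [oI hoI] : exists o : int -> S -> S, forall n s, f (o n s) = eprodn Ih n (f s).
  have h n s := cid (exf _ (localHV_eprodnI charK HW Hres n (hf s))).
  by exists (fun n s => projT1 (h n s)) => n s; exact: (projT2 (h n s)).
have Mid : localHV l1 l2 L I (@idser K W).
  by split; [exact: inE_id|apply: local_id; case: hL|apply: local_id; case: hI].
have [s0 hs0] := exf _ Mid.
case: HV => _ _ /(_ S oL oI s0) [||g [[lg gL gI] g0 _]].
- split.
  + move=> n a u v; apply: injf; rewrite hoL !lf !hoL.
    by have [h1 h2 h3] := hf u; have [h4 h5 h6] := hf v; exact: eprodn_linr.
  + move=> n a u v; apply: injf; rewrite hoI !lf !hoI.
    by have [h1 h2 h3] := hf u; have [h4 h5 h6] := hf v; exact: eprodn_linr.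
  + move=> m n v; apply: injf; rewrite (linB lf) (linD lf) !(linZ lf) !hoL.
    by apply/funext => M; apply/funext => w; exact: (rel_LL charK HW Hres).
  + move=> m n v; apply: injf; rewrite !(linB lf) (linN lf) !(linZ lf) !(hoL, hoI).
    by apply/funext => M; apply/funext => w; exact: (rel_LI charK HW Hres).
  + move=> m n v; apply: injf; rewrite (linB lf) (linZ lf) !hoI.
    by apply/funext => M; apply/funext => w; exact: (rel_II charK HW Hres).
- move=> n hn; split; apply: injf; rewrite ?hoL ?hoI hs0 (lin0 lf); exact: eprodn_id_nonneg.
exists (fun v => f (g v)); split.
- by move=> v; exact: hf.
- by move=> a u v; rewrite lg lf.
- by rewrite g0.
- by move=> n v; rewrite gL hoL.
- by move=> n v; rewrite gI hoI.
Qed.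

Lemma mdL n v : md Y (Lb (-1) vac) n v = Lb n v.
Proof. by rewrite /md HYL; congr Lb; lia. Qed.

Lemma mdI n v : md Y (Ib (-1) vac) n v = Ib n v.
Proof. by rewrite /md HYI; congr Ib; lia. Qed.

Variable YW : V -> ser W.
Hypothesis HYW : fieldmap YW.

Lemma YW_D u v : YW (u + v) = YW u + YW v.
Proof. by have := fm_lin HYW 1 u v; rewrite !scale1r. Qed.
Lemma YW_0 : YW 0 = 0.
Proof. by apply: (addrI (YW 0)); rewrite -YW_D !addr0. Qed.
Lemma YW_Z a u : YW (a *: u) = a *: YW u.
Proof. by have := fm_lin HYW a u 0; rewrite YW_0 !addr0. Qed.
Lemma YW_B u v : YW (u - v) = YW u - YW v.
Proof. by rewrite YW_D -scaleN1r YW_Z scaleN1r. Qed.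
Lemma YW_sum n (F : 'I_n -> V) : YW (\sum_(i < n) F i) = \sum_(i < n) YW (F i).
Proof. exact: (big_morph YW YW_D YW_0). Qed.

Lemma YW_Lb1 : YW (Lb (-1) vac) = Lh.
Proof.
rewrite (fm_L HYW) (fm_vac HYW); apply/funext => M; apply/funext => w.
by have [lL _] := inE_Lh HW Hres; rewrite /eprodn (eprodc_idr charK) // opprK subrr expz_0 scale1r.
Qed.

Lemma YW_Ib1 : YW (Ib (-1) vac) = Ih.
Proof.
rewrite (fm_I HYW) (fm_vac HYW); apply/funext => M; apply/funext => w.
by have [lI _] := inE_Ih HW Hres; rewrite /eprodn (eprodc_idr charK) // opprK subrr expz_0 scale1r.
Qed.

Lemma trans_lin a u v : trans vac Y (a *: u + v) = a *: trans vac Y u + trans vac Y v.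
Proof. by case: HY => -[_ h _ _ _] _; exact: h. Qed.

Lemma euler_lin a (b c : ser W) : euler (a *: b + c) = a *: euler b + euler c.
Proof.
apply/funext => M; apply/funext => w.
rewrite -[LHS]/(M%:~R *: (a *: b M w + c M w)) -[RHS]/(a *: (M%:~R *: b M w) + M%:~R *: c M w).
by rewrite scalerDr !scalerA mulrC.
Qed.

(** Translation in V and $x\,d/dx$ on fields obey the same commutation rule with the modes of the
    generators, and both kill the vacuum. *)
Lemma YW_trans u : YW (trans vac Y u) = euler (YW u).
Proof.
have hL := inE_Lh HW Hres; have hI := inE_Ih HW Hres.
apply: (VfrakL_ind HV (P := fun u => YW (trans vac Y u) = euler (YW u))).
- rewrite (_ : trans vac Y vac = 0); last by case: HY => -[_ _ _ h _] _; rewrite /trans /md h.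
  rewrite YW_0 (fm_vac HYW); apply/funext => M; apply/funext => w.
  by rewrite /euler /idser; case: eqP => [->|_]; rewrite ?scale0r ?scaler0.
- by move=> a x y hx hy; rewrite trans_lin !(fm_lin HYW) hx hy euler_lin.
- move=> n v hv; have [h1 h2 h3] := fm_inM HYW v.
  rewrite -mdL (trans_md charK HY) YW_B YW_Z !mdL !(fm_L HYW) hv (eprodn_eulerr charK) //.
- move=> n v hv; have [h1 h2 h3] := fm_inM HYW v.
  by rewrite -mdI (trans_md charK HY) YW_B YW_Z !mdI !(fm_I HYW) hv (eprodn_eulerr charK).
Qed.

(** Both sides are p-th divided powers, of translation on V and of $x\,d/dx$ on W, which [YW_trans]
    matches. *)
Lemma YW_vac_mode u q : YW (Y u q vac) = eprodc (YW u) (YW vac) q.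
Proof.
rewrite (fm_vac HYW); apply/funext => M; apply/funext => w.
have [lu _] : Defs.inE (YW u) by case: (fm_inM HYW u).
rewrite (eprodc_idr charK) //; case: q => [p|p]; last first.
  by rewrite expz_neg // scale0r; case: HY => -[_ _ _ _ h] _; rewrite h // YW_0.
elim: p u {lu} => [|p IH] u; first by rewrite expz_0 scale1r; case: HY => _ [-> _].
have E := md_trans_vac charK HY u p; rewrite /md in E.
rewrite (_ : - (- Posz p - 1) - 1 = p) in E; last by lia.
rewrite (_ : - (- Posz p - 2) - 1 = p.+1) in E; last by lia.
have -> : Y u p.+1 vac = p.+1%:R^-1 *: Y (trans vac Y u) p vac.
  by rewrite E scalerA mulVf ?scale1r // natSK_neq0.
rewrite YW_Z -[LHS]/(_ *: YW _ M w) IH YW_trans /euler !scalerA expzS //.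
by rewrite mulrAC.
Qed.

(** All [u] are included at once because the induction step on [v] replaces [u] by its images under
    modes of a generator. *)
Definition compat v := forall u, local (YW u) (YW v) /\ forall q, YW (Y u q v) = eprodc (YW u) (YW v) q.

(** The commutator of the generator with a mode of [u] is given by the same binomial sum in V and
    among fields, and the induction hypothesis equates the summands. *)
Lemma compat_step om_ (a : ser W) n v : Defs.inE a -> (forall v, local a (YW v)) ->
  (forall n v, YW (md Y om_ n v) = eprodn a n (YW v)) -> compat v -> compat (md Y om_ n v).
Proof.
move=> ha hl hE hv u; have [hu _ _] := fm_inM HYW u; have [hv' _ _] := fm_inM HYW v.
have hg : good a (YW u) (YW v).
  split=> //; first by case: (hv u).
  by move=> s; rewrite -hE; case: (hv (md Y om_ s u)).
rewrite hE; split; first exact: (local_eprodn charK n hg).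
move=> q; have [k Hk] := hl u; have [M0 hM] := VA_comm charK HY om_ u v n (- q - 1).
(* A common length for the sum from V, truncated at [M0], and the sum from the locality order
   [k]. *)
have hk := locord_le (leq_maxr M0 k) Hk; have := hM (maxn M0 k) (leq_maxl _ _).
have Eu x : md Y u (- q - 1) x = Y u q x by rewrite /md; congr (Y u _ x); lia.
rewrite !Eu => /(congr1 YW); rewrite YW_B YW_sum hE (proj2 (hv u)) => H.
apply/funext => M; apply/funext => w.
have {}H : eprodn a n (eprodc (YW u) (YW v) q) M w - YW (Y u q (md Y om_ n v)) M w =
    \sum_(i < maxn M0 k) gbin K n i *: eprodc (eprodn a i (YW u)) (YW v) (q - n + Posz i) M w.
  have -> : eprodn a n (eprodc (YW u) (YW v) q) M w - YW (Y u q (md Y om_ n v)) M w =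
      (eprodn a n (eprodc (YW u) (YW v) q) - YW (Y u q (md Y om_ n v))) M w by [].
  rewrite H fct_sumE fct_sumE; apply: eq_bigr => i _; rewrite YW_Z /md (proj2 (hv _)).
  rewrite -/(md Y om_ i u) hE -[LHS]/(_ *: eprodc _ _ _ M w).
  by congr (_ *: eprodc _ _ _ M w); lia.
have H2 := comm charK n q M w hg hk.
by apply: oppr_inj; apply: (addrI (eprodn a n (eprodc (YW u) (YW v) q) M w)); rewrite H H2.
Qed.

Lemma compat_all v : compat v.
Proof.
have hL := inE_Lh HW Hres; have hI := inE_Ih HW Hres.
apply: (VfrakL_ind HV (P := compat)).
- move=> u; have [[lu _] _ _] := fm_inM HYW u.
  by split; [rewrite (fm_vac HYW); exact: local_id|exact: YW_vac_mode].
- move=> a x y hx hy u; have [h1 h2] := hx u; have [h3 h4] := hy u.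
  have [hu _ _] := fm_inM HYW u; have [hx' _ _] := fm_inM HYW x; have [hy' _ _] := fm_inM HYW y.
  rewrite (fm_lin HYW); split; first by apply: local_linr => //; case: hu.
  move=> q; rewrite (eprodc_linr charK) // -h2 -h4 -(fm_lin HYW).
  by case: HY => -[h _ _ _ _] _; rewrite h.
- move=> n x hx; rewrite -mdL; apply: (@compat_step _ Lh) => //.
  + by move=> y; case: (fm_inM HYW y).
  + by move=> m y; rewrite mdL (fm_L HYW).
- move=> n x hx; rewrite -mdI; apply: (@compat_step _ Ih) => //.
  + by move=> y; case: (fm_inM HYW y).
  + by move=> m y; rewrite mdI (fm_I HYW).
Qed.

Lemma YW_phi_module : is_phi_module vac Y YW.
Proof.
split.
- by move=> u; case: (fm_inM HYW u).
- by move=> a u v k w; rewrite (fm_lin HYW).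
- by move=> k w; rewrite (fm_vac HYW).
move=> u v; have [hl hE] := compat_all v u.
have [hu _ _] := fm_inM HYW u; have [hv _ _] := fm_inM HYW v.
have [k H] := hl; exists k => w; have [N hN] := locord_trunc2 hu hv H w.
exists N; split=> // m p Q0 hQ.
have [_ _ E] := isE_at charK (finsupp_prodser (m - Posz k) w hu hv H) (eprodcP charK (m - Posz k) w
    hu hv hl).
rewrite -(@iter_expm1_ec K charK W k (fun q => YW (Y u q v) (m - Posz k) w)); last first.
  by move=> q /hQ ->; rewrite YW_0.
have -> : (fun q => YW (Y u q v) (m - Posz k) w) = fun q => eprodc (YW u) (YW v) q (m - Posz k) w.
  by apply/funext => q; rewrite hE.
rewrite E; case: ifP => hp; last by rewrite /expsum fsum0 // => i; rewrite expz_neg ?scale0r //; lia.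
by rewrite (substC_expsum m (absz p) hN); congr expsum; lia.
Qed.

(** The defining identity of a module says precisely that its modes are an expansion of the product
    series, so uniqueness of expansions applies. The clearing power provided by [YW'] may differ
    from the locality order. *)
Lemma phi_module_mode (YW' : V -> ser W) u v : is_phi_module vac Y YW' ->
  local (YW u) (YW v) -> YW' u = YW u -> YW' v = YW v ->
  forall q, YW' (Y u q v) = eprodc (YW u) (YW v) q.
Proof.
move=> [hE hlin _ /(_ u v) [k hk]] hl eu ev q; apply/funext => M; apply/funext => w.
have [hu _ _] := fm_inM HYW u; have [hv _ _] := fm_inM HYW v.
have [N [hN hid]] := hk w; rewrite eu ev in hN hid.
have z M' w' : YW' 0 M' w' = 0.
  have := hlin 1 0 0 M' w'; rewrite scaler0 addr0 scale1r => h.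
  by apply: (addrI (YW' 0 M' w')); rewrite addr0 -h.
have [Q0 hQ] : exists Q : int, forall q, q < Q -> Y u q v = 0 by case: HY => -[_ _ h _ _] _; exact: h.
have h0 r : r < Q0 -> YW' (Y u r v) M w = 0 by move=> /hQ ->.
have h1 : isE (prodser (YW u) (YW v) M w) (fun q => YW' (Y u q v) M w).
  exists k; split; [by exists Q0|exact: trunc2_finsupp hN|].
  apply/funext => p; rewrite (@iter_expm1_ec K charK W k _ Q0) //.
  have := hid (M + Posz k) p Q0 hQ; rewrite addrK => ->.
  case: ifP => hp; last by rewrite /expsum fsum0 // => i; rewrite expz_neg ?scale0r //; lia.
  by rewrite (substC_expsum _ (absz p) hN) addrK; congr expsum; lia.
by rewrite (eprodc_isE charK h1).
Qed.

Lemma YW_unique (YW' : V -> ser W) : is_phi_module vac Y YW' ->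
  YW' (Lb (-1) vac) = Lh -> YW' (Ib (-1) vac) = Ih -> forall u, YW' u = YW u.
Proof.
move=> hphi hL hI; apply: (VfrakL_ind HV (P := fun u => YW' u = YW u)).
- rewrite (fm_vac HYW); apply/funext => k; apply/funext => w.
  by case: hphi.
- move=> a u v hu hv; rewrite (fm_lin HYW) -hu -hv; apply/funext => k; apply/funext => w.
  by case: hphi.
- move=> n v hv; rewrite -mdL /md.
  have hl := proj1 (compat_all v (Lb (-1) vac)).
  rewrite (phi_module_mode hphi hl) //; first by rewrite (proj2 (compat_all v _)).
  by rewrite hL YW_Lb1.
- move=> n v hv; rewrite -mdI /md.
  have hl := proj1 (compat_all v (Ib (-1) vac)).
  rewrite (phi_module_mode hphi hl) //; first by rewrite (proj2 (compat_all v _)).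
  by rewrite hI YW_Ib1.
Qed.

Lemma YW_chain (ms ns : seq int) :
  chain_val ([seq (Ih, m) | m <- ms] ++ [seq (Lh, n) | n <- ns])
            (YW (foldr Ib (foldr Lb vac ns) ms)).
Proof.
elim: ms => [|m ms IH] /=; last first.
  exists (YW (foldr Ib (foldr Lb vac ns) ms)); split=> //; rewrite (fm_I HYW).
  by have [h1 _ h3] := fm_inM HYW (foldr Ib (foldr Lb vac ns) ms);
     apply: (eprod_eprodn charK) => //; exact: (inE_Ih HW Hres).
elim: ns => [|n ns IH] /=; first by move=> k w; rewrite (fm_vac HYW).
exists (YW (foldr Lb vac ns)); split=> //; rewrite (fm_L HYW).
by have [h1 h2 _] := fm_inM HYW (foldr Lb vac ns); apply: (eprod_eprodn charK) => //; exact: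
    (inE_Lh HW Hres).
Qed.

End Existence.

Theorem theorem2p10 (K : fieldType) (charK : [pchar K] =i pred0) (l1 l2 l3 : K)
  (V : lmodType K) (Lb Ib : int -> V -> V) (vac : V) (Y : V -> ser V)
  (HV : is_VfrakL l1 l2 l3 Lb Ib vac) (HY : is_VA vac Y)
  (HYL : forall k w, Y (Lb (-1) vac) k w = Lb (- k - 1) w)
  (HYI : forall k w, Y (Ib (-1) vac) k w = Ib (- k - 1) w)
  (W : lmodType K) (L I : int -> W -> W)
  (HW : calL_module l1 l2 l3 L I) (Hres : restricted L I) :
  exists YW : V -> ser W,
    [/\ is_phi_module vac Y YW,
     (forall k w, YW (Lb (-1) vac) k w = Lhat l1 L k w),
     (forall k w, YW (Ib (-1) vac) k w = Ihat l2 I k w),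
     (forall YW' : V -> ser W, is_phi_module vac Y YW' ->
        (forall k w, YW' (Lb (-1) vac) k w = Lhat l1 L k w) ->
        (forall k w, YW' (Ib (-1) vac) k w = Ihat l2 I k w) ->
        forall u k w, YW' u k w = YW u k w) &
     (forall ms ns : seq int,
        chain_val ([seq (Ihat l2 I, m) | m <- ms] ++ [seq (Lhat l1 L, n) | n <- ns])
                  (YW (foldr Ib (foldr Lb vac ns) ms)))].
Proof.
have [YW HYW] := fieldmap_exists charK HV HW Hres.
exists YW; split.
- exact: (YW_phi_module charK HV HY HYL HYI HW Hres HYW).
- by move=> k w; rewrite (YW_Lb1 charK HW Hres HYW).
- by move=> k w; rewrite (YW_Ib1 charK HW Hres HYW).
- move=> YW' hphi hL hI u k w.
  rewrite (YW_unique charK HV HY HYL HYI HW Hres HYW hphi) //;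
    by apply/funext => n; apply/funext => x.
- exact: (YW_chain charK HW Hres HYW).
Qed.
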